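(* Let $d\in\{1,2,3\}$ and let $X_0$ be either $H^s(\mathbb{R}^d)$ for some $s<0$, or $L^p(\mathbb{R}^d)$ for some $1\le p<2$ (spaces of $\mathbb{C}^N$-valued functions or distributions). Then the Cauchy problem for the Maxwell-Dirac system $$(-i\gamma^\mu\partial_\mu+M)\psi=A_\mu\gamma^\mu\psi,\qquad \square A_\mu=\overline{\psi}\gamma_\mu\psi\qquad(\mu=0,\dots,d)$$ with initial data $\psi(0,x)=\psi_0(x)$, $A_\mu(0,x)=a_\mu(x)$, $\partial_tA_\mu(0,x)=b_\mu(x)$ is ill posed for data $\psi_0\in X_0$, $a_\mu=b_\mu=0$ $(\mu=0,\dots,d)$, in the following precise sense. There exists $\psi_0^{\mathrm{bad}}\in X_0\setminus L^2(\mathbb{R}^d)$ such that for any $T>0$ and any neighbourhood $\Omega_0$ of $\psi_0^{\mathrm{bad}}$ in $X_0$, there does not exist a continuous map $$S\colon\Omega_0\longrightarrow\mathcal{D}'(\mathrm{Int}(K_T)),\qquad \psi_0\longmapsto S[\psi_0]=(\psi,A_\mu),$$ with the property that if $\psi_0\in\Omega_0\cap C_c^\infty(\mathbb{R}^d)$, then $S[\psi_0]$ is $C^\infty$ in $K_T$ and solves the Maxwell-Dirac system there, with initial data $\psi_0$ and $a_\mu=b_\mu=0$ in $B$.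
   Context: Setting: space-time $\mathbb{R}^{1+d}=\mathbb{R}_t\times\mathbb{R}^d_x$ with Minkowski metric $(g^{\mu\nu})=\mathrm{diag}(1,-1,\dots,-1)$, $x_0=t$, $x=(x_1,\dots,x_d)$, $\partial_\mu=\partial/\partial x_\mu$ (so $\partial_0=\partial_t$). Greek indices run over $0,\dots,d$; repeated upper and lower indices are summed. $\square=\partial_t^2-\Delta$. The spinor $\psi(t,x)$ takes values in $\mathbb{C}^N$, with $N=2$ for $d=1,2$ and $N=4$ for $d=3$; the potentials $A_\mu(t,x)$, $\mu=0,\dots,d$, are real-valued; $M\ge0$ is a fixed constant. $\gamma^0,\dots,\gamma^d$ are fixed $N\times N$ complex matrices with $\gamma^\mu\gamma^\nu+\gamma^\nu\gamma^\mu=2g^{\mu\nu}I$, $(\gamma^0)^*=\gamma^0$, $(\gamma^j)^*=-\gamma^j$ for $j=1,\dots,d$; indices are lowered with the metric: $\gamma_0=\gamma^0$, $\gamma_j=-\gamma^j$. $\psi^*$ is the conjugate transpose and $\overline\psi=\psi^*\gamma^0$. Thus $\square A_0=\psi^*\psi$ and $\square A_j=-\psi^*\gamma^0\gamma^j\psi$. $H^s(\mathbb{R}^d)$ is the usual (inhomogeneous) $L^2$-based Sobolev space. $\mathcal{D}'(U)$ is the space of distributions on the open set $U$ (here vector-valued, one component for each component of $(\psi,A_0,\dots,A_d)$). $B$ is the open unit ball in $\mathbb{R}^d$ centred at the origin; $K=\{(t,x)\in\mathbb{R}\times\mathbb{R}^d: 0\le t<1,\ |x|<1-t\}$ is the cone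 of dependence over $B$; $K_T=K\cap([0,T]\times\mathbb{R}^d)$; $\mathrm{Int}(K_T)$ is its interior. *)

(* Defs.v *)
From HB Require Import structures.
From mathcomp Require Import all_boot all_order all_algebra.
From mathcomp Require Import all_classical all_reals all_analysis.
From mathcomp Require Import complex.

Set Implicit Arguments.
Unset Strict Implicit.
Unset Printing Implicit Defensive.

Import Order.TTheory GRing.Theory Num.Theory numFieldNormedType.Exports.

Local Open Scope classical_set_scope.
Local Open Scope ring_scope.
Local Open Scope complex_scope.
Local Open Scope sesquilinear_scope.

(* R^n is 'rV[R]_n.  The library norm on it is the sup norm (same topology), so
   Euclidean lengths are written with [enorm] below. *)

Fact row_display : measure_display. Proof. by []. Qed.

Section row_measurable.
Context {R : realType} (n : nat).

Definition row_coord (i : 'I_n) (x : 'rV[R]_n) : measurableTypeR R := x ord0 i.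

Let row_set0 : g_sigma_preimage row_coord set0.
Proof. exact: sigma_algebra0. Qed.

Let row_setC A : g_sigma_preimage row_coord A -> g_sigma_preimage row_coord (~` A).
Proof. exact: sigma_algebraC. Qed.

Let row_bigcup (F : (set 'rV[R]_n)^nat) :
  (forall i, g_sigma_preimage row_coord (F i)) ->
  g_sigma_preimage row_coord (\bigcup_i F i).
Proof. exact: sigma_algebra_bigcup. Qed.

(* Borel sigma-algebra: the one generated by the coordinates. *)
HB.instance Definition _ := @isMeasurable.Build row_display 'rV[R]_n
  (g_sigma_preimage row_coord) row_set0 row_setC row_bigcup.

Lemma measurable_row_coord i : measurable_fun setT (row_coord i).
Proof.
move=> _ Y mY; rewrite setTI; apply: sub_sigma_algebra => /=.
rewrite -bigcup_seq/=; exists i => /=; first by rewrite mem_index_enum.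
by exists Y => //; rewrite setTI.
Qed.

Lemma measurable_fun_row d (T : measurableType d) (f : T -> 'rV[R]_n) :
  (forall i, measurable_fun setT (row_coord i \o f)) -> measurable_fun setT f.
Proof.
move=> mf _ A mA; rewrite setTI.
suff : g_sigma_preimage row_coord `<=` [set B | measurable (f @^-1` B)].
  exact.
apply: smallest_sub => /=.
  split => /=.
  - by rewrite preimage_set0.
  - by move=> B mB; rewrite setTD preimage_setC; exact: measurableC.
  - by move=> F mF; rewrite preimage_bigcup; exact: bigcup_measurable.
rewrite -bigcup_seq => B [i _ [C mC <-]] /=.
by rewrite setTI -comp_preimage -[X in measurable X]setTI; exact: mf.
Qed.

End row_measurable.

Section lebesgue_step.
Context {R : realType} (n : nat).
Variable mu : {sigma_finite_measure set 'rV[R]_n -> \bar R}.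

Definition row_cons (p : measurableTypeR R * 'rV[R]_n) : 'rV[R]_n.+1 :=
  row_mx (const_mx p.1 : 'rV_1) p.2.

Definition row_uncons (x : 'rV[R]_n.+1) : measurableTypeR R * 'rV[R]_n :=
  (x ord0 ord0, rsubmx (x : 'rV_(1 + n))).

Lemma row_cons0 p : row_cons p ord0 ord0 = p.1.
Proof. by rewrite mxE; case: splitP => [j _|//]; rewrite mxE. Qed.

Lemma row_consS p i : row_cons p ord0 (lift ord0 i) = p.2 ord0 i.
Proof.
rewrite mxE; case: splitP => [j /=|l /= [il]]; first by rewrite (ord1 j).
by congr (p.2 _ _); exact/val_inj.
Qed.

Lemma row_consK : cancel row_cons row_uncons.
Proof.
by case=> a y; congr pair; [exact: row_cons0 | rewrite /= row_mxKr].
Qed.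

Lemma row_unconsK : cancel row_uncons row_cons.
Proof.
move=> x; apply/rowP => j; rewrite mxE.
case: splitP => k jk; rewrite !mxE; congr (x _ _); apply/val_inj => //=.
by rewrite jk (ord1 k).
Qed.

Lemma measurable_row_cons : measurable_fun setT row_cons.
Proof.
apply: measurable_fun_row => i.
case: (unliftP ord0 i) => [k|] ->.
- rewrite (_ : _ \o _ = row_coord k \o snd).
    by apply: measurableT_comp => //; exact: measurable_row_coord.
  by apply/funext => p; exact: row_consS.
- by rewrite (_ : _ \o _ = fst) //; apply/funext => p; exact: row_cons0.
Qed.

Lemma measurable_row_uncons : measurable_fun setT row_uncons.
Proof.
apply/measurable_fun_pairP; split => /=.
  exact: (measurable_row_coord (@ord0 n)).
apply: measurable_fun_row => i.
rewrite (_ : _ \o _ = row_coord (rshift 1 i : 'I_n.+1)).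
  exact: measurable_row_coord.
by apply/funext => x; rewrite /row_coord /= mxE.
Qed.

Definition lebesgue_step : set 'rV[R]_n.+1 -> \bar R :=
  pushforward (@lebesgue_measure R \x mu)%E row_cons.

HB.instance Definition _ := Measure.copy lebesgue_step
  (measure_function_pushforward__canonical__measure_function_Measure
    (@lebesgue_measure R \x mu)%E measurable_row_cons).

Let lebesgue_step_sigma_finite : sigma_finite setT lebesgue_step.
Proof.
have /sigma_finiteP[F [TF ndF Foo]] := sigma_finiteT (@lebesgue_measure R).
have /sigma_finiteP[G [TG ndG Goo]] := sigma_finiteT mu.
exists (fun k => row_uncons @^-1` (F k `*` G k)) => [|k].
  apply/esym/seteqP; split=> // x _.
  have [i _ Fi] : (\bigcup_i F i) (row_uncons x).1 by rewrite -TF.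
  have [j _ Gj] : (\bigcup_i G i) (row_uncons x).2 by rewrite -TG.
  exists (maxn i j) => //; split.
  - by move: Fi; exact/subsetPset/ndF/leq_maxl.
  - by move: Gj; exact/subsetPset/ndG/leq_maxr.
have [mF Fk] := Foo k; have [mG Gk] := Goo k; split.
  rewrite -[X in measurable X]setTI.
  by apply: measurable_row_uncons => //; exact: measurableX.
rewrite /lebesgue_step /pushforward -comp_preimage.
rewrite (_ : _ \o _ = id); last by apply/funext => p; exact: row_consK.
by rewrite preimage_id product_measure1E// lte_mul_pinfty// ge0_fin_numE.
Qed.

HB.instance Definition _ := Measure_isSigmaFinite.Build _ _ _ lebesgue_step
  lebesgue_step_sigma_finite.

End lebesgue_step.
Fixpoint lebesgue_rV {R : realType} (n : nat) :
    {sigma_finite_measure set 'rV[R]_n -> \bar R} :=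
  if n is m.+1 then lebesgue_step (lebesgue_rV m) else \d_(0 : 'rV[R]_0).

Lemma lebesgue_rV_box (R : realType) (n : nat)
    (A : 'I_n -> set (measurableTypeR R)) :
  (forall i, measurable (A i)) ->
  lebesgue_rV n [set x : 'rV[R]_n | forall i, A i (x ord0 i)] =
  (\prod_(i < n) lebesgue_measure (A i))%E.
Proof.
elim: n A => [|n IHn] A mA /=.
  by rewrite big_ord0 diracE mem_set //= => -[].
have mB : measurable [set x : 'rV[R]_n | forall i, A (lift ord0 i) (x ord0 i)].
  rewrite (_ : [set _ | _] =
      \bigcap_(i in [set: 'I_n]) row_coord i @^-1` A (lift ord0 i)); last first.
    by apply/seteqP; split => x /= h i; [move=> _|]; exact: h.
  apply: fin_bigcap_measurable => // i _; rewrite -[X in measurable X]setTI.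
  exact: measurable_row_coord.
rewrite big_ord_recl -IHn // -product_measure1E //.
rewrite /lebesgue_step /pushforward; congr (_ _).
apply/seteqP; split => p /= => [Ap|[A0 AS] i].
  split=> [|i]; first by have := Ap ord0; rewrite row_cons0.
  by have := Ap (lift ord0 i); rewrite row_consS.
by case: (unliftP ord0 i) => [k|] ->; rewrite ?row_cons0 ?row_consS //; exact: AS.
Qed.

Section calculus.
Context {R : realType} (n : nat).
Implicit Types (U K : set 'rV[R]_n) (f g : 'rV[R]_n -> R) (h : 'rV[R]_n -> R[i]).

Definition enorm (x : 'rV[R]_n) : R := Num.sqrt (\sum_i x ord0 i ^+ 2).

Definition pd (i : 'I_n) f : 'rV[R]_n -> R := fun x => 'D_'e_i f x.

Definition pds (s : seq 'I_n) f : 'rV[R]_n -> R := foldr pd f s.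

(* Meant for open [U]: all iterated partial derivatives exist and are
   continuous on U. *)
Definition smooth U f : Prop := forall (s : seq 'I_n) (x : 'rV[R]_n), U x ->
  {for x, continuous (pds s f)} /\ forall i : 'I_n, derivable (pds s f) x 'e_i.

Definition cpd (i : 'I_n) h : 'rV[R]_n -> R[i] := fun x =>
  pd i (fun y => complex.Re (h y)) x +i* pd i (fun y => complex.Im (h y)) x.

Definition cpds (s : seq 'I_n) h : 'rV[R]_n -> R[i] := foldr cpd h s.

Definition csmooth U h : Prop :=
  smooth U (fun x => complex.Re (h x)) /\ smooth U (fun x => complex.Im (h x)).

Definition cmeasurable h : Prop :=
  measurable_fun setT (fun x => complex.Re (h x)) /\
  measurable_fun setT (fun x => complex.Im (h x)).

Definition cintegrable U h : Prop :=
  (lebesgue_rV n).-integrable U (fun x => (complex.Re (h x))%:E) /\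
  (lebesgue_rV n).-integrable U (fun x => (complex.Im (h x))%:E).

Definition cintegral U h : R[i] :=
  (\int[lebesgue_rV n]_(x in U) complex.Re (h x)) +i*
  (\int[lebesgue_rV n]_(x in U) complex.Im (h x)).

End calculus.

Notation cmod := ComplexField.Normc.normc.

Section distributions.
Context (R : realType) (n : nat).

Record test_function (U : set 'rV[R]_n) := TestFunction {
  test_fun :> 'rV[R]_n -> R[i];
  test_smooth : csmooth setT test_fun;
  test_support : exists K : set 'rV[R]_n,
    [/\ compact K, K `<=` U & forall x, ~ K x -> test_fun x = 0] }.

(* D'(U): linear forms on test functions (linearity is stated on triples
   related by chi = a phi + eta), continuous in the sense of the usual
   seminorm estimates over each compact subset of U. *)
Record schwartz_distribution (U : set 'rV[R]_n) := Distribution {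
  distribution_fun :> test_function U -> R[i];
  distribution_linear : forall (a : R[i]) (phi eta chi : test_function U),
    (forall x, chi x = a * phi x + eta x) ->
    distribution_fun chi = a * distribution_fun phi + distribution_fun eta;
  distribution_continuous : forall K : set 'rV[R]_n, compact K -> K `<=` U ->
    exists (c : R) (m : nat), forall (phi : test_function U) (b : R),
      (forall x, ~ K x -> phi x = 0) ->
      (forall (s : seq 'I_n) x, (size s <= m)%N -> cmod (cpds s phi x) <= b) ->
      cmod (distribution_fun phi) <= c * b }.

Definition is_function (U : set 'rV[R]_n) (u : schwartz_distribution U)
    (h : 'rV[R]_n -> R[i]) : Prop :=
  forall phi : test_function U, u phi = cintegral U (fun x => h x * phi x).

Record schwartz := Schwartz {
  schwartz_fun :> 'rV[R]_n -> R[i];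
  schwartz_smooth : csmooth setT schwartz_fun;
  schwartz_decay : forall (m : nat) (s : seq 'I_n), exists b : R, forall x,
    (1 + enorm x) ^+ m * cmod (cpds s schwartz_fun x) <= b }.

Record tempered := Tempered {
  tempered_fun :> schwartz -> R[i];
  tempered_linear : forall (a : R[i]) (phi eta chi : schwartz),
    (forall x, chi x = a * phi x + eta x) ->
    tempered_fun chi = a * tempered_fun phi + tempered_fun eta;
  tempered_continuous : exists (c : R) (m : nat), forall (phi : schwartz) (b : R),
    (forall (s : seq 'I_n) x, (size s <= m)%N ->
      (1 + enorm x) ^+ m * cmod (cpds s phi x) <= b) ->
    cmod (tempered_fun phi) <= c * b }.

Definition fourier (h : 'rV[R]_n -> R[i]) (xi : 'rV[R]_n) : R[i] :=
  let theta (x : 'rV[R]_n) := \sum_i x ord0 i * xi ord0 i in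
  cintegral setT (fun x => h x * (cos (theta x) -i* sin (theta x))).

End distributions.

Section data_spaces.
Context (R : realType) (d N : nat).
Implicit Types (w : 'I_N -> schwartz R d -> R[i]) (u v : 'I_N -> tempered R d).

Definition cvnorm (z : 'cV[R[i]]_N) : R :=
  Num.sqrt (\sum_k cmod (z k ord0) ^+ 2).

Definition represents (g : 'rV[R]_d -> 'cV[R[i]]_N) w : Prop :=
  forall k : 'I_N, cmeasurable (fun x => g x k ord0) /\
  forall phi : schwartz R d,
    cintegrable setT (fun x => g x k ord0 * phi x) /\
    w k phi = cintegral setT (fun x => g x k ord0 * phi x).

(* The Fourier transform of w is the function g: <w, F phi> = <g, phi>.  No
   factor 2 pi is used, which only multiplies the Sobolev norm by a constant. *)
Definition fourier_represents (g : 'rV[R]_d -> 'cV[R[i]]_N) w : Prop :=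
  forall k : 'I_N, cmeasurable (fun x => g x k ord0) /\
  forall phi phihat : schwartz R d,
    (forall xi, phihat xi = fourier phi xi) ->
    cintegrable setT (fun x => g x k ord0 * phi x) /\
    w k phihat = cintegral setT (fun x => g x k ord0 * phi x).

(* In both norms the function g is unique up to null sets when it exists, so
   the infimum is the norm of the function, and +oo if there is none. *)
Definition Lp_norm (p : R) w : \bar R :=
  ereal_inf [set 'N[lebesgue_rV d]_(p%:E)[(fun x => (cvnorm (g x))%:E)]%E |
             g in [set g | represents g w]].

Definition Hs_norm (s : R) w : \bar R :=
  ereal_inf [set 'N[lebesgue_rV d]_(2%:E)[(fun xi =>
                 ((1 + enorm xi ^+ 2) `^ (s / 2) * cvnorm (g xi))%:E)]%E |
             g in [set g | fourier_represents g w]].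

Inductive data_space := Sobolev of R | Lebesgue of R.

Definition admissible (X : data_space) : Prop :=
  match X with Sobolev s => s < 0 | Lebesgue p => 1 <= p < 2 end.

Definition data_norm (X : data_space) w : \bar R :=
  match X with Sobolev s => Hs_norm s w | Lebesgue p => Lp_norm p w end.

Definition in_space (X : data_space) u : Prop := (data_norm X u < +oo)%E.

Definition data_dist (X : data_space) u v : \bar R :=
  data_norm X (fun k phi => u k phi - v k phi).

Definition neighbourhood (X : data_space) u (Omega : set ('I_N -> tempered R d)) :
    Prop :=
  (forall v, Omega v -> in_space X v) /\
  exists2 e : R, 0 < e &
    forall v, in_space X v -> (data_dist X v u < e%:E)%E -> Omega v.

End data_spaces.

Section cones.
Context (R : realType) (d : nat).

Definition time_coord (z : 'rV[R]_d.+1) : R := z ord0 ord0.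

Definition space_coord (z : 'rV[R]_d.+1) : 'rV[R]_d := rsubmx (z : 'rV_(1 + d)).

Definition spacetime_point (t : R) (x : 'rV[R]_d) : 'rV[R]_d.+1 :=
  row_mx (const_mx t : 'rV_1) x.

Definition unit_ball : set 'rV[R]_d := [set x | enorm x < 1].

Definition cone : set 'rV[R]_d.+1 :=
  [set z | 0 <= time_coord z < 1 /\ enorm (space_coord z) < 1 - time_coord z].

Definition cone_upto (T : R) : set 'rV[R]_d.+1 :=
  cone `&` [set z | 0 <= time_coord z <= T].

End cones.

Definition spinor_dim (d : nat) : nat := if d == 3 then 4 else 2.

Section maxwell_dirac.
Context (R : realType) (d : nat).
Local Notation N := (spinor_dim d).
Local Notation spacetime := 'rV[R]_d.+1.

Definition minkowski_metric (mu nu : 'I_d.+1) : R[i] :=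
  if mu == nu then (if mu == ord0 then 1 else -1) else 0.

Definition dirac_matrices (gamma : 'I_d.+1 -> 'M[R[i]]_N) : Prop :=
  [/\ forall mu nu, gamma mu *m gamma nu + gamma nu *m gamma mu =
        (2 * minkowski_metric mu nu)%:M,
      (gamma ord0) ^t* = gamma ord0 &
      forall j : 'I_d, (gamma (lift ord0 j)) ^t* = - gamma (lift ord0 j)].

Definition lowered (gamma : 'I_d.+1 -> 'M[R[i]]_N) (mu : 'I_d.+1) : 'M[R[i]]_N :=
  \sum_nu minkowski_metric mu nu *: gamma nu.

Definition vpd (mu : 'I_d.+1) (psi : spacetime -> 'cV[R[i]]_N) (z : spacetime) :
    'cV[R[i]]_N :=
  \col_k cpd mu (fun y => psi y k ord0) z.

Definition box (f : spacetime -> R) (z : spacetime) : R :=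
  pd ord0 (pd ord0 f) z -
  \sum_(j < d) pd (lift ord0 j) (pd (lift ord0 j) f) z.

Definition dirac_eq (M : R) (gamma : 'I_d.+1 -> 'M[R[i]]_N)
    (psi : spacetime -> 'cV[R[i]]_N) (A : 'I_d.+1 -> spacetime -> R)
    (z : spacetime) : Prop :=
  - 'i%C *: (\sum_mu gamma mu *m vpd mu psi z) + M%:C *: psi z =
  \sum_mu (A mu z)%:C *: (gamma mu *m psi z).

Definition maxwell_eq (gamma : 'I_d.+1 -> 'M[R[i]]_N)
    (psi : spacetime -> 'cV[R[i]]_N) (A : 'I_d.+1 -> spacetime -> R)
    (z : spacetime) : Prop :=
  forall mu, (box (A mu) z)%:C =
    ((psi z) ^t* *m gamma ord0 *m lowered gamma mu *m psi z) ord0 ord0.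

Definition cauchy_data (psi : spacetime -> 'cV[R[i]]_N)
    (A : 'I_d.+1 -> spacetime -> R) (f : 'I_N -> 'rV[R]_d -> R[i]) : Prop :=
  forall x, unit_ball x ->
    (forall k, psi (spacetime_point 0 x) k ord0 = f k x) /\
    (forall mu, A mu (spacetime_point 0 x) = 0 /\
                pd ord0 (A mu) (spacetime_point 0 x) = 0).

(* C^oo on the non-open set K_T: restriction of a C^oo function defined on an
   open neighbourhood of it. *)
Definition smooth_on_cone (T : R) (psi : spacetime -> 'cV[R[i]]_N)
    (A : 'I_d.+1 -> spacetime -> R) : Prop :=
  exists V : set spacetime, [/\ open V, @cone_upto R d T `<=` V,
    forall k, csmooth V (fun z => psi z k ord0) & forall mu, smooth V (A mu)].

Definition fields (U : set spacetime) : Type :=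
  (('I_N -> schwartz_distribution U) * ('I_d.+1 -> schwartz_distribution U))%type.

Definition cone_interior (T : R) : set spacetime := (@cone_upto R d T)°.

(* D'(U) carries the topology of pointwise convergence on test functions.  The
   domain is a subset of a metric space and weakly convergent sequences in D'(U)
   converge strongly, so the strong topology gives the same continuous maps. *)
Definition continuous_data_map (X : data_space R) (T : R)
    (Omega : set ('I_N -> tempered R d))
    (S : ('I_N -> tempered R d) -> fields (cone_interior T)) : Prop :=
  forall u, Omega u -> forall (phi : test_function (cone_interior T)) (e : R),
    0 < e -> exists2 delta : R, 0 < delta &
    forall v, Omega v -> (data_dist X v u < delta%:E)%E ->
      (forall k, cmod ((S v).1 k phi - (S u).1 k phi) < e) /\
      (forall mu, cmod ((S v).2 mu phi - (S u).2 mu phi) < e).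

Definition solves_smooth_data (M : R) (gamma : 'I_d.+1 -> 'M[R[i]]_N) (T : R)
    (Omega : set ('I_N -> tempered R d))
    (S : ('I_N -> tempered R d) -> fields (cone_interior T)) : Prop :=
  forall (u : 'I_N -> tempered R d) (f : 'I_N -> test_function [set: 'rV[R]_d]),
    Omega u ->
    (forall k (phi : schwartz R d),
      u k phi = cintegral setT (fun x => f k x * phi x)) ->
    exists (psi : spacetime -> 'cV[R[i]]_N) (A : 'I_d.+1 -> spacetime -> R),
    [/\ smooth_on_cone T psi A,
        (forall k, is_function ((S u).1 k) (fun z => psi z k ord0)) /\
        (forall mu, is_function ((S u).2 mu) (fun z => (A mu z)%:C)),
        forall z, cone_upto T z ->
          dirac_eq M gamma psi A z /\ maxwell_eq gamma psi A z &
        cauchy_data psi A f].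

End maxwell_dirac.

(* Main.v *)
(* The charge density [j^0 = psi^* psi] belongs to a conserved current with
   [|j^k| <= j^0], whatever the potentials are.  Let [Phi (t, x) = rho t * theta (t, x)]
   be a nonnegative cut-off supported in the interior of the cone, with [theta]
   nondecreasing along future causal vectors.  Since [box A_0 = psi^* psi],
   integration by parts gives [<A_0, box Phi> = int Phi * j^0], and the divergence
   theorem bounds this integral from below by a fixed positive multiple of the charge
   that the initial spinor carries near the origin.

   The bad datum is [g = sum_k b_k], with disjointly supported bumps [b_k]
   concentrating at the origin whose L^2 norms are bounded below, while their L^p
   norms for p < 2 and their H^s norms for s < 0 decrease geometrically.  The partial
   sums [f_m] are smooth and converge to [g] in X_0, but [int f_m^2] tends to
   infinity.  Hence [<A_0, box Phi>] diverges along the solutions with data [f_m],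
   which no map that is continuous at [g] allows. *)
Require Import Defs.
From mathcomp Require Import all_boot all_order all_algebra.
From mathcomp Require Import all_classical all_reals all_analysis.
From mathcomp Require Import measurable_realfun complex ring lra.
Import Order.TTheory GRing.Theory Num.Theory numFieldNormedType.Exports.
Set Implicit Arguments.
Unset Strict Implicit.
Unset Printing Implicit Defensive.
Local Open Scope classical_set_scope.
Local Open Scope ring_scope.

(** * A class of smooth functions *)

(** The potentials are uncontrolled, so the bound may use only that they are real, which makes the
    Hamiltonian Hermitian. The fields are smooth only on a neighbourhood of the cone that depends on
    the datum; hence every integration carries a compactly supported weight. The test function has
    to vanish near [t = 0], the only time at which the spinor is known. The conserved current
    carries the initial charge forward into the support of [rho], and [theta] widens at unit speed,
    so that charge leaving sideways cannot spoil the bound. Weights and bumps are products over the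
    coordinates: [|j^k| <= j^0] is used for each [k] separately, and integrals and Fourier
    transforms then factor. Times up to 1/16 and coordinates up to 1/8 keep the weight inside the
    cone when [d <= 3], and the bumps sit in the cube [(0, 1/32)^d], where [theta (0, .)] is bounded
    below. One datum serves all spaces [X], and continuity is applied at this datum alone, against a
    single test function. *)

Section directional_derivatives.
Context {R : realType} {V : normedModType R}.
Implicit Types (f : V -> R) (g : R -> R) (x v : V).

(** The hypotheses on the fields provide directional derivatives only. Along a line the one-variable
    chain rule applies, and this equivalence carries it back. *)
Lemma is_derive_line f x v df :
  is_derive x v f df <-> is_derive (0 : R) 1 (fun t : R => f (t *: v + x)) df.
Proof.
have E : (fun h : R => h^-1 *: ((f \o shift x) (h *: v) - f x)) =
   (fun h : R => h^-1 *: (((fun t : R => f (t *: v + x)) \o shift (0 : R))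
      (h *: (1 : R)) - f (0 *: v + x))).
  by apply/funext => h /=; rewrite addr0 scale0r add0r [_%:A]mulr1.
split=> -[fd fv]; split.
- by move: fd; rewrite /derivable E.
- by move: fv; rewrite /derive E.
- by move: fd; rewrite /derivable E.
- by move: fv; rewrite /derive E.
Qed.

Lemma is_derive_outer g f x v (dg df : R) :
  is_derive (f x) 1 g dg -> is_derive x v f df ->
  is_derive x v (fun y => g (f y)) (dg * df).
Proof.
move=> gd /is_derive_line fd; apply/is_derive_line.
have gd' : is_derive (f (0 *: v + x)) 1 g dg by rewrite scale0r add0r.
exact: (@is_derive1_comp _ g (fun t : R => f (t *: v + x)) 0 dg df gd' fd).
Qed.

Lemma is_deriveMr f k x v (df dg : R) :
  is_derive x v f df -> is_derive x v k dg ->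
  is_derive x v (fun y => f y * k y) (df * k x + f x * dg).
Proof.
move=> fd gd; have := @is_deriveM _ _ f k x v df dg fd gd.
by rewrite [X in is_derive _ _ _ X](_ : _ = df * k x + f x * dg) //= addrC mulrC.
Qed.

End directional_derivatives.

(** * Flat functions built from [exp (-1/u)] *)

Section flat.
Context {R : realType}.
Implicit Types (p : {poly R}) (u v : R).

(* Derivatives of [u |-> exp (-1/u)] for [u > 0] have this form; the class is
   closed under differentiation by [p |-> (p - p') X^2]. *)
Definition flat p u : R := if 0 < u then p.[u^-1] * expR (- u^-1) else 0.

Definition dflat p := (p - p^`()) * 'X^2.

Lemma horner_expRN_bounded p :
  exists2 C : R, 0 <= C & forall v, 0 <= v -> `|p.[v]| * expR (- v) <= C.
Proof.
(* Deliberately crude: [1 + v^n / n! <= exp v] for [n > 0] gives [v^n exp (-v) <= n!], and [D]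
   leaves room for [n = 0]. *)
pose D (n : nat) : R := n.+1`!%:R + 1.
have Xn n v : 0 <= v -> v ^+ n * expR (- v) <= D n.
  move=> v0; case: n => [|n].
    rewrite expr0 mul1r /D (@le_trans _ _ 1) ?lerDr //.
    by rewrite expR_le1 oppr_le0.
  have := expR_ge1Dxn n v0; rewrite expRN => h.
  have e0 := expR_gt0 v.
  rewrite ler_pdivrMr //.
  have f0 : 0 < n.+1`!%:R :> R by rewrite ltr0n fact_gt0.
  have : v ^+ n.+1 / n.+1`!%:R <= expR v by lra.
  rewrite ler_pdivrMr // => /le_trans; apply.
  rewrite mulrC ler_pM2r // /D (_ : n.+2`!%:R = n.+2%:R * n.+1`!%:R :> R).
    by rewrite -[leLHS]mul1r -[leLHS]addr0 lerD // ler_pM // ?ler1n.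
  by rewrite -natrM.
exists (\sum_(i < size p) `|p`_i| * D i).
  by apply: sumr_ge0 => i _; rewrite mulr_ge0 // /D addr_ge0.
move=> v v0; rewrite horner_coef.
apply: (@le_trans _ _ (\sum_(i < size p) `|p`_i| * (v ^+ i * expR (- v)))).
  under [leRHS]eq_bigr do rewrite mulrA.
  rewrite -mulr_suml ler_wpM2r ?expR_ge0 //.
  apply: (le_trans (ler_norm_sum _ _ _)); apply: ler_sum => i _.
  by rewrite normrM [`|v ^+ i|]ger0_norm // exprn_ge0.
by apply: ler_sum => i _; rewrite ler_wpM2l // Xn.
Qed.

Lemma flat_le0 p u : u <= 0 -> flat p u = 0.
Proof. by rewrite /flat => /le_gtF ->. Qed.

(** The previous bound for [p * X^2] absorbs a factor [u^-2]. Quadratic vanishing is what makes the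
    difference quotient at 0 tend to 0. *)
Lemma flat_quadratic p : exists2 C : R, 0 <= C & forall u, `|flat p u| <= C * u ^+ 2.
Proof.
have [C C0 hC] := horner_expRN_bounded (p * 'X^2).
exists C => // u; rewrite /flat; case: ltP => u0; last first.
  by rewrite normr0 mulr_ge0 // sqr_ge0.
have uV0 : 0 <= u^-1 by rewrite invr_ge0 ltW.
have := hC u^-1 uV0.
rewrite hornerM hornerXn !normrM [`|expR _|]ger0_norm ?expR_ge0 //.
rewrite (ger0_norm uV0) -expr2 => h.
rewrite -ler_pdivrMr ?exprn_gt0 // -exprVn.
by apply: le_trans h; rewrite mulrAC.
Qed.

Lemma is_derive_flat p u : is_derive u 1 (flat p) (flat (dflat p) u).
Proof.
have [u0|u0|->] := ltgtP u 0.
- rewrite [X in is_derive _ _ _ X]flat_le0; last exact: ltW.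
  apply: (@near_eq_is_derive _ _ _ (cst 0)) => //.
  + by near=> y; rewrite flat_le0 // ltW //; near: y; exact: lt_nbhsl.
- rewrite {2}/flat u0 /dflat.
  apply: (@near_eq_is_derive _ _ _ (fun u => p.[u^-1] * expR (- u^-1))) => //.
  + by near=> y; rewrite /flat ifT //; near: y; exact: lt_nbhsr.
  have iV : is_derive u 1 (fun y : R => y^-1) (- u ^- 2).
    have := @is_deriveV R id u 1 1; rewrite /= => /(_ (lt0r_neq0 u0)).
    by move=> /(_ (is_derive_id _ _)); rewrite [_%:A]mulr1.
  have iNV : is_derive u 1 (fun y : R => - y^-1) (u ^- 2).
    by have := @is_deriveN _ _ _ _ _ _ _ iV; rewrite opprK.
  have h1 : is_derive u 1 (fun y : R => p.[y^-1]) (p^`().[u^-1] * - u ^- 2).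
    exact: is_derive_outer.
  have h2 : is_derive u 1 (fun y : R => expR (- y^-1)) (expR (- u^-1) * u ^- 2).
    exact: is_derive_outer.
  apply: is_derive_eq (is_deriveMr h1 h2) _.
  rewrite hornerM hornerD hornerN hornerXn exprVn; ring.
- rewrite [X in is_derive _ _ _ X]flat_le0 //.
  have [C C0 hC] := flat_quadratic p.
  have C1 : 0 < C + 1 by lra.
  have cv : (fun h => h^-1 *: ((flat p \o shift (0 : R)) (h *: (1 : R)) - flat p 0)) @ 0^' --> (0 : R).
    apply/cvgr0Pnorm_le => e e0.
    near=> h.
    have h0 : h != 0 by near: h; exact: nbhs_dnbhs_neq.
    rewrite /= addr0 [_%:A]mulr1 (@flat_le0 _ 0) // subr0 normrM normfV.
    rewrite ler_pdivrMl ?normr_gt0 //.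
    apply: (le_trans (hC h)).
    rewrite -real_normK ?num_real // expr2 mulrCA ler_wpM2l //.
    have : `|h| <= e / (C + 1).
      by near: h; apply: dnbhs0_le; rewrite divr_gt0.
    rewrite ler_pdivlMr // => hh.
    apply: le_trans hh; rewrite mulrC ler_wpM2l //; lra.
  split; first by apply/cvg_ex; exists 0.
  exact/cvg_lim.
Unshelve. all: by end_near. Qed.

Lemma continuous_flat p : continuous (flat p).
Proof.
move=> u; apply: differentiable_continuous; apply/derivable1_diffP.
by have [] := is_derive_flat p u.
Qed.

Definition bump_half : R -> R := flat 1.

Lemma bump_halfE u : bump_half u = if 0 < u then expR (- u^-1) else 0.
Proof. by rewrite /bump_half /flat hornerC mul1r. Qed.

Lemma bump_half_ge0 u : 0 <= bump_half u.
Proof. by rewrite bump_halfE; case: ifP => // _; exact: expR_ge0. Qed.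

Lemma bump_half_gt0 u : 0 < u -> 0 < bump_half u.
Proof. by move=> u0; rewrite bump_halfE u0 expR_gt0. Qed.

Lemma bump_half_le1 u : bump_half u <= 1.
Proof.
rewrite bump_halfE; case: ifP => // u0.
by rewrite expR_le1 oppr_le0 invr_ge0 ltW.
Qed.

Lemma bump_half_mono : {homo bump_half : u v / u <= v}.
Proof.
move=> u v uv; rewrite !bump_halfE; case: ifP => u0; last by case: ifP; rewrite ?expR_ge0.
rewrite (lt_le_trans u0 uv) ler_expR lerN2 lef_pV2 //.
by rewrite posrE (lt_le_trans u0 uv).
Qed.

Lemma dflat1_ge0 u : 0 <= flat (dflat 1) u.
Proof.
rewrite /flat /dflat; case: ifP => // u0.
by rewrite derivC subr0 mul1r hornerXn mulr_ge0 ?expR_ge0 ?sqr_ge0.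
Qed.

Lemma flat_bounded p : exists2 C : R, 0 <= C & forall u, `|flat p u| <= C.
Proof.
have [C C0 hC] := horner_expRN_bounded p; exists C => // u; rewrite /flat.
case: ifP => u0; last by rewrite normr0.
rewrite normrM [`|expR _|]ger0_norm ?expR_ge0 //; apply: hC.
by rewrite invr_ge0 ltW.
Qed.

End flat.

(** * Functions generated by coordinates and flat functions *)

Section smooth_class.
Context {R : realType} {n : nat}.
Implicit Types (f g : 'rV[R]_n -> R).

Lemma is_derive_coord i (x v : 'rV[R]_n) :
  is_derive x v (fun y : 'rV[R]_n => y ord0 i) (v ord0 i).
Proof.
apply/is_derive_line.
rewrite (_ : (fun t => _) = (fun t => v ord0 i * t + x ord0 i)); last first.
  by apply/funext => t; rewrite !mxE mulrC.
have h1 := is_deriveMr (is_derive_cst (v ord0 i) (0 : R) 1) (is_derive_id (0 : R) 1).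
have := is_deriveD h1 (is_derive_cst (x ord0 i) (0 : R) 1).
by rewrite mul0r add0r addr0 mulr1.
Qed.

(* A class of smooth functions that is closed under partial derivatives and
   contains every weight, test function and initial datum of the argument. *)
Inductive flatgen : ('rV[R]_n -> R) -> Prop :=
| flatgen_cst a : flatgen (fun _ => a)
| flatgen_coord i : flatgen (fun x => x ord0 i)
| flatgen_add f g : flatgen f -> flatgen g -> flatgen (fun x => f x + g x)
| flatgen_mul f g : flatgen f -> flatgen g -> flatgen (fun x => f x * g x)
| flatgen_flat p f : flatgen f -> flatgen (fun x => flat p (f x)).

Lemma flatgen_derive f : flatgen f -> forall v : 'rV[R]_n, exists2 g, flatgen g &
  forall x, is_derive x v f (g x).
Proof.
move=> F v; elim: F => {f} [a|i|f1 f2 F1 [d1 D1 h1] F2 [d2 D2 h2]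
  |f1 f2 F1 [d1 D1 h1] F2 [d2 D2 h2]|p f F [d D h]].
- by exists (fun=> 0) => [|x]; [exact: flatgen_cst|exact: is_derive_cst].
- by exists (fun=> v ord0 i) => [|x]; [exact: flatgen_cst|exact: is_derive_coord].
- by exists (fun x => d1 x + d2 x) => [|x]; [exact: flatgen_add|exact: is_deriveD].
- exists (fun x => d1 x * f2 x + f1 x * d2 x) => [|x]; last exact: is_deriveMr.
  by apply: flatgen_add; exact: flatgen_mul.
- exists (fun x => flat (dflat p) (f x) * d x) => [|x].
    by apply: flatgen_mul => //; exact: flatgen_flat.
  by apply: is_derive_outer => //; exact: is_derive_flat.
Qed.

Lemma flatgen_continuous f : flatgen f -> continuous f.
Proof.
elim=> {f} [a|i|f g _ cf _ cg|f g _ cf _ cg|p f _ cf] x.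
- exact: cst_continuous.
- exact: coord_continuous.
- exact: (@continuousD _ _ _ f g x (cf x) (cg x)).
- exact: (@continuousM _ _ f g x (cf x) (cg x)).
- rewrite (_ : (fun x => _) = flat p \o f) //.
  by apply: continuous_comp; [exact: cf|exact: continuous_flat].
Qed.

Lemma flatgen_pd f i : flatgen f -> flatgen (pd i f).
Proof.
move=> F; have [g G h] := flatgen_derive F 'e_i.
rewrite (_ : pd i f = g) //; apply/funext => x; exact: derive_val.
Qed.

Lemma flatgen_pds s f : flatgen f -> flatgen (pds s f).
Proof. by move=> F; elim: s => //= i s IH; exact: flatgen_pd. Qed.

Lemma flatgen_derivable f : flatgen f -> forall x v, derivable f x v.
Proof. by move=> F x v; have [g _ /(_ x)[]] := flatgen_derive F v. Qed.

Lemma flatgen_smooth U f : flatgen f -> smooth U f.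
Proof.
move=> F s x _; split; first exact/flatgen_continuous/flatgen_pds.
by move=> i; exact/flatgen_derivable/flatgen_pds.
Qed.

Lemma flatgen_opp f : flatgen f -> flatgen (fun x => - f x).
Proof.
move=> F; rewrite (_ : (fun x => _) = (fun x => -1 * f x)).
  by apply: flatgen_mul => //; exact: flatgen_cst.
by apply/funext => x; rewrite mulN1r.
Qed.

Lemma flatgen_sum I (s : seq I) (F : I -> 'rV[R]_n -> R) :
  (forall i, flatgen (F i)) -> flatgen (fun x => \sum_(i <- s) F i x).
Proof.
move=> H; elim: s => [|i s IH].
  by under eq_fun do rewrite big_nil; exact: flatgen_cst.
by under eq_fun do rewrite big_cons; exact: flatgen_add.
Qed.

Lemma flatgen_prod I (s : seq I) (F : I -> 'rV[R]_n -> R) :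
  (forall i, flatgen (F i)) -> flatgen (fun x => \prod_(i <- s) F i x).
Proof.
move=> H; elim: s => [|i s IH].
  by under eq_fun do rewrite big_nil; exact: flatgen_cst.
by under eq_fun do rewrite big_cons; exact: flatgen_mul.
Qed.

(** Linearity in the direction, by induction over the class. It lets a contraction of a gradient
    with the current be read as one derivative along a causal vector. *)
Lemma flatgen_derive_sum f : flatgen f ->
  forall x v, 'D_v f x = \sum_i v ord0 i * pd i f x.
Proof.
move=> F x v; elim: F => {f} [a|i|f g F Ef G Eg|f g F Ef G Eg|p f F Ef].
- rewrite derive_cst big1 // => i _; rewrite /pd derive_cst mulr0 //.
- rewrite (derive_val (is_derive := is_derive_coord i x v)).
  rewrite (bigD1 i) //= big1 ?addr0 => [|j ji].
    by rewrite /pd (derive_val (is_derive := is_derive_coord i x 'e_i)) mxE !eqxx mulr1.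
  rewrite /pd (derive_val (is_derive := is_derive_coord i x 'e_j)) mxE eqxx /=.
  by rewrite eq_sym (negPf ji) mulr0.
- have E u : 'D_u (fun x => f x + g x) x = 'D_u f x + 'D_u g x.
    by apply: deriveD; exact: flatgen_derivable.
  rewrite E Ef Eg -big_split /=; apply: eq_bigr => i _.
  by rewrite /pd E mulrDr.
- have E u : 'D_u (fun x => f x * g x) x = 'D_u f x * g x + f x * 'D_u g x.
    apply: derive_val; apply: is_deriveMr; apply/derivableP; exact: flatgen_derivable.
  rewrite E Ef Eg mulr_suml mulr_sumr -big_split /=; apply: eq_bigr => i _.
  by rewrite /pd E mulrDr !mulrA (mulrC (f x)).
- have E u : 'D_u (fun x => flat p (f x)) x = flat (dflat p) (f x) * 'D_u f x.
    apply: derive_val; apply: is_derive_outer; first exact: is_derive_flat.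
    by apply/derivableP; exact: flatgen_derivable.
  rewrite E Ef mulr_sumr; apply: eq_bigr => i _.
  by rewrite /pd E mulrCA.
Qed.

End smooth_class.

(** * Lebesgue measure on R^n *)

Section borel_rV.
Context {R : realType} {n : nat}.

(** Links the topology to the sigma-algebra generated by the coordinates: an open set is the
    countable union of the cubes with rational centre and half-width [1/(m+1)] that it contains. *)
Lemma open_measurable_rV (U : set 'rV[R]_n) : open U -> measurable U.
Proof.
move=> oU.
pose Bx (p : 'rV[rat]_n * nat) := [set x : 'rV[R]_n |
  forall i, `|x ord0 i - ratr (p.1 ord0 i)| < p.2.+1%:R^-1].
pose F p := if `[< Bx p `<=` U >] then Bx p else set0.
have -> : U = \bigcup_p F p.
  apply/seteqP; split=> [x Ux|x [p _]]; last first.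
    by rewrite /F; case: asboolP => // pU; exact: pU.
  move: oU; rewrite openE => /(_ _ Ux) /nbhs_ballP[e e0 xeU].
  have e20 : 0 < e / 2 by rewrite divr_gt0.
  pose m := Num.bound (e / 2)^-1.
  have m0 : 0 < m.+1%:R^-1 :> R by rewrite invr_gt0.
  have me : m.+1%:R^-1 < e / 2.
    rewrite -[ltRHS]invrK ltf_pV2 ?posrE ?invr_gt0 //.
    apply: (lt_le_trans (archi_boundP _)); first by rewrite invr_ge0 ltW.
    by rewrite ler_nat.
  have /choice[q hq] : forall i, exists q : rat, `|x ord0 i - ratr q| < m.+1%:R^-1.
    move=> i; have [|q] := @rat_in_itvoo R (x ord0 i) (x ord0 i + m.+1%:R^-1).
      by rewrite ltrDl.
    rewrite in_itv /= => /andP[q1 q2]; exists q.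
    by rewrite distrC ger0_norm ?subr_ge0 ?(ltW q1) // ltrBlDl.
  exists (\row_i q i, m) => //.
  rewrite /F; case: asboolP => [_ i /=|[]]; first by rewrite mxE.
  move=> y yB; apply: xeU; split => // i j; rewrite (ord1 i).
  have := yB j; rewrite /= mxE => yq; have xq := hq j.
  rewrite /ball /= (splitr e) -(subrKA (ratr (q j))).
  by rewrite (le_lt_trans (ler_normD _ _)) // ltrD // ?(lt_trans xq) // distrC (lt_trans yq).
apply: countable_bigcupT_measurable => [|p]; first exact: countableP.
rewrite /F; case: ifP => // _.
rewrite (_ : Bx p = \bigcap_(i in [set: 'I_n]) row_coord i @^-1`
    [set t | `|t - ratr (p.1 ord0 i)| < p.2.+1%:R^-1]); last first.
  by apply/seteqP; split => x /= h i; [move=> _|]; exact: h.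
apply: fin_bigcap_measurable => // i _; rewrite -[X in measurable X]setTI.
apply: measurable_row_coord => //.
apply: open_measurable; rewrite (_ : [set _ | _] = ball (ratr (p.1 ord0 i) : R) p.2.+1%:R^-1).
  exact: ball_open.
by apply/seteqP; split => t /=; rewrite /ball /= distrC.
Qed.

Lemma continuous_measurable_rV (f : 'rV[R]_n -> measurableTypeR R) :
  continuous (f : 'rV[R]_n -> R) -> measurable_fun setT f.
Proof.
move=> cf; apply: (measurability _ (RGenOInfty.measurableE R)) => _ [_ [a ->] <-].
rewrite setTI; apply: open_measurable_rV; apply: open_comp => [x _|]; first exact: cf.
exact: interval_open.
Qed.

End borel_rV.

(** * Slices and iterated integrals *)

Section slices.
Context {R : realType} {n : nat}.
Local Notation cons t x := (@row_cons R n (t, x)).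

Lemma scale_delta0 (h : R) : h *: 'e_ord0 = cons h 0.
Proof.
apply/rowP => j; case: (unliftP ord0 j) => [k|] ->; rewrite ?row_consS ?row_cons0 !mxE.
  by rewrite /= mulr0.
by rewrite eqxx mulr1.
Qed.

Lemma scale_deltaS (h : R) (j : 'I_n) : h *: 'e_(lift ord0 j) = cons 0 (h *: 'e_j).
Proof.
apply/rowP => k; case: (unliftP ord0 k) => [l|] ->; rewrite ?row_consS ?row_cons0 !mxE.
  by rewrite (inj_eq lift_inj).
by rewrite /= mulr0.
Qed.

Lemma row_consD (s t : R) (x y : 'rV[R]_n) : cons s x + cons t y = cons (s + t) (x + y).
Proof.
apply/rowP => k; rewrite mxE.
by case: (unliftP ord0 k) => [l|] ->; rewrite ?row_consS ?row_cons0 // mxE.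
Qed.

(** The difference quotients are literally the same functions of [h], so derivability and partial
    derivatives both pass to slices. *)
Lemma slice0_quotient (F : 'rV[R]_n.+1 -> R) (t : R) (x : 'rV[R]_n) :
  (fun h : R => h^-1 *: ((F \o shift (cons t x)) (h *: 'e_ord0) - F (cons t x))) =
  (fun h : R => h^-1 *: (((fun s => F (cons s x)) \o shift t) (h *: (1 : R)) - F (cons t x))).
Proof.
by apply/funext => h /=; rewrite scale_delta0 row_consD add0r [_%:A]mulr1.
Qed.

Lemma sliceS_quotient (F : 'rV[R]_n.+1 -> R) (t : R) (x : 'rV[R]_n) (j : 'I_n) :
  (fun h : R => h^-1 *: ((F \o shift (cons t x)) (h *: 'e_(lift ord0 j)) - F (cons t x))) =
  (fun h : R => h^-1 *: (((fun y => F (cons t y)) \o shift x) (h *: 'e_j) - F (cons t x))).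
Proof.
by apply/funext => h /=; rewrite scale_deltaS row_consD add0r.
Qed.

Lemma derivable_slice0 F t x :
  derivable F (cons t x) 'e_ord0 = derivable (fun s => F (cons s x) : R) t 1.
Proof. by rewrite /derivable slice0_quotient. Qed.

Lemma pd_slice0 F t x : pd ord0 F (cons t x) = 'D_1 (fun s => F (cons s x)) t.
Proof. by rewrite /pd /derive slice0_quotient. Qed.

Lemma derivable_sliceS F t x j :
  derivable F (cons t x) 'e_(lift ord0 j) = derivable (fun y => F (cons t y) : R) x 'e_j.
Proof. by rewrite /derivable sliceS_quotient. Qed.

Lemma pd_sliceS F t x j : pd (lift ord0 j) F (cons t x) = pd j (fun y => F (cons t y)) x.
Proof. by rewrite /pd /derive sliceS_quotient. Qed.

Lemma row_cons_continuousr t : continuous (fun x : 'rV[R]_n => cons t x).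
Proof.
move=> x A /nbhs_ballP[e e0 eA]; apply/nbhs_ballP; exists e => // y [_ xy]; apply: eA.
split => // i j; rewrite (ord1 i) {i}.
by case: (unliftP ord0 j) => [k|] ->; rewrite ?row_consS ?row_cons0; [exact: xy|exact: ballxx].
Qed.

Lemma row_cons_continuousl x : continuous (fun t : R => cons t x).
Proof.
move=> t A /nbhs_ballP[e e0 eA]; apply/nbhs_ballP; exists e => // s ts; apply: eA.
split => // i j; rewrite (ord1 i) {i}.
by case: (unliftP ord0 j) => [k|] ->; rewrite ?row_consS ?row_cons0; [exact: ballxx|exact: ts].
Qed.

End slices.

Section iterated_integrals.
Context {R : realType} {n : nat}.
Local Open Scope ereal_scope.
Local Notation leb := (@lebesgue_measure R).
Local Notation cons t x := (@row_cons R n (t, x)).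

Lemma ge0_integral_rVS (f : 'rV[R]_n.+1 -> \bar R) :
  measurable_fun setT f -> (forall x, 0 <= f x) ->
  \int[lebesgue_rV n.+1]_z f z = \int[leb]_t \int[lebesgue_rV n]_x f (cons t x).
Proof.
move=> mf f0.
rewrite (ge0_integral_pushforward (@measurable_row_cons R n)) //=.
rewrite preimage_setT fubini_tonelli1 //.
by apply: measurableT_comp => //; exact: measurable_row_cons.
Qed.

Lemma integrable_rVS (f : 'rV[R]_n.+1 -> \bar R) :
  (lebesgue_rV n.+1).-integrable setT f ->
  (leb \x lebesgue_rV n).-integrable setT (f \o @row_cons R n).
Proof.
move=> /integrableP[mf foo]; apply/integrableP; split.
  exact: (measurableT_comp mf (@measurable_row_cons R n)).
move: foo; rewrite (ge0_integral_pushforward (@measurable_row_cons R n)) //=.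
exact: measurableT_comp.
Qed.

Lemma integral_rVS12 (f : 'rV[R]_n.+1 -> \bar R) :
  (lebesgue_rV n.+1).-integrable setT f ->
  \int[lebesgue_rV n.+1]_z f z = \int[leb]_t \int[lebesgue_rV n]_x f (cons t x).
Proof.
move=> fi; rewrite (integral_pushforward (@measurable_row_cons R n)) //=.
- by rewrite preimage_setT -integral12_prod_meas1 //; exact: integrable_rVS.
- exact: measurable_int fi.
- by rewrite preimage_setT; exact: integrable_rVS.
Qed.

Lemma integral_rVS21 (f : 'rV[R]_n.+1 -> \bar R) :
  (lebesgue_rV n.+1).-integrable setT f ->
  \int[lebesgue_rV n.+1]_z f z = \int[lebesgue_rV n]_x \int[leb]_t f (cons t x).
Proof.
move=> fi; rewrite (integral_pushforward (@measurable_row_cons R n)) //=.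
- by rewrite preimage_setT -integral21_prod_meas1 //; exact: integrable_rVS.
- exact: measurable_int fi.
- by rewrite preimage_setT; exact: integrable_rVS.
Qed.

End iterated_integrals.

(** Supports are recorded through cubes because slices of cubes are cubes, which feeds the
    inductions on the dimension. *)
Definition rbox {R : realType} n (L : R) : set 'rV[R]_n :=
  [set x | forall i, `|x ord0 i| <= L].
Arguments rbox {R} n L _.

(** * Product integrals and functions supported in a cube *)

Section boxes.
Context {R : realType}.
Local Notation leb := (@lebesgue_measure R).

Lemma ge0_integral_rV_prod n (v : R -> R) :
  measurable_fun setT (v : measurableTypeR R -> measurableTypeR R) ->
  (forall t, 0 <= v t) ->
  (\int[lebesgue_rV n]_x (\prod_(i < n) v (x ord0 i))%:E =
   \prod_(i < n) \int[leb]_t (v t)%:E)%E.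
Proof.
move=> mv v0.
have mP m : measurable_fun setT
    (fun x : 'rV[R]_m => (\prod_(i < m) v (x ord0 i))%:E).
  apply/measurable_EFinP; apply: measurable_prod => i _.
  by apply: (measurableT_comp mv); exact: measurable_row_coord.
have P0 m (x : 'rV[R]_m) : (0 <= (\prod_(i < m) v (x ord0 i))%:E)%E.
  by rewrite lee_fin prodr_ge0.
elim: n => [|n IH].
  rewrite big_ord0; under eq_integral do rewrite big_ord0.
  by rewrite integral_dirac // diracT mul1e.
rewrite ge0_integral_rVS //.
transitivity (\int[leb]_t ((v t)%:E * \prod_(i < n) \int[leb]_t (v t)%:E))%E.
  apply: eq_integral => t _.
  under eq_integral => x _.
    rewrite big_ord_recl row_cons0 /=.
    under eq_bigr do rewrite row_consS /=.
    rewrite EFinM; over.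
  rewrite ge0_integralZl // -?IH //; last by rewrite lee_fin.
    exact: mP.
  by move=> x _; exact: P0.
rewrite ge0_integralZr ?big_ord_recl //.
- exact/measurable_EFinP.
- by move=> t _; rewrite lee_fin.
- by apply: prode_ge0 => i _; apply: integral_ge0 => t _; rewrite lee_fin.
Qed.

Lemma rboxE n (L : R) : rbox n L =
  [set x : 'rV[R]_n | forall i, ([set` `[- L, L]] : set (measurableTypeR R)) (x ord0 i)].
Proof.
by apply/seteqP; split => x /= h i; have := h i; rewrite /= in_itv /= ler_norml.
Qed.

Lemma measurable_rbox n (L : R) : measurable (rbox n L).
Proof.
rewrite rboxE (_ : [set x | _] = \bigcap_(i in [set: 'I_n]) row_coord i @^-1`
    [set` `[- L, L]]); last first.
  by apply/seteqP; split => x /= h i; [move=> _|]; exact: h.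
apply: fin_bigcap_measurable => // i _; rewrite -[X in measurable X]setTI.
exact: measurable_row_coord.
Qed.

Lemma lebesgue_rbox_lty n (L : R) : (lebesgue_rV n (rbox n L) < +oo)%E.
Proof.
rewrite rboxE (@lebesgue_rV_box R n (fun=> [set` `[- L, L]])) //.
rewrite (eq_bigr (fun=> (fine (leb [set` `[- L, L]]))%:E)).
  by rewrite prodEFin ltry.
move=> i _; rewrite fineK // lebesgue_measure_itv /=.
by case: ifP.
Qed.

Lemma integrable_rbox n (f : 'rV[R]_n -> R) (L C : R) :
  measurable_fun setT (f : _ -> measurableTypeR R) ->
  (forall x, `|f x| <= C) -> (forall x, ~ rbox n L x -> f x = 0) ->
  (lebesgue_rV n).-integrable setT (EFin \o f).
Proof.
move=> mf fC f0.
have -> : EFin \o f = (EFin \o f) \_ (rbox n L).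
  apply/funext => x; rewrite patchE; case: ifPn => // /negP; rewrite in_setE => h.
  by rewrite /= f0.
rewrite -integrable_mkcond; last exact: measurable_rbox.
apply: measurable_bounded_integrable.
- exact: measurable_rbox.
- exact: lebesgue_rbox_lty.
- exact: measurable_funTS.
- exists C; split; first exact: num_real.
  by move=> y Cy x _; rewrite /= (le_trans (fC x)) // ltW.
Qed.

Lemma compact_rbox n (L : R) : compact (rbox n L).
Proof.
rewrite rboxE.
have := @rV_compact R n (fun=> [set` `[- L, L]]).
by apply => _; exact: segment_compact.
Qed.

Lemma bounded_rbox n (f : 'rV[R]_n -> R) (L : R) :
  continuous f -> (forall x, ~ rbox n L x -> f x = 0) ->
  exists2 C : R, 0 <= C & forall x, `|f x| <= C.
Proof.
move=> cf f0.
have cpt : compact (f @` rbox n L).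
  apply: continuous_compact; last exact: compact_rbox.
  exact: continuous_subspaceT.
have [M [_ hM]] := compact_bounded cpt.
exists (`|M| + 1); first by rewrite addr_ge0.
move=> x; have [xL|xL] := pselect (rbox n L x).
  by apply: (hM (`|M| + 1)); [rewrite (le_lt_trans (ler_norm M)) // ltrDl|exists x].
by rewrite f0 // normr0 addr_ge0.
Qed.

Lemma integrable_continuous_rbox n (f : 'rV[R]_n -> R) (L : R) :
  continuous f -> (forall x, ~ rbox n L x -> f x = 0) ->
  (lebesgue_rV n).-integrable setT (EFin \o f).
Proof.
move=> cf f0; have [C _ fC] := bounded_rbox cf f0.
exact: (integrable_rbox (continuous_measurable_rV cf) fC f0).
Qed.

End boxes.

(** * Integrals of derivatives of compactly supported functions *)

Section integration_by_parts.
Context {R : realType}.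
Local Notation leb := (@lebesgue_measure R).

Lemma derive_near0 {V : normedModType R} (f : V -> R) (x v : V) :
  (\forall y \near x, f y = 0) -> 'D_v f x = 0.
Proof.
move=> f0; rewrite (@near_eq_derive _ _ _ _ (cst 0)); last exact: f0.
exact: derive_cst.
Qed.

Lemma integral_derive_eq0 (f : R -> R) (L : R) :
  (forall t, derivable f t 1) -> continuous (fun t => 'D_1 f t) ->
  (forall t, L < `|t| -> f t = 0) -> (\int[leb]_t ('D_1 f t)%:E = 0)%E.
Proof.
move=> df cf f0.
(* [L] is arbitrary; this [K] is positive and exceeds [L], so [f] vanishes at both endpoints. *)
pose K : R := `|L| + 1.
have LK : L < K by rewrite (le_lt_trans (ler_norm L)) // ltrDl.
have K0 : 0 < K by rewrite ltr_wpDl.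
have -> : (\int[leb]_t ('D_1 f t)%:E = \int[leb]_(t in [set` `[(- K)%R, K]]) ('D_1 f t)%:E)%E.
  rewrite [RHS]integral_mkcond; apply: eq_integral => t _; rewrite patchE.
  case: ifPn => // /negP; rewrite in_setE /= in_itv /= -ler_norml => /negP.
  rewrite -ltNge => Kt; congr EFin; apply: derive_near0.
  have : \forall y \near t, K < `|y|.
    exact: (cvgr_gt `|t| (@norm_continuous _ _ t) K Kt).
  apply: filterS => y Ky; apply: f0; exact: lt_trans LK Ky.
rewrite (@continuous_FTC2 _ _ f); first last.
- by move=> t _; rewrite derive1E.
- split=> [t _||]; first exact: df.
  + by apply: cvg_at_right_filter; apply/differentiable_continuous/derivable1_diffP.
  + by apply: cvg_at_left_filter; apply/differentiable_continuous/derivable1_diffP.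
- exact: continuous_subspaceT.
- lra.
rewrite !f0 ?subrr ?sube0 //.
- by rewrite normrN (gtr0_norm K0).
- by rewrite (gtr0_norm K0).
Qed.

Lemma pd_rbox n (F : 'rV[R]_n -> R) (L : R) i :
  (forall x, ~ rbox n L x -> F x = 0) -> forall x, ~ rbox n L x -> pd i F x = 0.
Proof.
move=> F0 x xL; apply: derive_near0.
have : open (~` rbox n L).
  by apply: closed_openC; apply: compact_closed; [exact: norm_hausdorff|exact: compact_rbox].
rewrite openE => /(_ x xL); apply: filterS => y; exact: F0.
Qed.

(** Fubini in the order that makes the inner integral vanish: over the first coordinate if [i] is
    the first one, and over the remaining ones, by induction, otherwise. *)
Lemma integral_pd_eq0 n (i : 'I_n) (F : 'rV[R]_n -> R) (L : R) :
  (forall x, derivable F x 'e_i) -> continuous (pd i F) ->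
  (forall x, ~ rbox n L x -> F x = 0) ->
  (\int[lebesgue_rV n]_x (pd i F x)%:E = 0)%E.
Proof.
elim: n i F => [[]//|n IH] i F dF cF F0.
have ci : (lebesgue_rV n.+1).-integrable setT (EFin \o pd i F).
  by apply: (integrable_continuous_rbox (L := L)) => //; exact: pd_rbox.
case: (unliftP ord0 i) dF cF ci => [j|] -> dF cF ci.
- rewrite integral_rVS12 //; apply: integral0_eq => t _ /=.
  under eq_integral do rewrite pd_sliceS.
  apply: IH.
  + by move=> x; rewrite -derivable_sliceS.
  + move=> x; have := continuous_comp (@row_cons_continuousr R n t x) (cF (row_cons (t, x))).
    rewrite (_ : _ \o _ = pd j (fun y => F (row_cons (t, y)))) //.
    by apply/funext => y /=; rewrite pd_sliceS.
  + move=> x xL; apply: F0 => h; apply: xL => k.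
    by have := h (lift ord0 k); rewrite row_consS.
- rewrite integral_rVS21 //; apply: integral0_eq => x _ /=.
  under eq_integral do rewrite pd_slice0.
  apply: (@integral_derive_eq0 _ L).
  + by move=> t; rewrite -derivable_slice0.
  + move=> t; have := continuous_comp (@row_cons_continuousl R n x t) (cF (row_cons (t, x))).
    rewrite (_ : _ \o _ = fun t => 'D_1 (fun s => F (row_cons (s, x))) t) //.
    by apply/funext => s /=; rewrite pd_slice0.
  + by move=> t Lt; apply: F0 => h; have := h ord0; rewrite row_cons0 /= leNgt Lt.
Qed.

End integration_by_parts.

(** * Divergence theorem on a half-space *)

Section cut_products.
Context {R : realType} {n : nat}.
Implicit Types (V K : set 'rV[R]_n) (w g : 'rV[R]_n -> R).

(* [g] is only controlled on the open set V; the weight [w] vanishes off K. *)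
Lemma continuous_cutM V K w g : open V -> closed K -> K `<=` V ->
  continuous w -> (forall x, ~ K x -> w x = 0) ->
  (forall x, V x -> {for x, continuous g}) ->
  continuous (fun x => w x * g x).
Proof.
move=> oV cK KV cw w0 cg x.
have [/KV/cg gx|Kx] := pselect (K x).
  exact: (@continuousM _ _ w g x (cw x) gx).
have oK : open (~` K) by exact: closed_openC.
apply: (@near_cst_continuous _ _ 0).
move: oK; rewrite openE => /(_ x Kx); apply: filterS => y /w0 ->.
exact: mul0r.
Qed.

Lemma is_derive_cutM V K w g i x : closed K -> K `<=` V ->
  (forall x, derivable w x 'e_i) -> (forall x, ~ K x -> w x = 0) ->
  (forall x, V x -> derivable g x 'e_i) ->
  is_derive x 'e_i (fun x => w x * g x) (pd i w x * g x + w x * pd i g x).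
Proof.
move=> cK KV dw w0 dg.
have [/KV/dg gx|Kx] := pselect (K x).
  by apply: is_deriveMr; exact/derivableP.
have oK : \forall y \near x, w y = 0.
  have : open (~` K) by exact: closed_openC.
  by rewrite openE => /(_ x Kx); apply: filterS => y /w0 ->.
rewrite [pd i w x]derive_near0 // w0 // !mul0r addr0.
apply: (@near_eq_is_derive _ _ _ (cst 0)) => //.
by apply: filterS oK => y ->; rewrite mul0r.
Qed.

Lemma pd_supp K w i : closed K -> (forall x, ~ K x -> w x = 0) ->
  forall x, ~ K x -> pd i w x = 0.
Proof.
move=> cK w0 x Kx; apply: derive_near0.
have : open (~` K) by exact: closed_openC.
by rewrite openE => /(_ x Kx); apply: filterS => y /w0 ->.
Qed.

Lemma continuous_pd_cutM V K w g i : open V -> closed K -> K `<=` V ->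
  flatgen w -> (forall x, ~ K x -> w x = 0) ->
  (forall x, V x -> [/\ {for x, continuous g}, derivable g x 'e_i
     & {for x, continuous (pd i g)}]) ->
  continuous (pd i (fun x => w x * g x)).
Proof.
move=> oV cK KV fw w0 hg.
rewrite (_ : pd i _ = fun x => pd i w x * g x + w x * pd i g x); last first.
  have dw x : derivable w x 'e_i by exact: flatgen_derivable.
  have dg x : V x -> derivable g x 'e_i by move=> /hg[].
  by apply/funext => x; have [_] := is_derive_cutM x cK KV dw w0 dg.
move=> x; apply: (@continuousD _ _ _ (fun x => pd i w x * g x) (fun x => w x * pd i g x)).
- apply: (continuous_cutM oV cK KV) => [||y /hg[]//].
  + exact/flatgen_continuous/flatgen_pd.
  + exact: pd_supp.
- apply: (continuous_cutM oV cK KV) => [|//|y /hg[]//].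
  exact/flatgen_continuous.
Qed.

End cut_products.

Section rbox_integrals.
Context {R : realType} {n : nat}.
Local Notation mu := (lebesgue_rV n : {measure set 'rV[R]_n -> \bar R}).

(** The two integrands add up to the derivative of [w * g], which is globally C^1 although [g] is
    controlled on [V] only. *)
Lemma Rintegral_pd_cutM V K (w g : 'rV[R]_n -> R) i L : open V -> closed K -> K `<=` V ->
  K `<=` rbox n L ->
  flatgen w -> (forall x, ~ K x -> w x = 0) ->
  (forall x, V x -> [/\ {for x, continuous g}, derivable g x 'e_i
     & {for x, continuous (pd i g)}]) ->
  \int[mu]_x (w x * pd i g x) = - \int[mu]_x (pd i w x * g x).
Proof.
move=> oV cK KV KL fw w0 hg.
have supL u : (forall x, ~ K x -> u x = 0) -> forall x, ~ rbox n L x -> u x = 0 :> R.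
  by move=> u0 x xL; apply: u0 => /KL.
have w0' := pd_supp i cK w0.
have c1 : continuous (fun x => pd i w x * g x).
  apply: (continuous_cutM oV cK KV) => [||y /hg[]//] //.
  exact/flatgen_continuous/flatgen_pd.
have c2 : continuous (fun x => w x * pd i g x).
  apply: (continuous_cutM oV cK KV) => [||y /hg[]//] //.
  exact/flatgen_continuous.
have i1 : mu.-integrable setT (EFin \o (fun x => pd i w x * g x)).
  apply: (integrable_continuous_rbox (L := L)) => //; apply: supL => x xK.
  by rewrite w0' // mul0r.
have i2 : mu.-integrable setT (EFin \o (fun x => w x * pd i g x)).
  apply: (integrable_continuous_rbox (L := L)) => //; apply: supL => x xK.
  by rewrite w0 // mul0r.
have E : forall x, is_derive x 'e_i (fun x => w x * g x) (pd i w x * g x + w x * pd i g x).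
  move=> x; apply: (is_derive_cutM (V := V) (K := K)) => // y.
  + exact: flatgen_derivable.
  + by move=> /hg[].
have := @integral_pd_eq0 R n i (fun x => w x * g x) L.
move=> /(_ (fun x => ex_derive (is_derive := E x))) /(_ (continuous_pd_cutM oV cK KV fw w0 hg)).
have sF : forall x, ~ rbox n L x -> w x * g x = 0.
  by apply: supL => x xK; rewrite w0 // mul0r.
move=> /(_ sF) I0.
apply/eqP; rewrite -addr_eq0 addrC -RintegralD //; apply/eqP.
rewrite /Rintegral -[RHS]/(fine 0%E) -I0; congr fine.
by apply: eq_integral => x _; congr EFin; rewrite [RHS](derive_val (is_derive := E x)).
Qed.

End rbox_integrals.

(** * Integrals over nonnegative times *)

Section half_space.
Context {R : realType} {n : nat}.
Local Notation leb := (@lebesgue_measure R).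
Local Notation mu := (lebesgue_rV n.+1 : {measure set 'rV[R]_n.+1 -> \bar R}).
Local Notation nu := (lebesgue_rV n : {measure set 'rV[R]_n -> \bar R}).
Local Notation cons t x := (@row_cons R n (t, x)).

Definition future : set 'rV[R]_n.+1 := [set z | 0 <= z ord0 ord0].

Lemma measurable_future : measurable future.
Proof.
rewrite (_ : future = row_coord ord0 @^-1` [set` `[0, +oo[]); last first.
  by apply/seteqP; split => x; rewrite /future /= in_itv /= andbT.
by rewrite -[X in measurable X]setTI; exact: measurable_row_coord.
Qed.

Lemma future_cons t x : future (cons t x) <-> 0 <= t.
Proof. by rewrite /future /= row_cons0. Qed.

Lemma future_restrict (F : 'rV[R]_n.+1 -> R) t x :
  ((EFin \o F) \_ future) (cons t x) = if 0 <= t then (F (cons t x))%:E else 0%E.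
Proof.
rewrite patchE; case: ifPn => [|/negP]; rewrite in_setE future_cons.
  by move=> ->.
by move/negP/negbTE => ->.
Qed.

(** The half-space is a union of full slices of constant time, and a space derivative integrates to
    zero over each of them. *)
Lemma integral_future_space (j : 'I_n) (F : 'rV[R]_n.+1 -> R) (L : R) :
  (forall x, derivable F x 'e_(lift ord0 j)) -> continuous (pd (lift ord0 j) F) ->
  (forall x, ~ rbox n.+1 L x -> F x = 0) ->
  \int[mu]_(z in future) pd (lift ord0 j) F z = 0.
Proof.
move=> dF cF F0; rewrite /Rintegral integral_mkcond.
have ci : mu.-integrable setT (EFin \o pd (lift ord0 j) F).
  by apply: (integrable_continuous_rbox (L := L)) => //; exact: pd_rbox.
rewrite integral_rVS12; last first.
  rewrite -integrable_mkcond; last exact: measurable_future.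
  by apply: integrableS ci => //; exact: measurable_future.
rewrite integral0_eq // => t _.
under eq_integral do rewrite (future_restrict (pd (lift ord0 j) F)).
have [t0|t0] := boolP (0 <= t); last exact: integral0_eq.
under eq_integral do rewrite pd_sliceS.
apply: (@integral_pd_eq0 _ _ _ _ L).
- by move=> x; rewrite -derivable_sliceS.
- move=> x; have := continuous_comp (@row_cons_continuousr R n t x) (cF (cons t x)).
  rewrite (_ : _ \o _ = pd j (fun y => F (cons t y))) //.
  by apply/funext => y /=; rewrite pd_sliceS.
- move=> x xL; apply: F0 => h; apply: xL => k.
  by have := h (lift ord0 k); rewrite row_consS.
Qed.

(** On each line in the time direction the fundamental theorem is applied on [[0, k]] with [k]
    beyond the support, so only the lower endpoint contributes. *)
Lemma integral_future_time (F : 'rV[R]_n.+1 -> R) (L : R) :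
  (forall x, derivable F x 'e_ord0) -> continuous F -> continuous (pd ord0 F) ->
  (forall x, ~ rbox n.+1 L x -> F x = 0) ->
  \int[mu]_(z in future) pd ord0 F z = - \int[nu]_x F (cons 0 x).
Proof.
move=> dF cF cF' F0; rewrite /Rintegral integral_mkcond.
have ci : mu.-integrable setT (EFin \o pd ord0 F).
  by apply: (integrable_continuous_rbox (L := L)) => //; exact: pd_rbox.
rewrite integral_rVS21; last first.
  rewrite -integrable_mkcond; last exact: measurable_future.
  by apply: integrableS ci => //; exact: measurable_future.
have E x : (\int[leb]_t ((EFin \o pd ord0 F) \_ future) (cons t x) =
    (-1 * F (cons 0 x))%:E)%E.
  pose f t := F (cons t x).
  pose k : R := `|L| + 1.
  have Lk : L < k by rewrite (le_lt_trans (ler_norm L)) // ltrDl.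
  have k0 : 0 < k by rewrite ltr_wpDl.
  have f0 t : L < `|t| -> f t = 0.
    by move=> Lt; apply: F0 => h; have := h ord0; rewrite row_cons0 /= leNgt Lt.
  have df t : derivable f t 1 by rewrite -derivable_slice0.
  have cf : continuous (fun t => 'D_1 f t).
    move=> t; have := continuous_comp (@row_cons_continuousl R n x t) (cF' (cons t x)).
    rewrite (_ : _ \o _ = fun t => 'D_1 f t) //.
    by apply/funext => s /=; rewrite pd_slice0.
  transitivity (\int[leb]_(t in [set` `[0%R, k]]) ('D_1 f t)%:E)%E.
    rewrite [RHS]integral_mkcond; apply: eq_integral => t _.
    rewrite (future_restrict (pd ord0 F)) pd_slice0 patchE.
    case: ifPn => [t0|/negPf t0]; case: ifPn => //.
    - move=> /negP; rewrite in_setE /= in_itv /= t0 /= => /negP; rewrite -ltNge => kt.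
      congr EFin; apply: derive_near0.
      have : \forall y \near t, k < `|y|.
        by apply: (cvgr_gt `|t| (@norm_continuous _ _ t)); rewrite ger0_norm.
      by apply: filterS => y Ky; apply: f0; exact: lt_trans Lk Ky.
    - by rewrite in_setE /= in_itv /= t0.
  rewrite (@continuous_FTC2 _ _ f) //; first last.
  - by move=> t _; rewrite derive1E.
  - split=> [t _||]; first exact: df.
    + by apply: cvg_at_right_filter; apply/differentiable_continuous/derivable1_diffP.
    + by apply: cvg_at_left_filter; apply/differentiable_continuous/derivable1_diffP.
  - exact: continuous_subspaceT.
  by rewrite f0 ?gtr0_norm // sub0e mulN1r.
transitivity (fine (\int[lebesgue_rV n]_x (-1 * F (cons 0 x))%:E)%E).
  by congr fine; apply: eq_integral => x _; exact: E.
have iF : nu.-integrable setT (EFin \o (fun x => F (cons 0 x))).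
  apply: (integrable_continuous_rbox (L := L)) => [x|x xL].
    exact: (continuous_comp (@row_cons_continuousr R n 0 x) (cF (cons 0 x))).
  apply: F0 => h; apply: xL => k.
  by have := h (lift ord0 k); rewrite row_consS.
have := RintegralZl (-1) measurableT iF.
by rewrite mulN1r /Rintegral => <-.
Qed.

End half_space.

(** * The Dirac current *)

Local Open Scope sesquilinear_scope.

Section adjoints.
Context {C : numClosedFieldType}.

Lemma adjM m n p (A : 'M[C]_(m, n)) (B : 'M[C]_(n, p)) :
  (A *m B) ^t* = B ^t* *m A ^t*.
Proof. by rewrite trmx_mul map_mxM. Qed.

Lemma adjD m n (A B : 'M[C]_(m, n)) : (A + B) ^t* = A ^t* + B ^t*.
Proof. by rewrite linearD map_mxD. Qed.

Lemma adjN m n (A : 'M[C]_(m, n)) : (- A) ^t* = - A ^t*.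
Proof. by rewrite linearN map_mxN. Qed.

Lemma adjZ m n (c : C) (A : 'M[C]_(m, n)) : (c *: A) ^t* = c^* *: A ^t*.
Proof. by rewrite linearZ map_mxZ. Qed.

Lemma adj_sum m n I (s : seq I) (F : I -> 'M[C]_(m, n)) :
  (\sum_(i <- s) F i) ^t* = \sum_(i <- s) (F i) ^t*.
Proof. by rewrite linear_sum map_mx_sum. Qed.

Definition bilin N (A : 'M[C]_N) (u v : 'cV[C]_N) : C := (u ^t* *m A *m v) 0 0.

Lemma bilinE N (A : 'M[C]_N) u v :
  bilin A u v = \sum_k \sum_l (u k 0)^* * A k l * v l 0.
Proof.
rewrite /bilin mxE exchange_big; apply: eq_bigr => l _.
by rewrite mxE mulr_suml; apply: eq_bigr => k _; rewrite !mxE.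
Qed.

(** As the [al mu] are Hermitian, the two halves of the sum are [<c H psi, psi>] and
    [<psi, c H psi>]; they cancel because [H] is Hermitian and [c] is purely imaginary. *)
Lemma divergence_eq0 N n (al : 'I_n -> 'M[C]_N) (D : 'I_n -> 'cV[C]_N)
    (psi : 'cV[C]_N) (H : 'M[C]_N) (c : C) :
  (forall mu, (al mu) ^t* = al mu) -> H ^t* = H -> c^* = - c ->
  \sum_mu al mu *m D mu = c *: (H *m psi) ->
  \sum_mu (bilin (al mu) (D mu) psi + bilin (al mu) psi (D mu)) = 0.
Proof.
move=> hal hH hc eqD; rewrite big_split /=.
have -> : \sum_mu bilin (al mu) psi (D mu) = (psi ^t* *m (c *: (H *m psi))) 0 0.
  rewrite -eqD mulmx_sumr summxE; apply: eq_bigr => mu _.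
  by rewrite /bilin mulmxA.
have -> : \sum_mu bilin (al mu) (D mu) psi = ((c *: (H *m psi)) ^t* *m psi) 0 0.
  rewrite -eqD adj_sum mulmx_suml summxE; apply: eq_bigr => mu _.
  by rewrite /bilin adjM hal.
rewrite adjZ adjM hH hc scaleNr mulNmx -scalemxAl -scalemxAr mulmxA !mxE.
by rewrite addNr.
Qed.

Lemma bilin_sqr_ge0 N (u : 'cV[C]_N) : 0 <= bilin 1%:M u u.
Proof.
rewrite /bilin mulmx1 mxE; apply: sumr_ge0 => k _.
by rewrite !mxE mulrC mul_conjC_ge0.
Qed.

(* [0 <= |u + s A u|^2 = 2 (|u|^2 + s <u, A u>)] for [s = 1] and [s = -1]. *)
Lemma bilin_bound N (A : 'M[C]_N) (u : 'cV[C]_N) :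
  A ^t* = A -> A *m A = 1%:M ->
  bilin A u u <= bilin 1%:M u u /\ - bilin A u u <= bilin 1%:M u u.
Proof.
move=> hA AA.
have E (s : C) : s^* = s -> s * s = 1 ->
  bilin 1%:M (u + s *: (A *m u)) (u + s *: (A *m u)) =
    2 * (bilin 1%:M u u + s * bilin A u u).
  move=> hs ss; rewrite /bilin adjD adjZ adjM hA hs !mulmx1.
  rewrite mulmxDl !mulmxDr -!scalemxAl -!scalemxAr.
  rewrite -!mulmxA (mulmxA A A) AA mul1mx scalerA ss scale1r !mulmxA !mxE.
  ring.
split.
- have := bilin_sqr_ge0 (u + (-1) *: (A *m u)).
  rewrite E ?rmorphN1 ?mulN1r ?opprK // pmulr_rge0 // subr_ge0.
  by [].
- have := bilin_sqr_ge0 (u + 1 *: (A *m u)).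
  rewrite E ?rmorph1 ?mul1r // pmulr_rge0 // addrC -[X in 0 <= X + _]opprK addrC subr_ge0.
  by [].
Qed.

End adjoints.

Local Open Scope complex_scope.

(** * Dirac matrices and the Hamiltonian form of the equation *)

Section dirac_matrices_theory.
Context {R : realType} {d : nat}.
Local Notation N := (spinor_dim d).
Variable gamma : 'I_d.+1 -> 'M[R[i]]_N.
Hypothesis hg : dirac_matrices gamma.

(** The Hermitian matrices of the current: [j^mu = psi^* alpha^mu psi]. *)
Definition alpha mu : 'M[R[i]]_N := gamma ord0 *m gamma mu.

Lemma conjCE (x : R[i]) : Num.conj x = conjc x.
Proof. by []. Qed.

Lemma half_mx m (A B : 'M[R[i]]_m) : A + A = B + B -> A = B.
Proof.
move=> h; have : 2%:R *: A = 2%:R *: B by rewrite !scaler_nat !mulr2n.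
by move/scalerI => -> //; rewrite pnatr_eq0.
Qed.

Lemma gamma00 : gamma ord0 *m gamma ord0 = 1%:M.
Proof.
have [h _ _] := hg; apply: half_mx; rewrite h /minkowski_metric !eqxx mulr1.
by rewrite -scalemx1 scaler_nat mulr2n.
Qed.

Lemma gammajj j : gamma (lift ord0 j) *m gamma (lift ord0 j) = - 1%:M.
Proof.
have [h _ _] := hg; apply: half_mx; rewrite h /minkowski_metric eqxx /= mulrN1.
by rewrite -scalemx1 scaleNr scaler_nat mulr2n opprD.
Qed.

Lemma gamma0j j : gamma ord0 *m gamma (lift ord0 j) = - (gamma (lift ord0 j) *m gamma ord0).
Proof.
have [h _ _] := hg; apply/eqP; rewrite -addr_eq0 h /minkowski_metric /=.
by rewrite mulr0 raddf0.
Qed.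

Lemma alpha0 : alpha ord0 = 1%:M.
Proof. exact: gamma00. Qed.

Lemma alpha_adj mu : (alpha mu) ^t* = alpha mu.
Proof.
have [_ h0 hj] := hg; rewrite /alpha adjM h0.
case: (unliftP ord0 mu) => [j|] ->; last by rewrite h0.
by rewrite hj mulNmx gamma0j.
Qed.

Lemma alpha_sqr mu : alpha mu *m alpha mu = 1%:M.
Proof.
case: (unliftP ord0 mu) => [j|] ->; last by rewrite alpha0 mul1mx.
rewrite /alpha {1}gamma0j mulNmx -mulmxA (mulmxA (gamma ord0) (gamma ord0)).
by rewrite gamma00 mul1mx gammajj opprK.
Qed.

Lemma lowered0 : lowered gamma ord0 = gamma ord0.
Proof.
rewrite /lowered (bigD1 ord0) //= big1 ?addr0; last first.
  by move=> i i0; rewrite /minkowski_metric eq_sym (negPf i0) scale0r.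
by rewrite /minkowski_metric !eqxx scale1r.
Qed.

(** Multiplying the Dirac equation by [gamma^0] collects the mass and the potentials in one matrix,
    which is Hermitian because [M] and the [A_mu] are real. This is why the current does not see the
    potentials. *)
Lemma dirac_hamiltonian (M : R) psi A z : dirac_eq M gamma psi A z ->
  exists2 H : 'M[R[i]]_N, H ^t* = H &
    \sum_mu alpha mu *m vpd mu psi z = 'i%C *: (H *m psi z).
Proof.
have [_ h0 _] := hg.
move=> eqD; exists (\sum_mu (A mu z)%:C *: alpha mu - M%:C *: gamma ord0).
  rewrite adjD adjN adj_sum adjZ h0 conjCE conjc_real; congr (_ - _).
  by apply: eq_bigr => mu _; rewrite adjZ alpha_adj conjCE conjc_real.
have i2 : 'i%C * - 'i%C = 1 :> R[i] by rewrite mulrN -expr2 sqr_i opprK.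
have -> : \sum_mu alpha mu *m vpd mu psi z =
    'i%C *: (gamma ord0 *m (- 'i%C *: (\sum_mu gamma mu *m vpd mu psi z))).
  rewrite -scalemxAr scalerA i2 scale1r mulmx_sumr.
  by apply: eq_bigr => mu _; rewrite mulmxA.
congr (_ *: _); move: eqD => /(canRL (addrK _)) ->.
rewrite mulmxBr mulmxBl -scalemxAr -scalemxAl; congr (_ - _).
rewrite mulmx_sumr mulmx_suml; apply: eq_bigr => mu _.
by rewrite -scalemxAr mulmxA -scalemxAl.
Qed.

End dirac_matrices_theory.

(** * Calculus of complex-valued fields *)

Section complex_derivatives.
Context {R : realType} {n : nat}.
Implicit Types (h k : 'rV[R]_n -> R[i]) (x : 'rV[R]_n) (i : 'I_n).
Local Notation Re := complex.Re.
Local Notation Im := complex.Im.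

Definition ccont h x := {for x, continuous (fun y => Re (h y))} /\
  {for x, continuous (fun y => Im (h y))}.

Definition is_cpd i h x (dh : R[i]) :=
  is_derive x 'e_i (fun y => Re (h y)) (Re dh) /\
  is_derive x 'e_i (fun y => Im (h y)) (Im dh).

Lemma ReM (a b : R[i]) : Re (a * b) = Re a * Re b - Im a * Im b.
Proof. by case: a b => [? ?] [? ?]. Qed.

Lemma ImM (a b : R[i]) : Im (a * b) = Re a * Im b + Im a * Re b.
Proof. by case: a b => [? ?] [? ?]. Qed.

Lemma ReD (a b : R[i]) : Re (a + b) = Re a + Re b.
Proof. by case: a b => [? ?] [? ?]. Qed.

Lemma ImD (a b : R[i]) : Im (a + b) = Im a + Im b.
Proof. by case: a b => [? ?] [? ?]. Qed.

Lemma ReJ (a : R[i]) : Re a^* = Re a. Proof. by case: a. Qed.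
Lemma ImJ (a : R[i]) : Im a^* = - Im a. Proof. by case: a. Qed.

Lemma ccont_cst (a : R[i]) x : ccont (fun=> a) x.
Proof. by split; exact: cst_continuous. Qed.

Lemma ccontD h k x : ccont h x -> ccont k x -> ccont (fun y => h y + k y) x.
Proof.
move=> [h1 h2] [k1 k2]; split.
- rewrite (_ : (fun y => _) = (fun y => Re (h y)) \+ (fun y => Re (k y))).
    exact: continuousD.
  by apply/funext => y; rewrite ReD.
- rewrite (_ : (fun y => _) = (fun y => Im (h y)) \+ (fun y => Im (k y))).
    exact: continuousD.
  by apply/funext => y; rewrite ImD.
Qed.

Lemma ccontM h k x : ccont h x -> ccont k x -> ccont (fun y => h y * k y) x.
Proof.
move=> [h1 h2] [k1 k2]; split.
- rewrite (_ : (fun y => _) = (fun y => Re (h y) * Re (k y)) \- (fun y => Im (h y) * Im (k y))).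
    by apply: continuousB; exact: continuousM.
  by apply/funext => y; rewrite ReM.
- rewrite (_ : (fun y => _) = (fun y => Re (h y) * Im (k y)) \+ (fun y => Im (h y) * Re (k y))).
    by apply: continuousD; exact: continuousM.
  by apply/funext => y; rewrite ImM.
Qed.

Lemma ccontJ h x : ccont h x -> ccont (fun y => (h y)^*) x.
Proof.
move=> [h1 h2]; split.
  by rewrite (_ : (fun y => _) = (fun y => Re (h y))) //; apply/funext => y; rewrite ReJ.
rewrite (_ : (fun y => _) = \- (fun y => Im (h y))); first exact: continuousN.
by apply/funext => y; rewrite ImJ.
Qed.

Lemma ccont_sum I (s : seq I) (F : I -> 'rV[R]_n -> R[i]) x :
  (forall j, ccont (F j) x) -> ccont (fun y => \sum_(j <- s) F j y) x.
Proof.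
move=> H; elim: s => [|j s IH].
  by under eq_fun do rewrite big_nil; exact: ccont_cst.
by under eq_fun do rewrite big_cons; exact: ccontD.
Qed.

Lemma is_cpd_cst i (a : R[i]) x : is_cpd i (fun=> a) x 0.
Proof. by split; exact: is_derive_cst. Qed.

Lemma is_cpdD i h k x dh dk : is_cpd i h x dh -> is_cpd i k x dk ->
  is_cpd i (fun y => h y + k y) x (dh + dk).
Proof.
move=> [h1 h2] [k1 k2]; split.
- rewrite ReD (_ : (fun y => _) = (fun y => Re (h y)) \+ (fun y => Re (k y))).
    exact: is_deriveD.
  by apply/funext => y; rewrite ReD.
- rewrite ImD (_ : (fun y => _) = (fun y => Im (h y)) \+ (fun y => Im (k y))).
    exact: is_deriveD.
  by apply/funext => y; rewrite ImD.
Qed.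

Lemma is_cpdM i h k x dh dk : is_cpd i h x dh -> is_cpd i k x dk ->
  is_cpd i (fun y => h y * k y) x (dh * k x + h x * dk).
Proof.
move=> [h1 h2] [k1 k2]; split.
- rewrite (_ : (fun y => _) = (fun y => Re (h y) * Re (k y)) \- (fun y => Im (h y) * Im (k y))).
    apply: is_derive_eq (is_deriveB (is_deriveMr h1 k1) (is_deriveMr h2 k2)) _.
    by rewrite ReD !ReM; ring.
  by apply/funext => y; rewrite ReM.
- rewrite (_ : (fun y => _) = (fun y => Re (h y) * Im (k y)) \+ (fun y => Im (h y) * Re (k y))).
    apply: is_derive_eq (is_deriveD (is_deriveMr h1 k2) (is_deriveMr h2 k1)) _.
    by rewrite ImD !ImM; ring.
  by apply/funext => y; rewrite ImM.
Qed.

Lemma is_cpdJ i h x dh : is_cpd i h x dh -> is_cpd i (fun y => (h y)^*) x dh^*.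
Proof.
move=> [h1 h2]; split.
  by rewrite ReJ; under eq_fun do rewrite ReJ.
rewrite ImJ; under eq_fun do rewrite ImJ.
exact: is_deriveN.
Qed.

Lemma is_cpd_sum i I (s : seq I) (F : I -> 'rV[R]_n -> R[i]) x dF :
  (forall j, is_cpd i (F j) x (dF j)) ->
  is_cpd i (fun y => \sum_(j <- s) F j y) x (\sum_(j <- s) dF j).
Proof.
move=> H; elim: s => [|j s IH].
  by rewrite big_nil; under eq_fun do rewrite big_nil; exact: is_cpd_cst.
by rewrite big_cons; under eq_fun do rewrite big_cons; exact: is_cpdD.
Qed.

Lemma csmooth_is_cpd V h i x : csmooth V h -> V x -> is_cpd i h x (cpd i h x).
Proof.
move=> [s1 s2] Vx; split; apply/derivableP.
- by have [_ /(_ i)] := s1 [::] x Vx.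
- by have [_ /(_ i)] := s2 [::] x Vx.
Qed.

Lemma csmooth_ccont V h x : csmooth V h -> V x -> ccont h x.
Proof.
move=> [s1 s2] Vx; split.
- by have [] := s1 [::] x Vx.
- by have [] := s2 [::] x Vx.
Qed.

Lemma csmooth_ccont_cpd V h i x : csmooth V h -> V x -> ccont (cpd i h) x.
Proof.
move=> [s1 s2] Vx; split.
- by have [] := s1 [:: i] x Vx.
- by have [] := s2 [:: i] x Vx.
Qed.

Lemma smooth_C1 V (f : 'rV[R]_n -> R) i x : smooth V f -> V x ->
  [/\ {for x, continuous f}, derivable f x 'e_i & {for x, continuous (pd i f)}].
Proof.
move=> sf Vx; have [c0 /(_ i) d0] := sf [::] x Vx.
by have [c1 _] := sf [:: i] x Vx; split.
Qed.

Lemma smooth_pd V (f : 'rV[R]_n -> R) i : smooth V f -> smooth V (pd i f).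
Proof.
move=> sf s x Vx; have := sf (rcons s i) x Vx.
by rewrite /pds foldr_rcons.
Qed.

End complex_derivatives.

(** * Conservation and causality of the current *)

Section currents.
Context {R : realType} {d : nat}.
Local Notation N := (spinor_dim d).
Local Notation spacetime := 'rV[R]_d.+1.
Variables (V : set spacetime) (psi : spacetime -> 'cV[R[i]]_N).
Hypotheses (oV : open V) (spsi : forall k, csmooth V (fun z => psi z k ord0)).

Lemma is_cpd_bilin (A : 'M[R[i]]_N) i z : V z ->
  is_cpd i (fun z => bilin A (psi z) (psi z)) z
    (bilin A (vpd i psi z) (psi z) + bilin A (psi z) (vpd i psi z)).
Proof.
move=> Vz; rewrite !bilinE -big_split /=.
under eq_fun do rewrite bilinE.
apply: is_cpd_sum => k; rewrite -big_split /=; apply: is_cpd_sum => l.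
have hk := csmooth_is_cpd i (spsi k) Vz.
have hl := csmooth_is_cpd i (spsi l) Vz.
have := is_cpdM (is_cpdM (is_cpdJ hk) (is_cpd_cst i (A k l) z)) hl.
by rewrite mulr0 addr0 ![vpd i psi z _ _]mxE.
Qed.

Lemma ccont_bilin (A : 'M[R[i]]_N) z : V z -> ccont (fun z => bilin A (psi z) (psi z)) z.
Proof.
move=> Vz; under eq_fun do rewrite bilinE.
apply: ccont_sum => k; apply: ccont_sum => l; apply: ccontM; last first.
  exact: csmooth_ccont (spsi l) Vz.
apply: ccontM; last exact: ccont_cst.
exact/ccontJ/(csmooth_ccont (spsi k) Vz).
Qed.

Lemma ccont_dbilin (A : 'M[R[i]]_N) i z : V z ->
  ccont (fun z => bilin A (vpd i psi z) (psi z) + bilin A (psi z) (vpd i psi z)) z.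
Proof.
move=> Vz; under eq_fun do rewrite !bilinE.
have c1 k : ccont (fun z => psi z k ord0) z by exact: csmooth_ccont (spsi k) Vz.
have c2 k : ccont (fun z => vpd i psi z k ord0) z.
  under eq_fun do rewrite mxE; exact: csmooth_ccont_cpd (spsi k) Vz.
apply: ccontD; apply: ccont_sum => k; apply: ccont_sum => l;
  (apply: ccontM; [apply: ccontM; [exact: ccontJ|exact: ccont_cst]|done]).
Qed.

(** For Hermitian [A] the form is real, so the real part is the whole value, and the real
    integration theory applies. *)
Definition current (A : 'M[R[i]]_N) (z : spacetime) : R :=
  complex.Re (bilin A (psi z) (psi z)).

Lemma pd_current A i z : V z -> pd i (current A) z =
  complex.Re (bilin A (vpd i psi z) (psi z) + bilin A (psi z) (vpd i psi z)).
Proof. by move=> Vz; have [+ _] := is_cpd_bilin A i Vz; move=> [_]. Qed.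

Lemma current_C1 A i z : V z ->
  [/\ {for z, continuous (current A)}, derivable (current A) z 'e_i
     & {for z, continuous (pd i (current A))}].
Proof.
move=> Vz; split.
- by have [] := ccont_bilin A Vz.
- by have [[]] := is_cpd_bilin A i Vz.
- have [c _] := ccont_dbilin A i Vz.
  have E : \forall y \near z, complex.Re (bilin A (vpd i psi y) (psi y) +
      bilin A (psi y) (vpd i psi y)) = pd i (current A) y.
    by move: oV; rewrite openE => /(_ z Vz); apply: filterS => y Vy; rewrite pd_current.
  rewrite /prop_for /continuous_at pd_current //.
  exact: (cvg_trans (near_eq_cvg E)).
Qed.

Variable gamma : 'I_d.+1 -> 'M[R[i]]_N.
Hypothesis hg : dirac_matrices gamma.

Lemma current_conservation (M : R) A z : V z -> dirac_eq M gamma psi A z ->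
  \sum_mu pd mu (current (alpha gamma mu)) z = 0.
Proof.
move=> Vz /(dirac_hamiltonian hg)[H hH eqD].
have ci : ('i%C : R[i])^*%R = - 'i%C.
  by rewrite conjCE /=; apply/eqP; rewrite eq_complex /= oppr0 !eqxx.
have := divergence_eq0 (alpha_adj hg) hH ci eqD.
move=> /(congr1 (@complex.Re R)).
rewrite (big_morph _ (@ReD R) (erefl : complex.Re 0 = 0)) => E.
by rewrite -[RHS]E; apply: eq_bigr => mu _; rewrite pd_current.
Qed.

Lemma current_bound mu z : `|current (alpha gamma mu) z| <= current 1%:M z.
Proof.
have [] := bilin_bound (psi z) (alpha_adj hg mu) (alpha_sqr hg mu).
rewrite !lecE => /andP[_ h1] /andP[_ h2].
rewrite ler_norml lerNl; apply/andP; split => //.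
by move: h2; rewrite /current; case: (bilin _ _ _).
Qed.

Lemma maxwell_current A z : maxwell_eq gamma psi A z ->
  box (A ord0) z = current 1%:M z.
Proof.
move=> /(_ ord0); rewrite (lowered0 gamma) -mulmxA -mulmxA (mulmxA (gamma ord0)) (gamma00 hg).
by rewrite mulmxA /current /bilin => <-.
Qed.

End currents.

Lemma current1E (R : realType) d (psi : 'rV[R]_d.+1 -> 'cV[R[i]]_(spinor_dim d)) z :
  current psi 1%:M z = \sum_k cmod (psi z k ord0) ^+ 2.
Proof.
rewrite /current /bilin mulmx1 mxE (big_morph _ (@ReD R) (erefl : complex.Re 0 = 0)).
apply: eq_bigr => k _; rewrite !mxE conjCE.
case: (psi z k ord0) => a b /=.
by rewrite sqr_sqrtr ?addr_ge0 ?sqr_ge0 // mulNr opprK !expr2.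
Qed.

(** * Causal weights and the charge estimate *)

Section weights.
Context {R : realType} {d : nat}.
Local Notation spacetime := 'rV[R]_d.+1.
Implicit Types (z v : spacetime).
Local Notation h := (@bump_half R).
Local Notation h' := (flat (dflat (1 : {poly R}))).

(** Componentwise, hence weaker than causality for the Euclidean length: this is what the bound on
    each component of the current provides, and it suffices for the product [theta]. *)
Definition causal v := forall j, `|v ord0 (lift ord0 j)| <= v ord0 ord0.

(* A product of nondecreasing functions of [t + x_j] and [t - x_j], hence
   nondecreasing along future causal vectors. *)
Definition theta z : R := \prod_(j < d)
  (h (16^-1 + z ord0 ord0 - z ord0 (lift ord0 j)) *
   h (16^-1 + z ord0 ord0 + z ord0 (lift ord0 j))).

(** A nonincreasing time cut-off, equal to the constant [h (h (tau / 3))] for [t <= tau / 3] and to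
    zero for [t >= 2 tau / 3]. Nesting [h] produces such a step inside [flatgen]. *)
Definition sigma (tau : R) z : R := h (h (tau / 3) - h (z ord0 ord0 - tau / 3)).

(* [rho = - d sigma / dt]. *)
Definition rho (tau : R) z : R :=
  h' (h (tau / 3) - h (z ord0 ord0 - tau / 3)) * h' (z ord0 ord0 - tau / 3).

(* Constant for [t >= 0] and zero for [t <= - eta]: it makes the weight compactly
   supported in the open set where the fields are smooth, without changing it on
   the half-space [t >= 0]. *)
Definition kappa (eta : R) z : R := h (h eta - h (- z ord0 ord0)).

Lemma flatgen_affine (a : R) i : flatgen (fun z => a + z ord0 i).
Proof. by apply: flatgen_add; [exact: flatgen_cst|exact: flatgen_coord]. Qed.

Lemma flatgen_theta : flatgen theta.
Proof.
apply: flatgen_prod => j; apply: flatgen_mul; apply: flatgen_flat.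
- by apply: flatgen_add; [exact: flatgen_affine|apply: flatgen_opp; exact: flatgen_coord].
- by apply: flatgen_add; [exact: flatgen_affine|exact: flatgen_coord].
Qed.

Lemma flatgen_delay (a b : R) : flatgen (fun z => a - h (z ord0 ord0 - b)).
Proof.
apply: flatgen_add; first exact: flatgen_cst.
apply: flatgen_opp; apply: flatgen_flat.
by apply: flatgen_add; [exact: flatgen_coord|exact: flatgen_cst].
Qed.

Lemma flatgen_sigma tau : flatgen (sigma tau).
Proof. by apply: flatgen_flat; exact: flatgen_delay. Qed.

Lemma flatgen_rho tau : flatgen (rho tau).
Proof.
apply: flatgen_mul; apply: flatgen_flat; first exact: flatgen_delay.
by apply: flatgen_add; [exact: flatgen_coord|exact: flatgen_cst].
Qed.

Lemma flatgen_kappa eta : flatgen (kappa eta).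
Proof.
apply: flatgen_flat; apply: flatgen_add; first exact: flatgen_cst.
by apply: flatgen_opp; apply: flatgen_flat; apply: flatgen_opp; exact: flatgen_coord.
Qed.

Lemma sigma_ge0 tau z : 0 <= sigma tau z.
Proof. exact: bump_half_ge0. Qed.

Lemma derive_theta_ge0 v z : causal v -> 0 <= 'D_v theta z.
Proof.
move=> cv.
pose q j z : R := h (16^-1 + z ord0 ord0 - z ord0 (lift ord0 j)) *
   h (16^-1 + z ord0 ord0 + z ord0 (lift ord0 j)).
have hq (j : 'I_d) : exists2 dq, 0 <= dq & is_derive z v (q j) dq.
  have [h1 h2] : 0 <= v ord0 ord0 - v ord0 (lift ord0 j) /\
      0 <= v ord0 ord0 + v ord0 (lift ord0 j).
    by have := cv j; rewrite ler_norml; split; lra.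
  pose l1 (z : spacetime) := 16^-1 + z ord0 ord0 - z ord0 (lift ord0 j).
  pose l2 (z : spacetime) := 16^-1 + z ord0 ord0 + z ord0 (lift ord0 j).
  have c1 := is_derive_cst (16^-1 : R) z v.
  have d0 := is_derive_coord ord0 z v.
  have dj := is_derive_coord (lift ord0 j) z v.
  have e1 : is_derive z v l1 (0 + v ord0 ord0 - v ord0 (lift ord0 j)).
    exact: (is_deriveB (is_deriveD c1 d0) dj).
  have e2 : is_derive z v l2 (0 + v ord0 ord0 + v ord0 (lift ord0 j)).
    exact: (is_deriveD (is_deriveD c1 d0) dj).
  exists (h' (l1 z) * (0 + v ord0 ord0 - v ord0 (lift ord0 j)) * h (l2 z) +
     h (l1 z) * (h' (l2 z) * (0 + v ord0 ord0 + v ord0 (lift ord0 j)))).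
    rewrite !add0r addr_ge0 // mulr_ge0 ?bump_half_ge0 // mulr_ge0 //; exact: dflat1_ge0.
  apply: is_deriveMr; apply: is_derive_outer => //; exact: is_derive_flat.
suff [dq dq0 [_ E]] : exists2 dq, 0 <= dq & is_derive z v theta dq by rewrite E.
rewrite /theta; elim: (index_enum _) => [|j s [dq dq0 hdq]].
  exists 0 => //; rewrite (_ : (fun z => _) = cst 1); first exact: is_derive_cst.
  by apply/funext => y; rewrite big_nil.
have [dj dj0 hdj] := hq j.
exists (dj * (\prod_(j <- s) q j z) + q j z * dq).
  rewrite addr_ge0 // mulr_ge0 //; last by rewrite mulr_ge0 ?bump_half_ge0.
  by apply: prodr_ge0 => i _; rewrite mulr_ge0 ?bump_half_ge0.
rewrite (_ : (fun z => _) = fun z => q j z * \prod_(j <- s) q j z); last first.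
  by apply/funext => y; rewrite big_cons.
exact: is_deriveMr.
Qed.

Lemma is_derive_sigma tau v z :
  is_derive z v (sigma tau) (- (rho tau z * v ord0 ord0)).
Proof.
have c1 := is_derive_cst (tau / 3) z v.
have d0 := is_derive_coord ord0 z v.
have e1 : is_derive z v (fun z : spacetime => z ord0 ord0 - tau / 3) (v ord0 ord0 - 0).
  exact: (is_deriveB d0 c1).
have e2 : is_derive z v (fun z : spacetime => h (z ord0 ord0 - tau / 3))
    (h' (z ord0 ord0 - tau / 3) * (v ord0 ord0 - 0)).
  by apply: is_derive_outer => //; exact: is_derive_flat.
have e3 : is_derive z v (fun z : spacetime => h (tau / 3) - h (z ord0 ord0 - tau / 3))
    (0 - h' (z ord0 ord0 - tau / 3) * (v ord0 ord0 - 0)).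
  exact: (is_deriveB (is_derive_cst (h (tau / 3)) z v) e2).
have e4 := is_derive_outer (is_derive_flat 1 _) e3.
apply: is_derive_eq e4 _.
by rewrite /rho; ring.
Qed.

(** This includes [t = 0], where the two-sided derivative vanishes because [h] is flat at 0. *)
Lemma is_derive_kappa eta v z : 0 <= z ord0 ord0 -> is_derive z v (kappa eta) 0.
Proof.
move=> z0.
have d0 := is_derive_coord ord0 z v.
have e1 : is_derive z v (fun z : spacetime => - z ord0 ord0) (- v ord0 ord0).
  exact: (is_deriveN d0).
have e2 : is_derive z v (fun z : spacetime => h (- z ord0 ord0))
    (h' (- z ord0 ord0) * - v ord0 ord0).
  by apply: is_derive_outer => //; exact: is_derive_flat.
have e3 : is_derive z v (fun z : spacetime => h eta - h (- z ord0 ord0))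
    (0 - h' (- z ord0 ord0) * - v ord0 ord0).
  exact: (is_deriveB (is_derive_cst (h eta) z v) e2).
have e4 := is_derive_outer (is_derive_flat 1 _) e3.
apply: is_derive_eq e4 _.
by rewrite [h' (- _)]flat_le0 ?oppr_le0 // mul0r subr0 mulr0.
Qed.

(** Both factors of index [j] are nonzero only if [|x_j| < 1/16 + t], and [t] is at most 1/16. *)
Lemma theta_supp z : z ord0 ord0 <= 16^-1 ->
  (exists j, 8^-1 < `|z ord0 (lift ord0 j)|) -> theta z = 0.
Proof.
move=> z0 [j]; rewrite /theta (bigD1 j) //= ltr_normr => /orP[] hj.
- by rewrite /h [flat _ _]flat_le0 ?mul0r //; lra.
- by rewrite [X in _ * X * _]flat_le0 ?mulr0 ?mul0r //; lra.
Qed.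

Lemma sigma_supp tau z : 2 * tau / 3 <= z ord0 ord0 -> sigma tau z = 0.
Proof.
move=> tz; apply: flat_le0; rewrite subr_le0; apply: bump_half_mono; lra.
Qed.

Lemma rho_supp tau z : z ord0 ord0 <= tau / 3 \/ 2 * tau / 3 <= z ord0 ord0 -> rho tau z = 0.
Proof.
rewrite /rho => -[] tz.
- by rewrite [X in _ * X]flat_le0 ?mulr0 // subr_le0.
- rewrite [X in X * _]flat_le0 ?mul0r // subr_le0; apply: bump_half_mono; lra.
Qed.

Lemma kappa_supp eta z : z ord0 ord0 <= - eta -> kappa eta z = 0.
Proof.
move=> tz; apply: flat_le0; rewrite subr_le0; apply: bump_half_mono; lra.
Qed.

Lemma kappa_future eta z : 0 <= z ord0 ord0 -> kappa eta z = h (h eta).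
Proof.
by move=> z0; rewrite /kappa [h (- _)]flat_le0 ?oppr_le0 // subr0.
Qed.

End weights.

(** * Compact slabs around the time axis *)

Section slabs.
Context {R : realType} {d : nat}.
Local Notation spacetime := 'rV[R]_d.+1.

Definition slab (a b : R) : set spacetime :=
  [set z | a <= z ord0 ord0 <= b /\ forall j, `|z ord0 (lift ord0 j)| <= 8^-1].

Lemma compact_slab a b : compact (slab a b).
Proof.
have := @rV_compact R d.+1 (fun i => if i == ord0 then [set` `[a, b]] else [set` `[- 8^-1, 8^-1]]).
rewrite (_ : [set _ | _] = slab a b); first by apply => i; case: ifP => _; exact: segment_compact.
apply/seteqP; split => z /=.
- move=> hz; split; first by have := hz ord0; rewrite /= in_itv.
  by move=> j; have := hz (lift ord0 j); rewrite /= in_itv /= ler_norml.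
- move=> [h0 hj] i; case: (unliftP ord0 i) => [j|] ->; rewrite /= in_itv //=.
  by rewrite -ler_norml.
Qed.

Lemma closed_slab a b : closed (slab a b).
Proof. by apply: compact_closed; [exact: norm_hausdorff|exact: compact_slab]. Qed.

Lemma slab_rbox a b : -1 <= a -> b <= 1 -> slab a b `<=` rbox d.+1 1.
Proof.
move=> a1 b1 z [z0 zj] i; case: (unliftP ord0 i) => [j|] ->.
  by apply: (le_trans (zj j)); lra.
by rewrite ler_norml; lra.
Qed.

(** A tube lemma. It provides room below [t = 0], inside the domain of the fields, for cutting the
    weight off with [kappa]. *)
Lemma slab_thicken (V : set spacetime) b : 0 <= b -> open V -> slab 0 b `<=` V ->
  exists2 eta : R, 0 < eta < 1 & slab (- eta) b `<=` V.
Proof.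
move=> b0 oV sV.
have /compact_near_coveringP nc := @compact_slab 0 b.
(* Compactness makes uniform over the slab the size of the time shifts that stay in [V]. *)
have [z Kz|e /= e0 he] := nc R (nbhs (0 : R)) (fun s z => V (z + s *: 'e_ord0)) _.
  have /nbhs_ballP[e /= e0 eV] : nbhs z V by move: oV; rewrite openE; apply; exact: sV.
  have e2 : 0 < e / 2 by rewrite divr_gt0.
  exists (ball z (e / 2), ball (0 : R) (e / 2)).
    by split; exact: nbhsx_ballx.
  move=> [y s] /= [[_ zy] s0]; apply: eV; split => // i j; rewrite (ord1 i) !mxE eqxx /=.
  have := zy ord0 j; move: s0; rewrite /ball /= sub0r normrN => s0 zyj.
  have -> : z ord0 j - (y ord0 j + s * (j == ord0)%:R) =
     (z ord0 j - y ord0 j) - s * (j == ord0)%:R by ring.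
  rewrite (splitr e) (le_lt_trans (ler_normB _ _)) // ltrD //.
  case: (j == ord0); rewrite ?mulr1 // mulr0 normr0 //.
(* The bound 1/2 keeps the thickened slab in the unit cube when [b <= 1]. *)
pose eta := Num.min (e / 2) (1 / 2).
have eta0 : 0 < eta by rewrite lt_min !divr_gt0.
have etae : eta <= e / 2 by rewrite ge_min lexx.
have eta1 : eta <= 1 / 2 by rewrite ge_min lexx orbT.
exists eta; first by rewrite eta0; lra.
move=> z [/andP[z1 z2] zj].
have [z0|z0] := leP 0 (z ord0 ord0); first by apply: sV; split => //; rewrite z0.
(* A point at negative time is a small backward shift of its projection [y] to [t = 0], which lies
   in the slab. *)
pose y : spacetime := row_cons (0, rsubmx (z : 'rV_(1 + d))).
have zE : z = y + z ord0 ord0 *: 'e_ord0.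
  rewrite scale_delta0 row_consD add0r addr0.
  by rewrite -[LHS]row_unconsK.
have yj j : y ord0 (lift ord0 j) = z ord0 (lift ord0 j).
  by rewrite zE mxE !mxE /= mulr0 addr0.
have yS : slab 0 b y.
  split => [|j]; last by rewrite yj.
  by rewrite row_cons0 /= lexx; lra.
rewrite zE; apply: (he (z ord0 ord0)) => //=.
by rewrite sub0r normrN ltr0_norm //; lra.
Qed.

End slabs.

Section finite_sums.
Context d (T : measurableType d) {R : realType} (mu : {measure set T -> \bar R}).

Lemma integrable_fsum I (s : seq I) (F : I -> T -> R) D : measurable D ->
  (forall i, mu.-integrable D (EFin \o F i)) ->
  mu.-integrable D (EFin \o (fun x => \sum_(i <- s) F i x)).
Proof.
move=> mD iF; have := integrable_sum mD s (P := xpredT) (h := fun i => EFin \o F i).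
rewrite (_ : (fun x => _) = EFin \o (fun x => \sum_(i <- s) F i x)); first by apply => i _.
by apply/funext => x /=; rewrite sumEFin.
Qed.

Lemma Rintegral_fsum I (s : seq I) (F : I -> T -> R) D : measurable D ->
  (forall i, mu.-integrable D (EFin \o F i)) ->
  \int[mu]_(x in D) (\sum_(i <- s) F i x) = \sum_(i <- s) \int[mu]_(x in D) F i x.
Proof.
move=> mD iF; elim: s => [|i s IH].
  by rewrite big_nil /Rintegral integral0_eq // => x _; rewrite big_nil.
rewrite big_cons -IH -RintegralD //; last exact: integrable_fsum.
by apply: eq_Rintegral => x _; rewrite big_cons.
Qed.

End finite_sums.

(** * Lower bound for the transported charge *)

Section charge.
Context {R : realType} {d : nat}.
Local Notation spacetime := 'rV[R]_d.+1.
Local Notation mu := (lebesgue_rV d.+1 : {measure set 'rV[R]_d.+1 -> \bar R}).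
Local Notation nu := (lebesgue_rV d : {measure set 'rV[R]_d -> \bar R}).
Variables (V : set spacetime) (J : 'I_d.+1 -> spacetime -> R) (tau : R).
Hypotheses (oV : open V) (tau0 : 0 < tau) (tau1 : tau <= 16^-1).
Hypothesis KV : slab 0 tau `<=` V.
Hypothesis J1 : forall m i z, V z ->
  [/\ {for z, continuous (J m)}, derivable (J m) z 'e_i & {for z, continuous (pd i (J m))}].
Hypothesis Jdiv : forall z, slab 0 tau z -> \sum_m pd m (J m) z = 0.
Hypothesis Jcone : forall m z, slab 0 tau z -> `|J m z| <= J ord0 z.

Lemma rho_theta_supp (z : spacetime) : ~ slab (tau / 3) (2 * tau / 3) z -> rho tau z * theta z = 0.
Proof.
have := tau0; have := tau1 => t1' t0' nz.
have [t1|t1] := leP (z ord0 ord0) (tau / 3); first by rewrite rho_supp ?mul0r //; left.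
have [t2|t2] := leP (2 * tau / 3) (z ord0 ord0); first by rewrite rho_supp ?mul0r //; right.
rewrite theta_supp ?mulr0 //; first lra.
apply: contrapT => /forallNP hz; apply: nz; split; first by rewrite !ltW.
by move=> j; have := hz j; rewrite ltNge => /negP; rewrite negbK.
Qed.

(** The leading factor is the value of [sigma tau] at [t = 0]. *)
Definition initial_density x : R := bump_half (bump_half (tau / 3)) *
  (theta (row_cons (0, x)) * J ord0 (row_cons (0, x))).

(* Integrate [div (sigma theta J)] over [t >= 0]: since [J] is divergence free and
   causal, the derivatives of [theta] contribute a nonnegative term, which leaves
   [- rho theta J_0] and the boundary term at [t = 0]. *)
Lemma charge_estimate :
  nu.-integrable setT (EFin \o initial_density) /\
  \int[nu]_x initial_density x <= \int[mu]_z (rho tau z * theta z * J ord0 z).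
Proof.
have := tau0; have := tau1 => t1' t0'.
have [eta /andP[eta0 eta1] KeV] := slab_thicken (ltW tau0) oV KV.
pose K : set spacetime := slab (- eta) tau.
have cK : closed K := @closed_slab R d (- eta) tau.
have KL : K `<=` rbox d.+1 1 by apply: slab_rbox; lra.
have sK z : slab 0 tau z -> K z.
  by move=> [/andP[z0 z1] zj]; split => //; rewrite z1 andbT; lra.
have sK' z : K z -> 0 <= z ord0 ord0 -> slab 0 tau z.
  by move=> [/andP[z0 z1] zj] z0'; split => //; rewrite z1 z0'.
pose k0 := bump_half (bump_half eta).
have k00 : 0 < k0 by rewrite !bump_half_gt0.
(* On [t >= 0] the first two factors cancel and [w = sigma * theta]; for [t <= - eta] the factor
   [kappa] vanishes. *)
pose w (z : spacetime) := k0^-1 * kappa eta z * sigma tau z * theta z.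
have fw : flatgen w.
  apply: flatgen_mul; last exact: flatgen_theta.
  apply: flatgen_mul; last exact: flatgen_sigma.
  by apply: flatgen_mul; [exact: flatgen_cst|exact: flatgen_kappa].
have wK z : ~ K z -> w z = 0.
  move=> nz; rewrite /w.
  have [t1|t1] := leP (z ord0 ord0) (- eta); first by rewrite kappa_supp // mulr0 !mul0r.
  have [t2|t2] := leP tau (z ord0 ord0); first by rewrite sigma_supp ?mulr0 ?mul0r //; lra.
  rewrite theta_supp ?mulr0 //; first lra.
  apply: contrapT => /forallNP hz; apply: nz; split; first by rewrite !ltW.
  by move=> j; have := hz j; rewrite ltNge => /negP; rewrite negbK.
pose phi (z : spacetime) := rho tau z * theta z.
have fphi : flatgen phi by apply: flatgen_mul; [exact: flatgen_rho|exact: flatgen_theta].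
have phiK z : ~ K z -> phi z = 0.
  move=> nz; apply: rho_theta_supp => -[/andP[h0 h1] hj]; apply: nz; split => //.
  by apply/andP; split; lra.
have J1' m i z : V z -> derivable (J m) z 'e_i by move=> /(J1 m i)[].
have Jc m z : V z -> {for z, continuous (J m)} by move=> /(J1 m ord0)[].
have dF m z : is_derive z 'e_m (fun z => w z * J m z) (pd m w z * J m z + w z * pd m (J m) z).
  apply: (is_derive_cutM (V := V) (K := K)) => // y; first exact: flatgen_derivable.
  exact: J1'.
have FL m z : ~ rbox d.+1 1 z -> w z * J m z = 0.
  by move=> nz; rewrite wK ?mul0r // => /KL.
have cF m : continuous (fun z => w z * J m z).
  by apply: (continuous_cutM oV cK KeV (flatgen_continuous fw) wK) => z; exact: Jc.
have cdF m : continuous (pd m (fun z => w z * J m z)).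
  by apply: (continuous_pd_cutM oV cK KeV fw wK) => z; exact: J1.
have idF m : mu.-integrable setT (EFin \o pd m (fun z => w z * J m z)).
  by apply: (integrable_continuous_rbox (L := 1)) => //; apply: pd_rbox; exact: FL.
have iphi : mu.-integrable setT (EFin \o (fun z => phi z * J ord0 z)).
  apply: (integrable_continuous_rbox (L := 1)).
    by apply: (continuous_cutM oV cK KeV (flatgen_continuous fphi) phiK) => z; exact: Jc.
  by move=> z nz; rewrite phiK ?mul0r // => /KL.
have mF := @measurable_future R d.
have ifut (f : spacetime -> R) : mu.-integrable setT (EFin \o f) ->
    mu.-integrable future (EFin \o f).
  by move=> i; apply: integrableS i.
have total : \int[mu]_(z in future) (\sum_m pd m (fun z => w z * J m z) z) =
    - (\int[nu]_x (w (row_cons (0, x)) * J ord0 (row_cons (0, x)))).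
  rewrite Rintegral_fsum //; last by move=> m; exact: ifut.
  rewrite big_ord_recl big1 ?addr0; last first.
    move=> j _; apply: (integral_future_space (L := 1)); last exact: FL.
      by move=> z; have [] := dF (lift ord0 j) z.
    exact: cdF.
  apply: (integral_future_time (L := 1)); last exact: FL.
  - by move=> z; have [] := dF ord0 z.
  - exact: cF.
  - exact: cdF.
have initial x : w (row_cons (0, x)) * J ord0 (row_cons (0, x)) =
    initial_density x.
  rewrite /initial_density /w kappa_future ?row_cons0 //= -/k0 mulVf ?gt_eqF // mul1r.
  rewrite /sigma row_cons0 /= [bump_half (_ - tau / 3)]flat_le0 ?subr0 ?mulrA //; lra.
have phifut : \int[mu]_z (phi z * J ord0 z) = \int[mu]_(z in future) (phi z * J ord0 z).
  rewrite [RHS]Rintegral_mkcond; apply: eq_Rintegral => z _; rewrite patchE.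
  case: ifPn => // /negP; rewrite in_setE /future /= => /negP; rewrite -ltNge => z0.
  by rewrite /phi rho_supp ?mul0r //; left; lra.
have comparison : - (\int[mu]_(z in future) (phi z * J ord0 z)) <=
    \int[mu]_(z in future) (\sum_m pd m (fun z => w z * J m z) z).
  have -> : - (\int[mu]_(z in future) (phi z * J ord0 z)) =
      \int[mu]_(z in future) (-1 * (phi z * J ord0 z)).
    by rewrite RintegralZl ?mulN1r //; exact: ifut.
  apply: le_Rintegral => //.
  - exact: (integrableZl mF (-1) (ifut _ iphi)).
  - by apply: integrable_fsum => // m; exact: ifut.
  move=> z z0.
  under eq_bigr do rewrite /pd (derive_val (is_derive := dF _ _)).
  have [Kz|nKz] := pselect (K z); last first.
    rewrite phiK // mul0r mulr0 big1 // => m _.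
    by rewrite (pd_supp m cK wK) // wK // !mul0r addr0.
  have Cz : slab 0 tau z by exact: sK'.
  rewrite big_split /= -mulr_sumr Jdiv // mulr0 addr0.
  (* The current at [z] is now used as a direction of differentiation; it is future causal. *)
  pose v : spacetime := \row_m J m z.
  have -> : \sum_m pd m w z * J m z = 'D_v w z.
    by rewrite flatgen_derive_sum //; apply: eq_bigr => m _; rewrite mxE mulrC.
  have dk := is_deriveMr (is_derive_cst (k0^-1 : R) z v) (@is_derive_kappa R d eta v z z0).
  have ds := is_deriveMr dk (is_derive_sigma tau v z).
  have dth : is_derive z v theta ('D_v theta z).
    by apply/derivableP; exact/flatgen_derivable/flatgen_theta.
  have dw := is_deriveMr ds dth.
  have cv : causal v by move=> j; rewrite !mxE; exact: Jcone.
  rewrite (derive_val (is_derive := dw)) kappa_future // -/k0 mulVf ?gt_eqF //.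
  (* The derivative of [w] along [v] is [sigma * D_v theta - rho * theta * J_0]; the first term is
     nonnegative and is dropped. *)
  have := mulr_ge0 (sigma_ge0 tau z) (derive_theta_ge0 z cv).
  by rewrite /phi !mxE; lra.
have -> : \int[nu]_x initial_density x = \int[nu]_x (w (row_cons (0, x)) * J ord0 (row_cons (0, x))).
  by apply: eq_Rintegral => x _.
split.
  rewrite (_ : initial_density = fun x => w (row_cons (0, x)) * J ord0 (row_cons (0, x))).
    apply: (integrable_continuous_rbox (L := 1)) => x.
      exact: (continuous_comp (@row_cons_continuousr R d 0 x) (cF ord0 (row_cons (0, x)))).
    move=> xL; apply: FL => h; apply: xL => k.
    by have := h (lift ord0 k); rewrite row_consS.
  by apply/funext => x.
rewrite -[leRHS]/(\int[mu]_z (phi z * J ord0 z)) phifut.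
by rewrite -lerN2 (le_trans comparison) // total.
Qed.

End charge.

(** * The test function and its pairing with the potential *)

Section test_in_cone.
Context {R : realType} {d : nat}.
Local Notation N := (spinor_dim d).
Local Notation spacetime := 'rV[R]_d.+1.
Local Notation mu := (lebesgue_rV d.+1 : {measure set 'rV[R]_d.+1 -> \bar R}).
Variables (T tau : R).
Hypotheses (d3 : (d <= 3)%N) (tau0 : 0 < tau) (tau1 : tau <= 16^-1) (tauT : tau <= T).

(** Here [d <= 3] enters: the sum of squares is at most 3/16, below 1/4. *)
Lemma enorm_le_half (x : 'rV[R]_d) : (forall j, `|x ord0 j| <= 4^-1) -> enorm x <= 2^-1.
Proof.
move=> hx; rewrite /enorm -[leRHS]ger0_norm ?invr_ge0 // -sqrtr_sqr ler_wsqrtr //.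
apply: (@le_trans _ _ (\sum_(j < d) 16^-1)).
  apply: ler_sum => j _; rewrite -real_normK ?num_real //.
  have -> : 16^-1 = 4^-1 ^+ 2 :> R by rewrite exprVn -natrX.
  by rewrite lerXn2r ?nnegrE.
rewrite sumr_const card_ord -mulr_natl.
have : d%:R <= 3 :> R by rewrite ler_nat.
by move=> d3'; rewrite exprVn -natrX; lra.
Qed.

Lemma space_coordE (z : spacetime) j : space_coord z ord0 j = z ord0 (lift ord0 j).
Proof. by rewrite mxE; congr (z _ _); apply/val_inj. Qed.

(** The bound 1/4 is twice the half-width of a slab; the margin gives neighbourhoods of slab points
    inside the cone. *)
Lemma near_axis_cone (z : spacetime) : 0 <= z ord0 ord0 <= tau ->
  (forall j, `|z ord0 (lift ord0 j)| <= 4^-1) -> cone_upto T z.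
Proof.
have := tau0; have := tau1; have := tauT => tT t1 t0 /andP[z0 z1] zj.
have he : enorm (space_coord z) <= 2^-1.
  by apply: enorm_le_half => j; rewrite space_coordE.
rewrite /cone_upto /cone /= /time_coord; split; last by rewrite z0; lra.
by split; [rewrite z0; lra|lra].
Qed.

Lemma slab_cone : slab 0 tau `<=` @cone_upto R d T.
Proof.
move=> z [z0 zj]; apply: near_axis_cone => // j; apply: (le_trans (zj j)).
lra.
Qed.

Lemma slab_cone_interior : slab (tau / 3) (2 * tau / 3) `<=` @cone_interior R d T.
Proof.
have := tau0; have := tau1 => t1 t0.
(* This radius keeps the time in [[0, tau]] and the coordinates below [1/8 + 1/96 < 1/4]. *)
move=> z [/andP[z0 z1] zj]; apply/nbhs_ballP; exists (tau / 6) => /=; first lra.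
move=> y [_ zy]; apply: near_axis_cone.
  by have := zy ord0 ord0; rewrite /ball /= ltr_norml => /andP[h1 h2]; apply/andP; lra.
move=> j; have := zy ord0 (lift ord0 j); rewrite /ball /=.
have := zj j; rewrite ltr_norml !ler_norml => /andP[h1 h2] /andP[h3 h4].
by apply/andP; lra.
Qed.

Definition weight (z : spacetime) : R := rho tau z * theta z.

Lemma flatgen_weight : flatgen weight.
Proof. by apply: flatgen_mul; [exact: flatgen_rho|exact: flatgen_theta]. Qed.

Lemma flatgen_box (f : spacetime -> R) : flatgen f -> flatgen (box f).
Proof.
move=> F; apply: flatgen_add; first exact/flatgen_pd/flatgen_pd.
by apply: flatgen_opp; apply: flatgen_sum => j; exact/flatgen_pd/flatgen_pd.
Qed.

Lemma box_weight_supp z : ~ slab (tau / 3) (2 * tau / 3) z -> box weight z = 0.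
Proof.
move=> nz; rewrite /box.
have cS := @closed_slab R d (tau / 3) (2 * tau / 3).
have w0 := @rho_theta_supp R d tau tau0 tau1.
rewrite (pd_supp _ cS (pd_supp _ cS w0)) // big1 ?subr0 // => j _.
by rewrite (pd_supp _ cS (pd_supp _ cS w0)).
Qed.

Lemma csmooth_real n (f : 'rV[R]_n -> R) : flatgen f -> csmooth setT (fun x => (f x)%:C).
Proof. by move=> F; split; apply: flatgen_smooth => //; exact: flatgen_cst. Qed.

Definition box_weight_test : test_function (@cone_interior R d T).
Proof.
exists (fun z => (box weight z)%:C).
  exact/csmooth_real/flatgen_box/flatgen_weight.
exists (slab (tau / 3) (2 * tau / 3)); split.
- exact: compact_slab.
- exact: slab_cone_interior.
- by move=> z /box_weight_supp ->.
Defined.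

(** Two integrations by parts in each direction; their signs cancel, and the support of the weight
    leaves no boundary term. *)
Lemma Rintegral_box (V : set spacetime) (f : spacetime -> R) : open V -> slab 0 tau `<=` V ->
  smooth V f ->
  \int[mu]_z (box weight z * f z) = \int[mu]_z (weight z * box f z).
Proof.
have := tau0; have := tau1 => t1 t0 oV KV sf.
pose S : set spacetime := slab (tau / 3) (2 * tau / 3).
have cS : closed S by exact: closed_slab.
have SV : S `<=` V.
  by move=> z [/andP[z0 z1] zj]; apply: KV; split => //; apply/andP; lra.
have SL : S `<=` rbox d.+1 1 by apply: slab_rbox; lra.
have w0 : forall z, ~ S z -> weight z = 0 := @rho_theta_supp R d tau tau0 tau1.
have fw := flatgen_weight.
have C1 g i : smooth V g -> forall z, V z ->
    [/\ {for z, continuous g}, derivable g z 'e_i & {for z, continuous (pd i g)}].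
  by move=> sg z; exact: smooth_C1.
have two i : \int[mu]_z (pd i (pd i weight) z * f z) = \int[mu]_z (weight z * pd i (pd i f) z).
  have pw0 := pd_supp i cS w0.
  have := Rintegral_pd_cutM oV cS SV SL (flatgen_pd i fw) pw0 (C1 f i sf).
  rewrite (Rintegral_pd_cutM oV cS SV SL fw w0 (C1 _ i (smooth_pd i sf))).
  by move=> ->; rewrite opprK.
have integr (u g : spacetime -> R) : flatgen u -> (forall z, ~ S z -> u z = 0) -> smooth V g ->
    mu.-integrable setT (EFin \o (fun z => u z * g z)).
  move=> fu u0 sg; apply: (integrable_continuous_rbox (L := 1)).
    apply: (continuous_cutM oV cS SV (flatgen_continuous fu) u0) => z Vz.
    by have [] := C1 g ord0 sg z Vz.
  by move=> z nz; rewrite u0 ?mul0r // => /SL.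
have i1 i : mu.-integrable setT (EFin \o (fun z => pd i (pd i weight) z * f z)).
  apply: integr => //; first exact/flatgen_pd/flatgen_pd.
  exact: (pd_supp i cS (pd_supp i cS w0)).
have i2 i : mu.-integrable setT (EFin \o (fun z => weight z * pd i (pd i f) z)).
  by apply: integr => //; exact/smooth_pd/smooth_pd.
rewrite /box.
under eq_Rintegral do rewrite mulrBl mulr_suml.
under [RHS]eq_Rintegral do rewrite mulrBr mulr_sumr.
have s1 := integrable_fsum (index_enum 'I_d) measurableT (fun j => i1 (lift ord0 j)).
have s2 := integrable_fsum (index_enum 'I_d) measurableT (fun j => i2 (lift ord0 j)).
rewrite !RintegralB // two; congr (_ - _).
rewrite !Rintegral_fsum //.
by apply: eq_bigr => j _; exact: two.
Qed.

Variables (M : R) (gamma : 'I_d.+1 -> 'M[R[i]]_N).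
Hypothesis hg : dirac_matrices gamma.
Variables (psi : spacetime -> 'cV[R[i]]_N) (A : 'I_d.+1 -> spacetime -> R).
Hypothesis smth : smooth_on_cone T psi A.
Hypothesis sol : forall z, cone_upto T z -> dirac_eq M gamma psi A z /\ maxwell_eq gamma psi A z.

Lemma potential_pairing :
  cintegral (@cone_interior R d T) (fun z => (A ord0 z)%:C * box_weight_test z) =
  (\int[mu]_z (weight z * current psi 1%:M z))%:C.
Proof.
have := tau0; have := tau1 => t1 t0.
have [V [oV CV spsi sA]] := smth.
have KV : slab 0 tau `<=` V by move=> z /slab_cone; exact: CV.
rewrite /cintegral.
have -> : \int[mu]_(z in @cone_interior R d T) complex.Im ((A ord0 z)%:C * box_weight_test z) = 0.
  rewrite /Rintegral integral0_eq // => z _ /=.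
  by rewrite mulr0 mul0r addr0.
congr (_ +i* _).
transitivity (\int[mu]_z (box weight z * A ord0 z)).
  rewrite Rintegral_mkcond; apply: eq_Rintegral => z _; rewrite patchE.
  case: ifPn => [_|/negP]; first by rewrite /= mulr0 subr0 mulrC.
  rewrite in_setE => nz; rewrite box_weight_supp ?mul0r // => /slab_cone_interior.
  exact: nz.
rewrite (Rintegral_box oV KV) //.
apply: eq_Rintegral => z _.
have [Sz|nSz] := pselect (slab (tau / 3) (2 * tau / 3) z); last first.
  by rewrite /weight rho_theta_supp // !mul0r.
rewrite (maxwell_current (psi := psi) hg (A := A)) //; apply: (sol _).2; apply: slab_cone.
by move: Sz => [/andP[z0 z1] zj]; split => //; apply/andP; lra.
Qed.

Lemma pairing_lower_bound (f : 'I_N -> 'rV[R]_d -> R[i]) :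
  cauchy_data psi A f ->
  let g x := bump_half (bump_half (tau / 3)) *
     (theta (row_cons (0, x)) * \sum_k cmod (f k x) ^+ 2) in
  (lebesgue_rV d).-integrable setT (EFin \o g) /\
  \int[lebesgue_rV d]_x g x <= \int[mu]_z (weight z * current psi 1%:M z).
Proof.
move=> cd g.
have := tau0; have := tau1 => t1 t0.
have [V [oV CV spsi sA]] := smth.
have KV : slab 0 tau `<=` V by move=> z /slab_cone; exact: CV.
have J0 z : current psi (alpha gamma ord0) z = current psi 1%:M z by rewrite (alpha0 hg).
have [|||] := @charge_estimate R d V (fun m => current psi (alpha gamma m)) tau oV tau0 tau1 KV.
- by move=> m i z Vz; exact: (current_C1 oV spsi).
- move=> z Kz; have Cz := slab_cone Kz.
  exact: (current_conservation spsi hg (CV z Cz) (sol Cz).1).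
- by move=> m z _; rewrite J0; exact: current_bound.
have gE : g = initial_density (fun m => current psi (alpha gamma m)) tau.
  apply/funext => x; rewrite /g /initial_density; congr (_ * _).
  (* The Cauchy data are known in the unit ball only; outside this cube, which lies in the ball,
     [theta] vanishes at [t = 0]. *)
  have [hx|] := pselect (forall j, `|x ord0 j| <= 4^-1); last first.
    move=> /existsNP[j] /negP; rewrite -ltNge => hj.
    rewrite theta_supp ?mul0r //; first by rewrite row_cons0 /= invr_ge0.
    exists j; rewrite row_consS /=; apply: lt_trans hj; lra.
  rewrite J0 current1E; congr (_ * _); apply: eq_bigr => k _.
  have xb : unit_ball x by rewrite /unit_ball /=; apply: le_lt_trans (enorm_le_half hx) _; lra.
  by have [/(_ k) <- _] := cd x xb.
move=> ig le; rewrite gE; split; first exact: ig.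
apply: (le_trans le).
have -> : (fun z => rho tau z * theta z * current psi (alpha gamma ord0) z) =
    (fun z => weight z * current psi 1%:M z) by apply/funext => z; rewrite J0.
exact: lexx.
Qed.

End test_in_cone.

(** * Fourier transforms and norms of densities *)

Section power_integrals.
Context {R : realType}.
Local Notation leb := (@lebesgue_measure R).

Definition decay (a t : R) : R := (1 + `|t|) `^ (- a).

Lemma decay_ge0 a t : 0 <= decay a t. Proof. exact: powR_ge0. Qed.

Lemma decayD a b t : decay (a + b) t = decay a t * decay b t.
Proof.
by rewrite /decay opprD powRD //; apply/implyP => _; rewrite gt_eqF // ltr_pwDl.
Qed.

Lemma continuous_decay a : continuous (decay a).
Proof.
move=> t; rewrite /decay.
have c1 : {for t, continuous (fun t : R => 1 + `|t|)}.
  by apply: continuousD; [exact: cst_continuous|exact: norm_continuous].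
apply: (@continuous_comp _ _ _ (fun t : R => 1 + `|t|) (fun y : R => y `^ (- a)) t c1).
apply: differentiable_continuous; apply/derivable1_diffP.
by apply: derivable_powR; rewrite in_itv /= andbT ltr_pwDl.
Qed.

Lemma decay_integral_lty a : 1 < a -> (\int[leb]_t (decay a t)%:E < +oo)%E.
Proof.
move=> a1.
have ev : decay a =1 decay a \o -%R by move=> t; rewrite /decay /= normrN.
rewrite (ge0_symfun_integralT (decay_ge0 a) (@continuous_decay a) ev) -set_itvcy.
pose c := a - 1.
have c0 : 0 < c by rewrite subr_gt0.
(* By evenness only the half-line is left; there [F] is a primitive that tends to 0 at infinity. *)
pose F (x : R) : R := - c^-1 * (1 + x) `^ (- c).
have dF (x : R) : -1 < x -> is_derive x 1 F ((1 + x) `^ (- a)).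
  move=> x1; have x0 : 0 < 1 + x by lra.
  have d1 : is_derive (1 + x) 1 (fun y : R => y `^ (- c)) (- c * (1 + x) `^ (- c - 1)).
    split; first by apply: derivable_powR; rewrite in_itv /= andbT.
    by rewrite -derive1E powR_derive1 // in_itv /= andbT.
  have d2 : is_derive x 1 (fun x : R => 1 + x) (0 + 1).
    exact: (is_deriveD (is_derive_cst (1 : R) x 1) (is_derive_id x 1)).
  have := is_deriveMr (is_derive_cst (- c^-1 : R) x 1) (is_derive_outer d1 d2).
  rewrite mul0r !add0r mulr1 mulrA mulrNN mulVf ?gt_eqF // mul1r.
  by rewrite (_ : - c - 1 = - a) // /c; ring.
have Flim : F x @[x --> +oo] --> (0 : R).
  apply/cvgr0Pnorm_le => e e0; near=> x.
  have ec : 0 < e * c by rewrite mulr_gt0.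
  (* The threshold solves [y^(- c) / c = e]. *)
  have x0 : (e * c) `^ (- c^-1) <= x by near: x; apply: nbhs_pinfty_ge; exact: num_real.
  have y0 : 0 < (e * c) `^ (- c^-1) by exact: powR_gt0.
  rewrite /F normrM normrN normfV (gtr0_norm c0) ger0_norm ?powR_ge0 //.
  rewrite ler_pdivrMl // mulrC powRN -[leRHS]invrK lef_pV2 ?posrE ?invr_gt0 //; last first.
    by apply: powR_gt0; lra.
  have -> : (e * c)^-1 = ((e * c) `^ (- c^-1)) `^ c.
    by rewrite -powRrM mulNr mulVf ?gt_eqF // powR_inv1 // ltW.
  by apply: ge0_ler_powR; rewrite ?nnegrE; lra.
have -> : (\int[leb]_(t in `[0%R, +oo[) (decay a t)%:E =
    \int[leb]_(t in `[0%R, +oo[) ((1 + t) `^ (- a))%:E)%E.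
  apply: eq_integral => t; rewrite in_setE /= in_itv /= andbT => t0.
  by rewrite /decay ger0_norm.
rewrite (@ge0_continuous_FTC2y _ _ F 0 0).
- by rewrite -EFinB -EFinM ltry.
- by move=> x _; exact: powR_ge0.
- apply: continuous_in_subspaceT => x; rewrite inE /= in_itv /= andbT => x0.
  apply: (@continuous_comp _ _ _ (fun x : R => 1 + x) (fun y : R => y `^ (- a))).
    by apply: continuousD; [exact: cst_continuous|exact: cvg_id].
  apply: differentiable_continuous; apply/derivable1_diffP.
  by apply: derivable_powR; rewrite in_itv /= andbT; lra.
- exact: Flim.
- by move=> x x0; have [] := dF x (lt_trans (ltrN10 R) x0).
- apply: cvg_at_right_filter; apply: differentiable_continuous; apply/derivable1_diffP.
  by have [] := dF 0 (ltrN10 R).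
- move=> x; rewrite in_itv /= andbT => x0; rewrite derive1E.
  by have [_ ->] := dF x (lt_trans (ltrN10 R) x0).
Unshelve. all: by end_near. Qed.

End power_integrals.

Section product_split.
Context {R : realType}.
Local Notation leb := (@lebesgue_measure R).

Lemma measurable_row_uncons1 n : measurable_fun setT
  (fun z : 'rV[R]_n.+1 => (row_uncons z).1).
Proof. exact: (measurableT_comp measurable_fst (@measurable_row_uncons R n)). Qed.

Lemma measurable_row_uncons2 n : measurable_fun setT
  (fun z : 'rV[R]_n.+1 => (row_uncons z).2).
Proof. exact: (measurableT_comp measurable_snd (@measurable_row_uncons R n)). Qed.

Lemma Rintegral_split n (u : R -> R) (v : 'rV[R]_n -> R) :
  leb.-integrable setT (EFin \o u) ->
  (lebesgue_rV n).-integrable setT (EFin \o v) ->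
  let F z := u (row_uncons z).1 * v (row_uncons z).2 in
  (lebesgue_rV n.+1).-integrable setT (EFin \o F) /\
  \int[lebesgue_rV n.+1]_z F z = (\int[leb]_t u t) * \int[lebesgue_rV n]_x v x.
Proof.
move=> iu iv F.
have mu : measurable_fun setT (u : measurableTypeR R -> measurableTypeR R).
  by apply/measurable_EFinP; exact: measurable_int iu.
have mv : measurable_fun setT (v : 'rV[R]_n -> measurableTypeR R).
  by apply/measurable_EFinP; exact: measurable_int iv.
have mF : measurable_fun setT (F : 'rV[R]_n.+1 -> measurableTypeR R).
  apply: measurable_funM.
    exact: (measurableT_comp mu (@measurable_row_uncons1 n)).
  exact: (measurableT_comp mv (@measurable_row_uncons2 n)).
have FE t x : F (row_cons (t, x)) = u t * v x by rewrite /F row_consK.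
have iF : (lebesgue_rV n.+1).-integrable setT (EFin \o F).
  apply/integrableP; split; first exact/measurable_EFinP.
  rewrite ge0_integral_rVS //; last first.
    by apply: measurableT_comp => //; exact/measurable_EFinP.
  have [_ fu] := integrableP _ _ _ iu; have [_ fv] := integrableP _ _ _ iv.
  pose cv := (\int[lebesgue_rV n]_x `|(v x)%:E|)%E.
  have cv0 : (0 <= cv)%E by exact: integral_ge0.
  have -> : (\int[leb]_t \int[lebesgue_rV n]_x `|(EFin \o F) (row_cons (t, x))| =
      \int[leb]_t (`|(u t)%:E| * cv))%E.
    apply: eq_integral => t _; under eq_integral do rewrite /= FE normrM EFinM.
    by rewrite ge0_integralZl //; exact: measurable_int (integrable_abse iv).
  rewrite ge0_integralZr //; last exact: measurable_int (integrable_abse iu).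
  have U0 : (0 <= \int[leb]_t `|(u t)%:E|)%E by exact: integral_ge0.
  by apply: lte_mul_pinfty => //; rewrite ge0_fin_numE.
split => //.
rewrite /Rintegral integral_rVS12 //.
have fv : (\int[lebesgue_rV n]_x (v x)%:E)%E \is a fin_num by exact: integrable_fin_num.
have fu : (\int[leb]_t (u t)%:E)%E \is a fin_num by exact: integrable_fin_num.
have -> : (\int[leb]_t \int[lebesgue_rV n]_x (EFin \o F) (row_cons (t, x)) =
    \int[leb]_t ((u t)%:E * \int[lebesgue_rV n]_x (v x)%:E))%E.
  apply: eq_integral => t _; under eq_integral do rewrite /= FE EFinM.
  by rewrite integralZl.
by rewrite -(fineK fv) integralZr // -(fineK fu) -EFinM.
Qed.

End product_split.

Section bounded_multiples.
Context d (T : measurableType d) {R : realType} (mu : {measure set T -> \bar R}).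

Lemma integrable_mul_bounded (f k : T -> R) (C : R) :
  mu.-integrable setT (EFin \o f) -> measurable_fun setT (k : T -> measurableTypeR R) ->
  (forall x, `|k x| <= C) -> mu.-integrable setT (EFin \o (fun x => f x * k x)).
Proof.
move=> iF mk kC.
have mf : measurable_fun setT (f : T -> measurableTypeR R).
  by apply/measurable_EFinP; exact: measurable_int iF.
apply: (@le_integrable _ _ _ mu setT measurableT _ (fun x => C%:E * (EFin \o f) x)%E).
- by apply/measurable_EFinP; exact: measurable_funM.
- move=> x _ /=; rewrite lee_fin !normrM mulrC ler_wpM2r //.
  by rewrite (le_trans (kC x)) // ler_norm.
- exact: integrableZl.
Qed.

Lemma le_normr_Rintegral1 (f g : T -> R) :
  mu.-integrable setT (EFin \o f) -> mu.-integrable setT (EFin \o g) ->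
  (forall x, `|f x| <= g x) -> `|\int[mu]_x f x| <= \int[mu]_x g x.
Proof.
move=> iF iG fg; apply: (le_trans (le_normr_Rintegral measurableT iF)).
by apply: le_Rintegral => //; exact: integrable_norm.
Qed.

Lemma RintegralN1 (f : T -> R) : mu.-integrable setT (EFin \o f) ->
  \int[mu]_x - f x = - (\int[mu]_x f x).
Proof.
move=> iF; rewrite -mulN1r -RintegralZl //.
by apply: eq_Rintegral => x _; rewrite mulN1r.
Qed.

End bounded_multiples.

(** * Fourier transform on the line *)

Section line_transform.
Context {R : realType}.
Local Notation leb := (@lebesgue_measure R).

Lemma measurable_cosM (t : R) : measurable_fun setT
  ((fun y => cos (y * t)) : measurableTypeR R -> measurableTypeR R).
Proof.
apply: continuous_measurable_fun => y; apply: continuous_comp; last exact: continuous_cos.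
exact: mulrr_continuous.
Qed.

Lemma measurable_sinM (t : R) : measurable_fun setT
  ((fun y => sin (y * t)) : measurableTypeR R -> measurableTypeR R).
Proof.
apply: continuous_measurable_fun => y; apply: continuous_comp; last exact: continuous_sin.
exact: mulrr_continuous.
Qed.

Lemma norm_cos_le1 (t : R) : `|cos t| <= 1.
Proof. by rewrite ler_norml cos_le1 cos_geN1. Qed.

Lemma norm_sin_le1 (t : R) : `|sin t| <= 1.
Proof. by rewrite ler_norml sin_le1 sin_geN1. Qed.

(** Up to sign, [hatc] and [hats] are the real and imaginary parts of the Fourier transform of a
    real function, and [hatm] is its modulus. *)
Definition hatc (u : R -> R) t := \int[leb]_y (u y * cos (y * t)).
Definition hats (u : R -> R) t := \int[leb]_y (u y * sin (y * t)).
Definition hatm u t := Num.sqrt (hatc u t ^+ 2 + hats u t ^+ 2).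

Lemma sqrt_sum_le (a b : R) : Num.sqrt (a ^+ 2 + b ^+ 2) <= `|a| + `|b|.
Proof.
have h : 0 <= `|a| + `|b| by rewrite addr_ge0.
rewrite -(ger0_norm h) -sqrtr_sqr ler_wsqrtr // sqrrD !real_normK ?num_real //.
by rewrite -addrA lerD2l addrC lerDl mulrn_wge0 // mulr_ge0.
Qed.

(** The transform of [u] is bounded by the L^1 norm of [u], and [t] times it, after integration by
    parts, by that of [du]. The factor 2 comes from bounding a modulus by the sum of its two
    parts. *)
Lemma hat_bound (u du : R -> R) (L A B : R) :
  (forall y : R, is_derive y 1 u (du y)) -> continuous du ->
  (forall y, L < `|y| -> u y = 0) ->
  leb.-integrable setT (EFin \o u) -> leb.-integrable setT (EFin \o du) ->
  \int[leb]_y `|u y| <= A -> \int[leb]_y `|du y| <= B ->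
  forall t, hatm u t <= 2 * A /\ (1 + `|t|) * hatm u t <= 2 * (A + B).
Proof.
move=> du1 cdu uL iu idu uA duB t.
have cu : continuous u.
  by move=> y; apply: differentiable_continuous; apply/derivable1_diffP; have [] := du1 y.
have iuc := integrable_mul_bounded iu (measurable_cosM t) (fun=> norm_cos_le1 _).
have ius := integrable_mul_bounded iu (measurable_sinM t) (fun=> norm_sin_le1 _).
have iduc := integrable_mul_bounded idu (measurable_cosM t) (fun=> norm_cos_le1 _).
have idus := integrable_mul_bounded idu (measurable_sinM t) (fun=> norm_sin_le1 _).
have small (f k : R -> R) C : leb.-integrable setT (EFin \o f) ->
    leb.-integrable setT (EFin \o (fun y => f y * k y)) -> (forall y, `|k y| <= 1) ->
    \int[leb]_y `|f y| <= C -> `|\int[leb]_y (f y * k y)| <= C.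
  move=> iF iFk k1; apply: le_trans; apply: le_normr_Rintegral1 => //.
    exact: integrable_norm.
  by move=> y; rewrite normrM ler_piMr.
have dlin (y : R) : is_derive y 1 (fun y : R => y * t) t.
  have := is_deriveMr (is_derive_id y 1) (is_derive_cst t y 1).
  by rewrite mul1r mulr0 addr0.
have clin : continuous (fun y : R => y * t) by exact: mulrr_continuous.
have csin : continuous (fun y : R => sin (y * t)).
  by move=> y; apply: continuous_comp; [exact: clin|exact: continuous_sin].
have ccos : continuous (fun y : R => cos (y * t)).
  by move=> y; apply: continuous_comp; [exact: clin|exact: continuous_cos].
(* Integration by parts as the vanishing of the integral of [(u k)']; applied below to sine and
   cosine. *)
have parts (k dk : R -> R) : (forall y : R, is_derive y 1 k (dk y)) -> continuous k -> continuous dk ->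
    \int[leb]_y (du y * k y + u y * dk y) = 0.
  move=> hk ck cdk; rewrite /Rintegral -[RHS]/(fine 0%E); congr fine.
  have dE y := is_deriveMr (du1 y) (hk y).
  rewrite -(@integral_derive_eq0 R (fun y => u y * k y) L).
  - by apply: eq_integral => y _; rewrite (derive_val (is_derive := dE y)).
  - by move=> y; have [] := dE y.
  - rewrite (_ : (fun y : R => 'D_1 (fun y => u y * k y) y) = fun y => du y * k y + u y * dk y).
      move=> y; apply: (@continuousD _ _ _ (fun y => du y * k y) (fun y => u y * dk y)).
        exact: (@continuousM _ _ du k y (cdu y) (ck y)).
      exact: (@continuousM _ _ u dk y (cu y) (cdk y)).
    by apply/funext => y; rewrite (derive_val (is_derive := dE y)).
  - by move=> y /uL ->; rewrite mul0r.
have Ec : t * hatc u t = - (\int[leb]_y (du y * sin (y * t))).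
  have hk (y : R) : is_derive y 1 (fun y => sin (y * t)) (cos (y * t) * t).
    exact: (is_derive_outer (is_derive_sin _) (dlin y)).
  have ccos' : continuous (fun y : R => cos (y * t) * t).
    by move=> y; apply: (@continuousM _ _ (fun y : R => cos (y * t)) (fun=> t)); [exact: ccos|exact: cst_continuous].
  have := parts _ _ hk csin ccos'.
  have -> : \int[leb]_y (du y * sin (y * t) + u y * (cos (y * t) * t)) =
      \int[leb]_y (du y * sin (y * t) + t * (u y * cos (y * t))).
    by apply: eq_Rintegral => y _; ring.
  rewrite RintegralD //; last exact: (integrableZl measurableT t iuc).
  by rewrite RintegralZl // => /eqP; rewrite addrC addr_eq0 => /eqP.
have Es : t * hats u t = \int[leb]_y (du y * cos (y * t)).
  have hk (y : R) : is_derive y 1 (fun y => cos (y * t)) (- sin (y * t) * t).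
    exact: (is_derive_outer (is_derive_cos _) (dlin y)).
  have csin' : continuous (fun y : R => - sin (y * t) * t).
    move=> y; apply: (@continuousM _ _ (fun y : R => - sin (y * t)) (fun=> t)); last exact: cst_continuous.
    exact: (@continuousN _ _ _ (fun y : R => sin (y * t)) y (csin y)).
  have := parts _ _ hk ccos csin'.
  have -> : \int[leb]_y (du y * cos (y * t) + u y * (- sin (y * t) * t)) =
      \int[leb]_y (du y * cos (y * t) + (- t) * (u y * sin (y * t))).
    by apply: eq_Rintegral => y _; ring.
  rewrite RintegralD //; last exact: (integrableZl measurableT (- t) ius).
  by rewrite RintegralZl // mulNr => /eqP; rewrite subr_eq0 => /eqP.
have c1 : `|hatc u t| <= A by apply: small => // y; exact: norm_cos_le1.
have s1 : `|hats u t| <= A by apply: small => // y; exact: norm_sin_le1.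
have c2 : `|t| * `|hatc u t| <= B.
  by rewrite -normrM Ec normrN; apply: small => // y; exact: norm_sin_le1.
have s2 : `|t| * `|hats u t| <= B.
  by rewrite -normrM Es; apply: small => // y; exact: norm_cos_le1.
have m := sqrt_sum_le (hatc u t) (hats u t).
split; first by apply: (le_trans m); lra.
have h1 : 0 <= 1 + `|t| by rewrite addr_ge0.
apply: (le_trans (ler_wpM2l h1 m)).
rewrite mulrDr !mulrDl !mul1r; lra.
Qed.

End line_transform.

(** * Fourier transform of tensor products *)

Section transform_rV.
Context {R : realType}.
Local Notation leb := (@lebesgue_measure R).

Definition ang n (x xi : 'rV[R]_n) : R := \sum_i x ord0 i * xi ord0 i.

Lemma angC n (x xi : 'rV[R]_n) : ang x xi = ang xi x.
Proof. by apply: eq_bigr => i _; rewrite mulrC. Qed.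

Lemma measurable_ang n : measurable_fun setT
  ((fun p => ang p.1 p.2) : 'rV[R]_n * 'rV[R]_n -> measurableTypeR R).
Proof.
apply: measurable_sum => i; apply: measurable_funM.
  exact: (measurableT_comp (@measurable_row_coord R n i) measurable_fst).
exact: (measurableT_comp (@measurable_row_coord R n i) measurable_snd).
Qed.

Lemma measurable_cos_ang n : measurable_fun setT
  ((fun p => cos (ang p.1 p.2)) : 'rV[R]_n * 'rV[R]_n -> measurableTypeR R).
Proof.
apply: (measurableT_comp _ (@measurable_ang n)).
by apply: continuous_measurable_fun; exact: continuous_cos.
Qed.

Lemma measurable_sin_ang n : measurable_fun setT
  ((fun p => sin (ang p.1 p.2)) : 'rV[R]_n * 'rV[R]_n -> measurableTypeR R).
Proof.
apply: (measurableT_comp _ (@measurable_ang n)).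
by apply: continuous_measurable_fun; exact: continuous_sin.
Qed.

Definition cosT n (G : 'rV[R]_n -> R) xi : R := \int[lebesgue_rV n]_x (G x * cos (ang x xi)).
Definition sinT n (G : 'rV[R]_n -> R) xi : R := \int[lebesgue_rV n]_x (G x * sin (ang x xi)).

Lemma integrable_mul_cos n (G : 'rV[R]_n -> R) xi :
  (lebesgue_rV n).-integrable setT (EFin \o G) ->
  (lebesgue_rV n).-integrable setT (EFin \o (fun x => G x * cos (ang x xi))).
Proof.
move=> iG; apply: (integrable_mul_bounded (C := 1)) => // [|x]; last exact: norm_cos_le1.
exact: (measurable_fun_pair1 xi (@measurable_cos_ang n)).
Qed.

Lemma integrable_mul_sin n (G : 'rV[R]_n -> R) xi :
  (lebesgue_rV n).-integrable setT (EFin \o G) ->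
  (lebesgue_rV n).-integrable setT (EFin \o (fun x => G x * sin (ang x xi))).
Proof.
move=> iG; apply: (integrable_mul_bounded (C := 1)) => // [|x]; last exact: norm_sin_le1.
exact: (measurable_fun_pair1 xi (@measurable_sin_ang n)).
Qed.

Lemma ang_uncons n (z xi : 'rV[R]_n.+1) :
  ang z xi = (row_uncons z).1 * xi ord0 ord0 + ang (row_uncons z).2 (row_uncons xi).2.
Proof.
rewrite -[z in LHS]row_unconsK -[xi in LHS]row_unconsK /ang big_ord_recl.
rewrite !row_cons0; congr (_ + _).
by apply: eq_bigr => i _; rewrite !row_consS.
Qed.

Definition tensor n (u : R -> R) (x : 'rV[R]_n) : R := \prod_(i < n) u (x ord0 i).

Lemma tensor_uncons n u (z : 'rV[R]_n.+1) :
  tensor u z = u (row_uncons z).1 * tensor u (row_uncons z).2.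
Proof.
rewrite -[z in LHS]row_unconsK /tensor big_ord_recl row_cons0; congr (_ * _).
by apply: eq_bigr => i _; rewrite row_consS.
Qed.

Lemma integrable_tensor n u : leb.-integrable setT (EFin \o u) ->
  (lebesgue_rV n).-integrable setT (EFin \o @tensor n u).
Proof.
move=> iu; elim: n => [|n IH].
  apply: (@integrable_rbox _ _ _ 0 1).
  - rewrite (_ : @tensor 0 u = fun=> 1); first exact: measurable_cst.
    by apply/funext => x; rewrite /tensor big_ord0.
  - by move=> x; rewrite /tensor big_ord0 normr1.
  - by move=> x []; case.
have [h _] := Rintegral_split iu IH.
rewrite (_ : @tensor n.+1 u = fun z => u (row_uncons z).1 * tensor u (row_uncons z).2) //.
by apply/funext => z; exact: tensor_uncons.
Qed.

(** By the addition formulas the pairs of cosine and sine transforms multiply like complex numbers,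
    so their squared moduli multiply. *)
Lemma transform_tensor n u (xi : 'rV[R]_n) : leb.-integrable setT (EFin \o u) ->
  cosT (@tensor n u) xi ^+ 2 + sinT (@tensor n u) xi ^+ 2 =
  \prod_(i < n) (hatc u (xi ord0 i) ^+ 2 + hats u (xi ord0 i) ^+ 2).
Proof.
move=> iu; elim: n xi => [|n IH] xi.
  (* In dimension 0 the measure is the Dirac mass at the only point, where the empty product is 1
     and the phase is 0. *)
  rewrite big_ord0 /cosT /sinT /Rintegral.
  rewrite (eq_integral (fun=> 1%:E)); last first.
    by move=> x _; rewrite /tensor /ang !big_ord0 cos0 mulr1.
  rewrite [X in _ + fine X ^+ 2]integral0_eq; last first.
    by move=> x _; rewrite /tensor /ang !big_ord0 sin0 mulr0.
  by rewrite integral_dirac // diracT mul1e /= expr1n expr0n addr0.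
pose t := xi ord0 ord0; pose eta := (row_uncons xi).2.
have iT := integrable_tensor n iu.
have iuc := integrable_mul_bounded iu (measurable_cosM t) (fun=> norm_cos_le1 _).
have ius := integrable_mul_bounded iu (measurable_sinM t) (fun=> norm_sin_le1 _).
have iTc := integrable_mul_cos eta iT.
have iTs := integrable_mul_sin eta iT.
have [i1 e1] := Rintegral_split iuc iTc; have [i2 e2] := Rintegral_split ius iTs.
have [i3 e3] := Rintegral_split iuc iTs; have [i4 e4] := Rintegral_split ius iTc.
have Ec : cosT (@tensor n.+1 u) xi =
    hatc u t * cosT (@tensor n u) eta - hats u t * sinT (@tensor n u) eta.
  rewrite /hatc /hats /cosT /sinT -e1 -e2 -RintegralB //.
  by apply: eq_Rintegral => z _; rewrite tensor_uncons ang_uncons cosD; ring.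
have Es : sinT (@tensor n.+1 u) xi =
    hatc u t * sinT (@tensor n u) eta + hats u t * cosT (@tensor n u) eta.
  rewrite /hatc /hats /cosT /sinT -e3 -e4 -RintegralD //.
  by apply: eq_Rintegral => z _; rewrite tensor_uncons ang_uncons sinD; ring.
rewrite big_ord_recl -/t (_ : \prod_(i < n) _ =
    \prod_(i < n) (hatc u (eta ord0 i) ^+ 2 + hats u (eta ord0 i) ^+ 2)); last first.
  apply: eq_bigr => i _; rewrite /eta -{1 2}[xi]row_unconsK /=.
  by rewrite row_consS.
by rewrite -IH Ec Es; ring.
Qed.

Lemma fourier_real n (G : 'rV[R]_n -> R) xi :
  (lebesgue_rV n).-integrable setT (EFin \o G) ->
  fourier (fun x => (G x)%:C) xi = cosT G xi -i* sinT G xi.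
Proof.
move=> iG; rewrite /fourier /cintegral; congr (_ +i* _).
  by apply: eq_Rintegral => x _ /=; rewrite mul0r subr0.
rewrite /sinT -RintegralN1; last exact: integrable_mul_sin.
by apply: eq_Rintegral => x _ /=; rewrite mul0r addr0 mulrN.
Qed.

Lemma cmod_fourier_tensor n u (xi : 'rV[R]_n) : leb.-integrable setT (EFin \o u) ->
  cmod (fourier (fun x => (@tensor n u x)%:C) xi) = \prod_(i < n) hatm u (xi ord0 i).
Proof.
move=> iu; rewrite fourier_real; last exact: integrable_tensor.
rewrite /=.
rewrite sqrrN transform_tensor //.
have h (s : seq 'I_n) : Num.sqrt (\prod_(i <- s) (hatc u (xi ord0 i) ^+ 2 + hats u (xi ord0 i) ^+ 2))
    = \prod_(i <- s) hatm u (xi ord0 i).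
  elim: s => [|i s IH]; first by rewrite !big_nil sqrtr1.
  by rewrite !big_cons sqrtrM ?IH // addr_ge0 ?sqr_ge0.
exact: h.
Qed.

End transform_rV.

(** * Integrability of Schwartz functions *)

Section schwartz_integrals.
Context {R : realType} {n : nat}.
Local Notation mu := (lebesgue_rV n : {measure set 'rV[R]_n -> \bar R}).

(** A product replaces a power of [1 + |x|]: its integral factors, and it has the shape of the
    bounds for transforms of tensor products. *)
Definition decayn (a : R) (x : 'rV[R]_n) : R := \prod_(i < n) decay a (x ord0 i).

Lemma decayn_ge0 a x : 0 <= decayn a x.
Proof. by apply: prodr_ge0 => i _; exact: decay_ge0. Qed.

Lemma measurable_decayn a : measurable_fun setT (decayn a : _ -> measurableTypeR R).
Proof.
apply: measurable_prod => i _; apply: (measurableT_comp (continuous_measurable_fun (@continuous_decay R a))).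
exact: measurable_row_coord.
Qed.

Lemma integrable_decayn a : 1 < a -> mu.-integrable setT (EFin \o decayn a).
Proof.
move=> a1; apply/integrableP; split; first by apply/measurable_EFinP; exact: measurable_decayn.
under eq_integral => x _ do rewrite /= ger0_norm ?decayn_ge0 //.
rewrite ge0_integral_rV_prod //; last 2 first.
- by apply: continuous_measurable_fun; exact: continuous_decay.
- by move=> t; exact: decay_ge0.
have fin : (\int[@lebesgue_measure R]_t (decay a t)%:E)%E \is a fin_num.
  rewrite ge0_fin_numE; first exact: decay_integral_lty.
  by apply: integral_ge0 => t _; rewrite lee_fin decay_ge0.
by rewrite -(fineK fin) prodEFin ltry.
Qed.

Lemma coord_le_enorm (x : 'rV[R]_n) i : `|x ord0 i| <= enorm x.
Proof.
rewrite /enorm -sqrtr_sqr ler_wsqrtr // (bigD1 i) //= lerDl.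
by apply: sumr_ge0 => j _; exact: sqr_ge0.
Qed.

Lemma schwartz_decayn (phi : schwartz R n) :
  exists2 b : R, 0 <= b & forall x, cmod (phi x) <= b * decayn 2 x.
Proof.
(* Order [2 n] suffices because the product of the [n] factors [(1 + |x_i|)^2] is at most
   [(1 + |x|)^(2 n)]. *)
have [b hb] := schwartz_decay phi (2 * n) [::].
exists `|b| => // x; rewrite /= in hb.
have c0 : 0 <= cmod (phi x) by case: (phi x) => ? ? /=; exact: sqrtr_ge0.
have -> : decayn 2 x = (\prod_(i < n) (1 + `|x ord0 i|) ^+ 2)^-1.
  rewrite -prodfV; apply: eq_bigr => i _.
  by rewrite /decay powR_invn // addr_ge0.
have P0 : 0 < \prod_(i < n) (1 + `|x ord0 i|) ^+ 2.
  by apply: prodr_gt0 => i _; rewrite exprn_gt0 // ltr_pwDl.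
rewrite ler_pdivlMr // mulrC.
apply: le_trans (le_trans (hb x) (ler_norm b)); rewrite ler_wpM2r //.
rewrite exprM -[X in _ ^+ X]card_ord -prodr_const; apply: ler_prod => i _.
rewrite exprn_ge0 ?addr_ge0 //= lerXn2r ?nnegrE ?addr_ge0 ?sqrtr_ge0 //.
by rewrite lerD2l coord_le_enorm.
Qed.

Lemma norm_Re_le (z : R[i]) : `|complex.Re z| <= cmod z.
Proof.
by case: z => a b /=; rewrite -sqrtr_sqr ler_wsqrtr // lerDl sqr_ge0.
Qed.

Lemma norm_Im_le (z : R[i]) : `|complex.Im z| <= cmod z.
Proof.
by case: z => a b /=; rewrite -sqrtr_sqr ler_wsqrtr // lerDr sqr_ge0.
Qed.

Lemma measurable_schwartz (phi : schwartz R n) :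
  measurable_fun setT ((fun x => complex.Re (phi x)) : 'rV[R]_n -> measurableTypeR R) /\
  measurable_fun setT ((fun x => complex.Im (phi x)) : 'rV[R]_n -> measurableTypeR R).
Proof.
have [s1 s2] := schwartz_smooth phi; split; apply: continuous_measurable_rV => x.
- by have [] := s1 [::] x I.
- by have [] := s2 [::] x I.
Qed.

Lemma integrable_schwartz (phi : schwartz R n) :
  mu.-integrable setT (EFin \o (fun x => complex.Re (phi x))) /\
  mu.-integrable setT (EFin \o (fun x => complex.Im (phi x))).
Proof.
have [b b0 hb] := schwartz_decayn phi.
have [m1 m2] := measurable_schwartz phi.
have i2 : mu.-integrable setT (EFin \o (fun x => b * decayn 2 x)).
  have iD : mu.-integrable setT (EFin \o decayn 2) by apply: integrable_decayn; rewrite ltr1n.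
  exact: (integrableZl measurableT b iD).
split; (apply: le_integrable i2 => //; first exact/measurable_EFinP) => x _ /=;
  rewrite lee_fin [leRHS]ger0_norm ?mulr_ge0 ?decayn_ge0 //.
- exact: (le_trans (norm_Re_le _) (hb x)).
- exact: (le_trans (norm_Im_le _) (hb x)).
Qed.

Lemma bounded_schwartz (phi : schwartz R n) :
  exists2 b : R, 0 <= b & forall x, cmod (phi x) <= b.
Proof.
have [b hb] := schwartz_decay phi 0 [::]; exists `|b| => // x.
by have := hb x; rewrite /= expr0 mul1r => /le_trans; apply; exact: ler_norm.
Qed.

End schwartz_integrals.

(** * Fubini with bounded kernels *)

Section fubini_kernels.
Context {R : realType} {n : nat}.
Local Notation mu := (lebesgue_rV n).

Lemma integrable_kernel_mul (p : 'rV[R]_n -> R) k x :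
  mu.-integrable setT (EFin \o p) ->
  measurable_fun setT (k : 'rV[R]_n * 'rV[R]_n -> measurableTypeR R) ->
  (forall z, `|k z| <= 1) -> mu.-integrable setT (EFin \o (fun y => p y * k (x, y))).
Proof.
move=> ip mk k1; apply: (integrable_mul_bounded ip (C := 1)) => //.
exact: (measurable_fun_pair2 x mk).
Qed.

(** Moves an integral transform from one factor to the other. The kernel is bounded by 1, so
    [|p| |G|] dominates and factors. *)
Lemma fubini_kernel (G p : 'rV[R]_n -> R) (k : 'rV[R]_n * 'rV[R]_n -> R) :
  mu.-integrable setT (EFin \o G) -> mu.-integrable setT (EFin \o p) ->
  measurable_fun setT (k : _ -> measurableTypeR R) -> (forall z, `|k z| <= 1) ->
  mu.-integrable setT (EFin \o (fun y => p y * \int[mu]_x (G x * k (y, x)))) /\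
  \int[mu]_x (G x * \int[mu]_y (p y * k (y, x))) =
  \int[mu]_y (p y * \int[mu]_x (G x * k (y, x))).
Proof.
move=> iG ip mk k1.
have mG : measurable_fun setT (G : _ -> measurableTypeR R).
  by apply/measurable_EFinP; exact: measurable_int iG.
have mp : measurable_fun setT (p : _ -> measurableTypeR R).
  by apply/measurable_EFinP; exact: measurable_int ip.
pose F (z : 'rV[R]_n * 'rV[R]_n) : R := p z.1 * (G z.2 * k z).
have mF : measurable_fun setT (F : _ -> measurableTypeR R).
  apply: measurable_funM; first exact: (measurableT_comp mp measurable_fst).
  by apply: measurable_funM => //; exact: (measurableT_comp mG measurable_snd).
have iGk y : mu.-integrable setT (EFin \o (fun x => G x * k (y, x))).
  exact: integrable_kernel_mul.
have ipk x : mu.-integrable setT (EFin \o (fun y => p y * k (y, x))).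
  apply: (integrable_mul_bounded ip (C := 1)) => //.
  exact: (measurable_fun_pair1 x mk).
have iF : (mu \x mu)%E.-integrable setT (EFin \o F).
  apply/integrable12ltyP; first exact/measurable_EFinP.
  have [_ fG] := integrableP _ _ _ iG; have [_ fp] := integrableP _ _ _ ip.
  pose cG := (\int[mu]_x `|(G x)%:E|)%E.
  have cG0 : (0 <= cG)%E by exact: integral_ge0.
  apply: (@le_lt_trans _ _ (\int[mu]_y (`|(p y)%:E| * cG))%E).
    apply: ge0_le_integral => //.
    - by move=> y _; exact: integral_ge0.
    - apply: (measurable_fun_fubini_tonelli_F (m2 := mu) (abse \o (EFin \o F))) => //=.
      by apply: measurableT_comp => //; exact/measurable_EFinP.
    - apply: emeasurable_funM; last exact: measurable_cst.
      exact: measurable_int (integrable_abse ip).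
    move=> y _; rewrite -ge0_integralZl //; last exact: measurable_int (integrable_abse iG).
    apply: ge0_le_integral => //.
    - apply: measurableT_comp => //; apply/measurable_EFinP.
      exact: (measurable_fun_pair2 y mF).
    - apply: measurable_funeM; exact: measurable_int (integrable_abse iG).
    move=> x _; rewrite /F /= lee_fin !normrM ler_wpM2l // ler_piMr //.
  rewrite ge0_integralZr //; last exact: measurable_int (integrable_abse ip).
  have U0 : (0 <= \int[mu]_y `|(p y)%:E|)%E by exact: integral_ge0.
  by apply: lte_mul_pinfty => //; rewrite ge0_fin_numE.
have E1 y : (\int[mu]_x (EFin \o F) (y, x) = (p y * \int[mu]_x (G x * k (y, x)))%:E)%E.
  rewrite /F /=; under eq_integral do rewrite EFinM.
  rewrite (integralZl measurableT (iGk y)) EFinM /Rintegral fineK //.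
  exact: (integrable_fin_num measurableT (iGk y)).
have E2 x : (\int[mu]_y (EFin \o F) (y, x) = (G x * \int[mu]_y (p y * k (y, x)))%:E)%E.
  rewrite /F /=; under eq_integral do rewrite mulrCA EFinM.
  rewrite (integralZl measurableT (ipk x)) EFinM /Rintegral fineK //.
  exact: (integrable_fin_num measurableT (ipk x)).
split.
  have := integrable_fubini_F iF.
  rewrite /fubini_F (_ : (fun y => _) = EFin \o (fun y => p y * \int[mu]_x (G x * k (y, x)))) //.
  by apply/funext => y; exact: E1.
rewrite /Rintegral; congr fine.
transitivity (\int[mu]_x \int[mu]_y (EFin \o F) (y, x))%E.
  by apply: eq_integral => x _; rewrite E2.
rewrite -(Fubini iF).
by apply: eq_integral => y _; rewrite E1.
Qed.

(** Fubini yields measurability of the transform only after multiplication by an integrable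
    function. With the positive weight [decayn 2] the factor can be divided out again. *)
Lemma measurable_kernel_transform (G : 'rV[R]_n -> R) (k : 'rV[R]_n * 'rV[R]_n -> R) :
  mu.-integrable setT (EFin \o G) ->
  measurable_fun setT (k : _ -> measurableTypeR R) -> (forall z, `|k z| <= 1) ->
  measurable_fun setT ((fun y => \int[mu]_x (G x * k (y, x))) : _ -> measurableTypeR R).
Proof.
move=> iG mk k1.
have i2 : mu.-integrable setT (EFin \o decayn (2 : R)).
  have h12 : (1 : R) < 2 by rewrite ltr1n.
  exact: (@integrable_decayn R n 2 h12).
have [iH _] := fubini_kernel iG i2 mk k1.
rewrite (_ : (fun y => _) = fun y => (decayn (-2) y) *
   (decayn 2 y * \int[mu]_x (G x * k (y, x)))).
  apply: measurable_funM; first exact: measurable_decayn.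
  by apply/measurable_EFinP; exact: measurable_int iH.
apply/funext => y; rewrite mulrA /decayn -big_split /=.
rewrite big1 ?mul1r // => i _; rewrite -decayD addNr /decay oppr0 powRr0 //.
Qed.

End fubini_kernels.

(** * Tempered distributions given by real densities *)

Section real_densities.
Context {R : realType} {n N : nat} (k0 : 'I_N).
Local Notation mu := (lebesgue_rV n).
Implicit Types (G : 'rV[R]_n -> R).

Lemma cintegrable_real G (phi : schwartz R n) : mu.-integrable setT (EFin \o G) ->
  cintegrable setT (fun x => (G x)%:C * phi x).
Proof.
move=> iG; have [b b0 hb] := bounded_schwartz phi.
have [m1 m2] := measurable_schwartz phi.
split.
- rewrite (_ : (fun x => _) = EFin \o (fun x => G x * complex.Re (phi x))).
    apply: (integrable_mul_bounded (C := b)) => // x.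
    exact: (le_trans (norm_Re_le _) (hb x)).
  by apply/funext => x /=; case: (phi x) => a c /=; rewrite mul0r subr0.
- rewrite (_ : (fun x => _) = EFin \o (fun x => G x * complex.Im (phi x))).
    apply: (integrable_mul_bounded (C := b)) => // x.
    exact: (le_trans (norm_Im_le _) (hb x)).
  by apply/funext => x /=; case: (phi x) => a c /=; rewrite mul0r addr0.
Qed.

Definition pairing G (phi : 'rV[R]_n -> R[i]) : R[i] :=
  cintegral setT (fun x => (G x)%:C * phi x).

Lemma pairingE G phi : pairing G phi =
  (\int[mu]_x (G x * complex.Re (phi x))) +i* (\int[mu]_x (G x * complex.Im (phi x))).
Proof.
rewrite /pairing /cintegral; congr (_ +i* _); apply: eq_Rintegral => x _ /=.
  by case: (phi x) => a c /=; rewrite mul0r subr0.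
by case: (phi x) => a c /=; rewrite mul0r addr0.
Qed.

Lemma integrable_pairing G (phi : schwartz R n) : mu.-integrable setT (EFin \o G) ->
  mu.-integrable setT (EFin \o (fun x => G x * complex.Re (phi x))) /\
  mu.-integrable setT (EFin \o (fun x => G x * complex.Im (phi x))).
Proof.
move=> iG; have [b b0 hb] := bounded_schwartz phi.
have [m1 m2] := measurable_schwartz phi.
split; apply: (integrable_mul_bounded (C := b)) => // x.
- exact: (le_trans (norm_Re_le _) (hb x)).
- exact: (le_trans (norm_Im_le _) (hb x)).
Qed.

Section tempered_density.
Variables (G : 'rV[R]_n -> R) (iG : mu.-integrable setT (EFin \o G)).

Lemma pairing_linear (a : R[i]) (phi eta chi : schwartz R n) :
  (forall x, chi x = a * phi x + eta x) ->
  pairing G chi = a * pairing G phi + pairing G eta.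
Proof.
move=> h; rewrite !pairingE.
have [p1 p2] := integrable_pairing phi iG; have [e1 e2] := integrable_pairing eta iG.
have iz (f : 'rV[R]_n -> R) c : mu.-integrable setT (EFin \o f) ->
    mu.-integrable setT (EFin \o (fun x => c * f x)).
  by move=> i; exact: (integrableZl measurableT c i).
case: a h => a b h; apply/eqP; rewrite eq_complex /=; apply/andP; split; apply/eqP.
- rewrite -!RintegralZl // -RintegralB //; [|exact: iz|exact: iz].
  rewrite -RintegralD //; last first.
    exact: (integrableB measurableT (iz _ a p1) (iz _ b p2)).
  apply: eq_Rintegral => x _; rewrite h.
  by case: (phi x) (eta x) => p q [r s] /=; ring.
- rewrite -!RintegralZl // -RintegralD //; [|exact: iz|exact: iz].
  rewrite -RintegralD //; last first.
    exact: (integrableD measurableT (iz _ a p2) (iz _ b p1)).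
  apply: eq_Rintegral => x _; rewrite h.
  by case: (phi x) (eta x) => p q [r s] /=; ring.
Qed.

Lemma pairing_bound (phi : schwartz R n) b : (forall x, cmod (phi x) <= b) ->
  cmod (pairing G phi) <= 2 * (\int[mu]_x `|G x|) * b.
Proof.
move=> hb; have [p1 p2] := integrable_pairing phi iG.
have iN : mu.-integrable setT (EFin \o (fun x => `|G x| * b)).
  apply: (integrable_mul_bounded (C := `|b|)) => //; first exact: integrable_norm.
have Eb : \int[mu]_x (`|G x| * b) = (\int[mu]_x `|G x|) * b.
  by rewrite RintegralZr //; exact: integrable_norm.
rewrite pairingE /= (le_trans (sqrt_sum_le _ _)) //.
have h1 : `|\int[mu]_x (G x * complex.Re (phi x))| <= \int[mu]_x (`|G x| * b).
  apply: le_normr_Rintegral1 => // x; rewrite normrM ler_wpM2l //.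
  exact: (le_trans (norm_Re_le _) (hb x)).
have h2 : `|\int[mu]_x (G x * complex.Im (phi x))| <= \int[mu]_x (`|G x| * b).
  apply: le_normr_Rintegral1 => // x; rewrite normrM ler_wpM2l //.
  exact: (le_trans (norm_Im_le _) (hb x)).
by rewrite -mulrA -Eb mulr2n mulrDl !mul1r lerD.
Qed.

Definition density_tempered : tempered R n.
Proof.
exists (fun phi => pairing G phi); first exact: pairing_linear.
exists (2 * \int[mu]_x `|G x|), 0%N => phi b hb; apply: pairing_bound => x.
by have := hb [::] x isT; rewrite expr0 mul1r.
Defined.

End tempered_density.

Definition zero_tempered : tempered R n.
Proof.
exists (fun=> 0); first by move=> *; rewrite mulr0 addr0.
exists 0, 0%N => phi b _; rewrite mul0r.
by rewrite /= expr0n addr0 sqrtr0.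
Defined.

(** The datum occupies the single component [k0], so norms of spinors reduce to moduli of
    scalars. *)
Definition spinor (z : R[i]) : 'cV[R[i]]_N := \col_k (if k == k0 then z else 0).

Definition spinor_pairing G (k : 'I_N) (phi : schwartz R n) : R[i] :=
  if k == k0 then pairing G phi else 0.

Definition spinor_density G (iG : mu.-integrable setT (EFin \o G)) (k : 'I_N) : tempered R n :=
  if k == k0 then density_tempered iG else zero_tempered.

Lemma spinor_densityE G iG : (fun k phi => @spinor_density G iG k phi) = spinor_pairing G.
Proof.
apply/funext => k; apply/funext => phi; rewrite /spinor_density /spinor_pairing.
by case: ifP.
Qed.

Lemma cmod0 : cmod (0 : R[i]) = 0.
Proof. by rewrite /= expr0n addr0 sqrtr0. Qed.

Lemma cmod_ge0 (z : R[i]) : 0 <= cmod z.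
Proof. by case: z => a b /=; exact: sqrtr_ge0. Qed.

Lemma cvnorm_spinor z : cvnorm (spinor z) = cmod z.
Proof.
rewrite /cvnorm (bigD1 k0) //= big1 ?addr0; last first.
  by move=> k /negPf kk0; rewrite mxE kk0 cmod0 expr0n.
by rewrite mxE eqxx sqrtr_sqr ger0_norm // cmod_ge0.
Qed.

Lemma cintegral0 (phi : 'rV[R]_n -> R[i]) : cintegral setT (fun x => 0 * phi x) = 0.
Proof.
rewrite /cintegral /Rintegral !integral0_eq // => x _; rewrite mul0r //.
Qed.

Lemma cintegrable0 (phi : 'rV[R]_n -> R[i]) : cintegrable setT (fun x => 0 * phi x).
Proof.
split; rewrite (_ : (fun x => _) = cst 0%E); try exact: integrable0.
all: by apply/funext => x; rewrite mul0r.
Qed.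

Lemma represents_density G : mu.-integrable setT (EFin \o G) ->
  represents (fun x => spinor (G x)%:C) (spinor_pairing G).
Proof.
move=> iG k; have mG : measurable_fun setT (G : _ -> measurableTypeR R).
  by apply/measurable_EFinP; exact: measurable_int iG.
rewrite /spinor_pairing; under eq_fun do rewrite mxE.
case: (eqVneq k k0) => kk0; split.
- by split => //; exact: measurable_cst.
- move=> phi; rewrite (_ : (fun x => _) = fun x => (G x)%:C * phi x).
    by split => //; exact: cintegrable_real.
  by apply/funext => x; rewrite mxE kk0 eqxx.
- by split => //; exact: measurable_cst.
- move=> phi; rewrite (_ : (fun x => _) = fun x => 0 * phi x).
    by split; [exact: cintegrable0|rewrite cintegral0].
  by apply/funext => x; rewrite mxE (negPf kk0).
Qed.

(** The multiplication formula: pairing [G] with the transform of [phi] equals pairing the transform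
    of [G] with [phi], because the kernels are symmetric. *)
Lemma fourier_represents_density G : mu.-integrable setT (EFin \o G) ->
  fourier_represents (fun xi => spinor (fourier (fun x => (G x)%:C) xi)) (spinor_pairing G).
Proof.
move=> iG k.
have FG xi : fourier (fun x => (G x)%:C) xi = cosT G xi -i* sinT G xi by exact: fourier_real.
pose kc (z : 'rV[R]_n * 'rV[R]_n) := cos (ang z.1 z.2).
pose ks (z : 'rV[R]_n * 'rV[R]_n) := sin (ang z.1 z.2).
have mkc : measurable_fun setT (kc : _ -> measurableTypeR R) by exact: measurable_cos_ang.
have mks : measurable_fun setT (ks : _ -> measurableTypeR R) by exact: measurable_sin_ang.
have kc1 z : `|kc z| <= 1 by exact: norm_cos_le1.
have ks1 z : `|ks z| <= 1 by exact: norm_sin_le1.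
have cE xi : \int[mu]_x (G x * kc (xi, x)) = cosT G xi.
  by apply: eq_Rintegral => x _; rewrite /kc /= angC.
have sE xi : \int[mu]_x (G x * ks (xi, x)) = sinT G xi.
  by apply: eq_Rintegral => x _; rewrite /ks /= angC.
have mc : measurable_fun setT (cosT G : _ -> measurableTypeR R).
  have := measurable_kernel_transform iG mkc kc1.
  by rewrite (_ : (fun y => _) = cosT G) //; apply/funext => y; exact: cE.
have ms : measurable_fun setT (sinT G : _ -> measurableTypeR R).
  have := measurable_kernel_transform iG mks ks1.
  by rewrite (_ : (fun y => _) = sinT G) //; apply/funext => y; exact: sE.
rewrite /spinor_pairing; under eq_fun do rewrite mxE.
case: (eqVneq k k0) => kk0; split.
- split; under eq_fun do rewrite FG /=; first exact: mc.
  exact: measurable_funN.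
- move=> phi phihat phE.
  rewrite (_ : (fun x => _) = fun x => (cosT G x -i* sinT G x) * phi x); last first.
    by apply/funext => x; rewrite mxE kk0 eqxx FG.
  have [ip iq] := integrable_schwartz phi.
  (* Stated once for a symmetric real kernel and used four times: real or imaginary part of [phi],
     against cosine or sine. *)
  have kernel (p : 'rV[R]_n -> R) kk T : mu.-integrable setT (EFin \o p) ->
      measurable_fun setT (kk : _ -> measurableTypeR R) -> (forall z, `|kk z| <= 1) ->
      (forall x y, kk (x, y) = kk (y, x)) -> (forall y, \int[mu]_x (G x * kk (y, x)) = T y) ->
      [/\ mu.-integrable setT (EFin \o (fun y => p y * T y)),
        mu.-integrable setT (EFin \o (fun x => G x * \int[mu]_y (p y * kk (y, x)))) &
        \int[mu]_x (G x * \int[mu]_y (p y * kk (y, x))) = \int[mu]_y (p y * T y)].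
    move=> ip' mk k1 ksym kT.
    have TE : (fun y => p y * \int[mu]_x (G x * kk (y, x))) = (fun y => p y * T y).
      by apply/funext => y; rewrite kT.
    have [] := fubini_kernel iG ip' mk k1; rewrite TE => h1 h2.
    have [h3 _] := fubini_kernel ip' iG mk k1; split => //.
    rewrite (_ : (fun x => _) = fun y => G y * \int[mu]_x (p x * kk (y, x))) //.
    by apply/funext => x; congr (_ * _); apply: eq_Rintegral => y _; rewrite ksym.
  have kcs x y : kc (x, y) = kc (y, x) by rewrite /kc /= angC.
  have kss x y : ks (x, y) = ks (y, x) by rewrite /ks /= angC.
  have [pc1 pc2 pc3] := kernel _ _ _ ip mkc kc1 kcs cE.
  have [ps1 ps2 ps3] := kernel _ _ _ ip mks ks1 kss sE.
  have [qc1 qc2 qc3] := kernel _ _ _ iq mkc kc1 kcs cE.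
  have [qs1 qs2 qs3] := kernel _ _ _ iq mks ks1 kss sE.
  have ReE : (fun x => complex.Re ((cosT G x -i* sinT G x) * phi x)) =
      (fun x => complex.Re (phi x) * cosT G x + complex.Im (phi x) * sinT G x).
    by apply/funext => x; case: (phi x) => a b /=; ring.
  have ImE : (fun x => complex.Im ((cosT G x -i* sinT G x) * phi x)) =
      (fun x => complex.Im (phi x) * cosT G x - complex.Re (phi x) * sinT G x).
    by apply/funext => x; case: (phi x) => a b /=; ring.
  have hatRe x : complex.Re (phihat x) = \int[mu]_y (complex.Re (phi y) * kc (y, x)) +
      \int[mu]_y (complex.Im (phi y) * ks (y, x)).
    rewrite phE; apply: etrans (RintegralD measurableT (integrable_mul_cos x ip) (integrable_mul_sin x iq)).
    by apply: eq_Rintegral => y _; rewrite /ang; case: (phi y) => a b /=; ring.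
  have hatIm x : complex.Im (phihat x) = \int[mu]_y (complex.Im (phi y) * kc (y, x)) -
      \int[mu]_y (complex.Re (phi y) * ks (y, x)).
    rewrite phE; apply: etrans (RintegralB measurableT (integrable_mul_cos x iq) (integrable_mul_sin x ip)).
    by apply: eq_Rintegral => y _; rewrite /ang; case: (phi y) => a b /=; ring.
  split.
    split.
      have -> : (fun x => (complex.Re ((cosT G x -i* sinT G x) * phi x))%:E) =
          EFin \o (fun x => complex.Re (phi x) * cosT G x + complex.Im (phi x) * sinT G x).
        by rewrite -ReE.
      exact: (integrableD measurableT pc1 qs1).
    have -> : (fun x => (complex.Im ((cosT G x -i* sinT G x) * phi x))%:E) =
        EFin \o (fun x => complex.Im (phi x) * cosT G x - complex.Re (phi x) * sinT G x).
      by rewrite -ImE.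
    exact: (integrableB measurableT qc1 ps1).
  rewrite pairingE /cintegral ReE ImE; congr (_ +i* _).
  - rewrite (RintegralD measurableT pc1 qs1) -pc3 -qs3 -(RintegralD measurableT pc2 qs2).
    by apply: eq_Rintegral => x _; rewrite hatRe mulrDr.
  - rewrite (RintegralB measurableT qc1 ps1) -qc3 -ps3 -(RintegralB measurableT qc2 ps2).
    by apply: eq_Rintegral => x _; rewrite hatIm mulrBr.
- by split => //; exact: measurable_cst.
- move=> phi phihat _; rewrite (_ : (fun x => _) = fun x => 0 * phi x).
    by split; [exact: cintegrable0|rewrite cintegral0].
  by apply/funext => x; rewrite mxE (negPf kk0).
Qed.

End real_densities.

(** * Upper bounds for L^p and Sobolev norms *)

Section norm_criteria.
Context {R : realType} {n N : nat} (k0 : 'I_N).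
Local Notation mu := (lebesgue_rV n).
Implicit Types (G : 'rV[R]_n -> R).

(** The norm is an infimum over representatives, so exhibiting [G] bounds it from above. *)
Lemma Lp_norm_le (p B : R) G : 0 < p -> 0 <= B -> mu.-integrable setT (EFin \o G) ->
  (\int[mu]_x (`|G x| `^ p)%:E <= B%:E)%E ->
  (Lp_norm p (spinor_pairing k0 G) <= (B `^ p^-1)%:E)%E.
Proof.
move=> p0 B0 iG GB.
apply: (@le_trans _ _ ('N[mu]_(p%:E)[(fun x => (cvnorm (spinor k0 (G x)%:C))%:E)])%E).
  apply: ereal_inf_lbound; exists (fun x => spinor k0 (G x)%:C) => //.
  exact: represents_density.
rewrite unlock.
rewrite (_ : (\int[mu]_x _ = \int[mu]_x (`|G x| `^ p)%:E)%E); last first.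
  apply: eq_integral => x _; rewrite cvnorm_spinor /= expr0n addr0 sqrtr_sqr.
  by rewrite normr_id.
rewrite -poweR_EFin; apply: gt0_ler_poweR.
- by rewrite invr_ge0 ltW.
- by rewrite in_itv /= leey andbT; apply: integral_ge0 => x _; rewrite lee_fin powR_ge0.
- by rewrite in_itv /= leey andbT lee_fin.
- exact: GB.
Qed.

(* Truncating [s] at [-1] only enlarges the Sobolev norm and keeps [sobexp s] in
   [0, 1/2); the square of [(1 + |xi|)^s] times [decayn (sobexp s)] is then bounded
   by [decayn (1 - sob s / n)], which is integrable. *)
Definition sob (s : R) : R := Num.max s (-1).
Definition sobexp (s : R) : R := 2^-1 + sob s / (2 * n%:R).

Lemma sob_bounds (s : R) : s < 0 -> -1 <= sob s < 0 /\ s <= sob s.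
Proof. by move=> s0; rewrite /sob le_max gt_max s0 le_max !lexx ltrN10 orbT. Qed.

(** The radial weight is split into [n] equal powers, and the [i]-th one is estimated by
    [(1 + |xi_i|)^2 <= 2 (1 + |xi|^2)]. *)
Lemma weight_le (s : R) (xi : 'rV[R]_n) : (0 < n)%N -> s < 0 ->
  (1 + enorm xi ^+ 2) `^ (s / 2) <= 2 `^ (- sob s / 2) * decayn (- sob s / n%:R) xi :> R.
Proof.
move=> n0 s0; have [/andP[s1 s2] ss] := sob_bounds s0.
have n0' : (0 : R) < n%:R by rewrite ltr0n.
set E : R := 1 + enorm xi ^+ 2.
have E1 : 1 <= E by rewrite lerDl sqr_ge0.
have E0 : 0 < E by exact: lt_le_trans E1.
apply: (@le_trans _ _ (E `^ (sob s / 2))).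
  by apply: ler_powR => //; rewrite ler_pM2r // invr_gt0.
(* The share of the exponent per coordinate. It is negative, so raising to it reverses
   inequalities. *)
set c : R := sob s / 2 / n%:R.
have c0 : c < 0 by rewrite /c !pmulr_llt0 // invr_gt0.
have -> : sob s / 2 = c * n%:R by rewrite /c divfK // gt_eqF.
have -> : E `^ (c * n%:R) = \prod_(i < n) (E `^ c).
  by rewrite powRrM powR_mulrn ?powR_ge0 // prodr_const card_ord.
have -> : 2 `^ (- sob s / 2) = \prod_(i < n) (2 `^ (- c)) :> R.
  rewrite prodr_const card_ord -powR_mulrn ?powR_ge0 // -powRrM; congr (_ `^ _).
  by rewrite /c !mulNr divfK // gt_eqF.
rewrite /decayn -big_split /=; apply: ler_prod => i _; rewrite powR_ge0 /=.
have x0 : 0 < 1 + `|xi ord0 i| by rewrite ltr_pwDl.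
have -> : 2 `^ (- c) * decay (- sob s / n%:R) (xi ord0 i) =
    ((1 + `|xi ord0 i|) ^+ 2 / 2) `^ c.
  rewrite powRM ?sqr_ge0 ?invr_ge0 // mulrC; congr (_ * _).
  - rewrite /decay -powR_mulrn ?ltW // -powRrM; congr (_ `^ _).
    by rewrite /c mulNr opprK; field; rewrite gt_eqF.
  - by rewrite -powR_inv1 // -powRrM mulN1r.
have h : (1 + `|xi ord0 i|) ^+ 2 / 2 <= E.
  have := coord_le_enorm xi i => xe.
  have xe2 : `|xi ord0 i| ^+ 2 <= enorm xi ^+ 2.
    by rewrite lerXn2r ?nnegrE ?sqrtr_ge0.
  have sq := sqr_ge0 (1 - `|xi ord0 i|).
  rewrite ler_pdivrMr // /E; move: sq xe2; rewrite !sqrrD !expr1n; lra.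
rewrite -[c]opprK !(powRN _ (- c)) lef_pV2 ?posrE ?powR_gt0 ?divr_gt0 ?exprn_gt0 //.
have c0' : 0 <= - c by rewrite oppr_ge0 ltW.
by apply: (ge0_ler_powR c0') => //; rewrite nnegrE ltW // divr_gt0 // exprn_gt0.
Qed.

Lemma Hs_norm_le (s : R) : (0 < n)%N -> s < 0 ->
  exists2 K : R, 0 < K & forall G delta, 0 <= delta -> mu.-integrable setT (EFin \o G) ->
    (forall xi, cmod (fourier (fun x => (G x)%:C) xi) <= delta * decayn (sobexp s) xi) ->
    (Hs_norm s (spinor_pairing k0 G) <= (delta * K)%:E)%E.
Proof.
move=> n0 s0; have [/andP[s1 s2] ss] := sob_bounds s0.
have n0' : (0 : R) < n%:R by rewrite ltr0n.
pose c : R := 2 `^ (- sob s / 2).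
have c0 : 0 < c by exact: powR_gt0.
pose a : R := 1 - sob s / n%:R.
have a1 : 1 < a by rewrite /a ltrDl oppr_gt0 pmulr_llt0 // invr_gt0.
have iD := @integrable_decayn R n a a1.
pose I : R := \int[mu]_xi decayn a xi.
have I0 : 0 <= I by apply: Rintegral_ge0 => xi _; exact: decayn_ge0.
(* The summand 1 makes the constant positive at once. *)
exists (c * Num.sqrt I + 1).
  by rewrite ltr_wpDl // mulr_ge0 ?sqrtr_ge0 // ltW.
move=> G delta d0 iG hG.
pose F xi : R := (1 + enorm xi ^+ 2) `^ (s / 2) *
   cvnorm (spinor k0 (fourier (fun x => (G x)%:C) xi)).
apply: (@le_trans _ _ ('N[mu]_(2%:E)[(fun xi => (F xi)%:E)])%E).
  apply: ereal_inf_lbound; exists (fun xi => spinor k0 (fourier (fun x => (G x)%:C) xi)) => //.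
  exact: fourier_represents_density.
have F0 xi : 0 <= F xi by rewrite mulr_ge0 ?powR_ge0 // cvnorm_spinor cmod_ge0.
have FB xi : F xi ^+ 2 <= (delta * c) ^+ 2 * decayn a xi.
  have -> : decayn a xi = (decayn (- sob s / n%:R) xi * decayn (sobexp s) xi) ^+ 2.
    rewrite /decayn -big_split -prodrXl; apply: eq_bigr => i _ /=.
    rewrite -decayD expr2 -decayD; congr (decay _ _); rewrite /a /sobexp.
    by field; rewrite gt_eqF.
  rewrite -exprMn lerXn2r ?nnegrE //.
    by rewrite !mulr_ge0 ?decayn_ge0 // ltW.
  rewrite /F cvnorm_spinor (_ : _ * _ * (_ * _) =
    (c * decayn (- sob s / n%:R) xi) * (delta * decayn (sobexp s) xi)); last by ring.
  by apply: ler_pM; rewrite ?powR_ge0 ?cmod_ge0 //; exact: weight_le.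
rewrite unlock.
have h : (\int[mu]_xi (`|(F xi)%:E| `^ 2) <= ((delta * c) ^+ 2 * I)%:E)%E.
  have iD2 : mu.-integrable setT (EFin \o (fun xi => (delta * c) ^+ 2 * decayn a xi)).
    exact: (integrableZl measurableT _ iD).
  have -> : ((delta * c) ^+ 2 * I)%:E = (\int[mu]_xi ((delta * c) ^+ 2 * decayn a xi)%:E)%E.
    rewrite /I -RintegralZl // /Rintegral fineK //; exact: (integrable_fin_num measurableT iD2).
  have [mg _] := fourier_represents_density k0 iG k0.
  have mF : measurable_fun setT (F : _ -> measurableTypeR R).
    apply: measurable_funM.
      apply: (measurableT_comp (measurable_powR _)).
      rewrite (_ : (fun xi => _) = fun xi : 'rV[R]_n => 1 + \sum_i xi ord0 i ^+ 2).
        apply: measurable_funD; first exact: measurable_cst.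
        apply: measurable_sum => i; apply: measurable_funX; exact: measurable_row_coord.
      apply/funext => xi; rewrite /enorm sqr_sqrtr //.
      by apply: sumr_ge0 => i _; exact: sqr_ge0.
    rewrite (_ : (fun xi => _) = fun xi => Num.sqrt (
        complex.Re (spinor k0 (fourier (fun x => (G x)%:C) xi) k0 ord0) ^+ 2 +
        complex.Im (spinor k0 (fourier (fun x => (G x)%:C) xi) k0 ord0) ^+ 2)).
      apply: (measurableT_comp (continuous_measurable_fun (@sqrt_continuous R))).
      by case: mg => m1 m2; apply: measurable_funD; exact: measurable_funX.
    by apply/funext => xi; rewrite cvnorm_spinor mxE eqxx; case: (fourier _ _).
  apply: ge0_le_integral => //.
  - by move=> xi _; exact: poweR_ge0.
  - apply: (measurableT_comp (measurable_poweR _)); apply: measurableT_comp => //.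
    exact/measurable_EFinP.
  - by apply/measurable_EFinP/measurable_EFinP; exact: measurable_int iD2.
  - move=> xi _ /=; rewrite lee_fin ger0_norm // powR_mulrn //; exact: FB.
have dc0 : 0 <= (delta * c) ^+ 2 * I by rewrite mulr_ge0 ?sqr_ge0.
apply: (@le_trans _ _ (((delta * c) ^+ 2 * I) `^ 2^-1)%:E).
  rewrite -poweR_EFin; apply: gt0_ler_poweR => //.
  - by rewrite in_itv /= leey andbT; apply: integral_ge0 => x _; rewrite lee_fin powR_ge0.
  - by rewrite in_itv /= leey andbT lee_fin.
rewrite lee_fin powR12_sqrt // sqrtrM ?sqr_ge0 // sqrtr_sqr ger0_norm ?mulr_ge0 ?(ltW c0) //.
by rewrite mulrDr mulr1 mulrA lerDl.
Qed.

End norm_criteria.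

(** * The initial data *)

Section profile.
Context {R : realType}.
Local Notation leb := (@lebesgue_measure R).
Local Notation h := (@bump_half R).
Local Notation h' := (flat (dflat (1 : {poly R}))).

Definition chi (y : R) : R := h (y - 1) * h (2 - y).
Definition dchi (y : R) : R := h' (y - 1) * h (2 - y) - h (y - 1) * h' (2 - y).

Lemma chi_ge0 y : 0 <= chi y.
Proof. by rewrite mulr_ge0 ?bump_half_ge0. Qed.

Lemma chi_le1 y : chi y <= 1.
Proof. by rewrite mulr_ile1 ?bump_half_ge0 ?bump_half_le1. Qed.

Lemma chi_supp y : ~ (1 <= y <= 2) -> chi y = 0.
Proof.
move=> /negP; rewrite negb_and -!ltNge /chi => /orP[] hy.
- by rewrite [h (y - 1)]flat_le0 ?mul0r //; lra.
- by rewrite [h (2 - y)]flat_le0 ?mulr0 //; lra.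
Qed.

Lemma chi_supp_open y : chi y != 0 -> 1 < y < 2.
Proof.
apply: contraR; rewrite negb_and -!leNgt /chi => /orP[] hy.
- by rewrite [h (y - 1)]flat_le0 ?mul0r //; lra.
- by rewrite [h (2 - y)]flat_le0 ?mulr0 //; lra.
Qed.

Lemma dchi_supp y : ~ (1 <= y <= 2) -> dchi y = 0.
Proof.
move=> /negP; rewrite negb_and -!ltNge /dchi => /orP[] hy.
- rewrite [h (y - 1)]flat_le0 ?[h' (y - 1)]flat_le0 ?mul0r ?subr0 //; lra.
- rewrite [h (2 - y)]flat_le0 ?[h' (2 - y)]flat_le0 ?mulr0 ?subr0 //; lra.
Qed.

Lemma dchi_bounded : exists2 C : R, 0 <= C & forall y, `|dchi y| <= C.
Proof.
have [C C0 hC] := flat_bounded (dflat (1 : {poly R})).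
exists (C + C); first exact: addr_ge0.
have b y : `|h y| <= 1 by rewrite ger0_norm ?bump_half_ge0 // bump_half_le1.
move=> y; apply: (le_trans (ler_normB _ _)); rewrite !normrM; apply: lerD.
- by rewrite -[leRHS]mulr1; apply: ler_pM.
- by rewrite -[leRHS]mul1r; apply: ler_pM.
Qed.

Lemma is_derive_affine (a b y : R) : is_derive y 1 (fun y : R => a * y + b) a.
Proof.
have h1 := is_deriveMr (is_derive_cst a y 1) (is_derive_id y 1).
have := is_deriveD h1 (is_derive_cst b y 1).
by rewrite mul0r add0r addr0 mulr1.
Qed.

Lemma is_derive_chi (y : R) : is_derive y 1 chi (dchi y).
Proof.
have e1 : is_derive y 1 (fun y : R => h (y - 1)) (h' (y - 1) * 1).
  apply: (@is_derive_outer _ _ h (fun y : R => y - 1) y 1 _ 1); first exact: is_derive_flat.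
  have := is_derive_affine 1 (-1) y.
  by rewrite (_ : (fun y => _) = (fun y : R => y - 1)) //; apply/funext => x; rewrite mul1r.
have e2 : is_derive y 1 (fun y : R => h (2 - y)) (h' (2 - y) * -1).
  apply: (@is_derive_outer _ _ h (fun y : R => 2 - y) y 1 _ (-1)); first exact: is_derive_flat.
  have := is_derive_affine (-1) 2 y.
  by rewrite (_ : (fun y => _) = (fun y : R => 2 - y)) //; apply/funext => x; rewrite mulN1r addrC.
apply: is_derive_eq (is_deriveMr e1 e2) _.
by rewrite /dchi; ring.
Qed.

Lemma continuous_scaled_flat (p : {poly R}) (a b : R) : continuous (fun y => flat p (a * y + b)).
Proof.
move=> y; apply: (@continuous_comp _ _ _ (fun y => a * y + b) (flat p)); last exact: continuous_flat.
apply: differentiable_continuous; apply/derivable1_diffP.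
by have [] := is_derive_affine a b y.
Qed.

Lemma continuous_dchi : continuous dchi.
Proof.
have c1 (p : {poly R}) : continuous (fun y : R => flat p (y - 1)).
  have := @continuous_scaled_flat p 1 (-1).
  by rewrite (_ : (fun y => _) = (fun y : R => flat p (y - 1))) //; apply/funext => x; rewrite mul1r.
have c2 (p : {poly R}) : continuous (fun y : R => flat p (2 - y)).
  have := @continuous_scaled_flat p (-1) 2.
  by rewrite (_ : (fun y => _) = (fun y : R => flat p (2 - y))) //; apply/funext => x; rewrite mulN1r addrC.
move=> y; apply: (@continuousB _ _ _ (fun y : R => h' (y - 1) * h (2 - y)) (fun y : R => h (y - 1) * h' (2 - y))).
- exact: (@continuousM _ _ (fun y : R => h' (y - 1)) (fun y : R => h (2 - y)) y (c1 _ y) (c2 _ y)).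
- exact: (@continuousM _ _ (fun y : R => h (y - 1)) (fun y : R => h' (2 - y)) y (c1 _ y) (c2 _ y)).
Qed.

(* The rescaling is such that the L^2 norm of [bump k] does not depend on [k],
   while its L^1 norm is of order [2^-k] and that of its derivative [2^k]. *)
Definition lam (k : nat) : R := 64 * 4 ^+ k.
Definition bump (k : nat) (y : R) : R := 2 ^+ k * chi (lam k * y).
Definition dbump (k : nat) (y : R) : R := 2 ^+ k * (lam k * dchi (lam k * y)).

Lemma lam_gt0 k : 0 < lam k.
Proof. by rewrite mulr_gt0 // exprn_gt0. Qed.

Lemma lam_ge64 k : 64 <= lam k.
Proof. by rewrite /lam ler_peMr // exprn_ege1 // ler1n. Qed.

Lemma is_derive_bump k (y : R) : is_derive y 1 (bump k) (dbump k y).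
Proof.
have e0 : is_derive y 1 (fun y : R => lam k * y) (lam k).
  have := is_derive_affine (lam k) 0 y.
  by rewrite (_ : (fun y => _) = (fun y : R => lam k * y)) //; apply/funext => x; rewrite addr0.
have e1 := is_derive_outer (is_derive_chi _) e0.
have -> : dbump k y = 0 * chi (lam k * y) + 2 ^+ k * (dchi (lam k * y) * lam k).
  by rewrite mul0r add0r /dbump [lam k * _]mulrC.
exact: (is_deriveMr (is_derive_cst (2 ^+ k : R) y 1) e1).
Qed.

Lemma continuous_bump k : continuous (bump k).
Proof.
move=> y; apply: differentiable_continuous; apply/derivable1_diffP.
by have [] := is_derive_bump k y.
Qed.

Lemma continuous_dbump k : continuous (dbump k).
Proof.
move=> y; rewrite /dbump.
have c0 : {for y, continuous (fun y : R => dchi (lam k * y))}.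
  apply: (@continuous_comp _ _ _ (fun y => lam k * y) dchi); last exact: continuous_dchi.
  exact: mulrl_continuous.
have c1 := @continuousM _ _ (fun=> lam k) (fun y : R => dchi (lam k * y)) y (@cst_continuous _ _ _ y) c0.
exact: (@continuousM _ _ (fun=> 2 ^+ k) (fun y : R => lam k * dchi (lam k * y)) y (@cst_continuous _ _ _ y) c1).
Qed.

Lemma bump_ge0 k y : 0 <= bump k y.
Proof. by rewrite mulr_ge0 ?chi_ge0. Qed.

Lemma bump_le k y : bump k y <= 2 ^+ k.
Proof. by rewrite /bump ler_piMr // chi_le1. Qed.

Lemma bump_supp k y : ~ (1 <= lam k * y <= 2) -> bump k y = 0.
Proof. by move=> hy; rewrite /bump chi_supp // mulr0. Qed.

Lemma dbump_supp k y : ~ (1 <= lam k * y <= 2) -> dbump k y = 0.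
Proof. by move=> hy; rewrite /dbump dchi_supp // !mulr0. Qed.

Lemma scaled_itvE k (a b : R) :
  [set y : measurableTypeR R | a <= lam k * y <= b] = [set` `[a / lam k, b / lam k]].
Proof.
apply/seteqP; split => y /=; rewrite in_itv /= ler_pdivrMr ?lam_gt0 // ler_pdivlMr ?lam_gt0 //.
  by rewrite !(mulrC y).
by rewrite !(mulrC y).
Qed.

Lemma lebesgue_scaled_itv k (a b : R) : a <= b ->
  leb [set y : measurableTypeR R | a <= lam k * y <= b] = ((b - a) / lam k)%:E.
Proof.
move=> ab; rewrite scaled_itvE lebesgue_measure_itv /= lte_fin ltr_pM2r ?invr_gt0 ?lam_gt0 //.
case: ltP => [_|ba]; first by rewrite mulrBl -EFinB.
have -> : a = b by apply/eqP; rewrite eq_le ab ba.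
by rewrite subrr mul0r.
Qed.

Lemma integral_scaled_le k (w : R -> R) (c : R) :
  measurable_fun setT (w : measurableTypeR R -> measurableTypeR R) ->
  (forall y, 0 <= w y <= c) -> (forall y, ~ (1 <= lam k * y <= 2) -> w y = 0) ->
  (\int[leb]_y (w y)%:E <= (c / lam k)%:E)%E.
Proof.
move=> mw wc w0.
pose D := [set y : measurableTypeR R | 1 <= lam k * y <= 2].
have mD : measurable D by rewrite /D scaled_itvE.
have -> : (\int[leb]_y (w y)%:E = \int[leb]_(y in D) (w y)%:E)%E.
  rewrite [RHS]integral_mkcond; apply: eq_integral => y _; rewrite patchE.
  by case: ifPn => // /negP; rewrite in_setE => /w0 ->.
apply: (@le_trans _ _ (\int[leb]_(y in D) c%:E)%E).
  apply: ge0_le_integral => //.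
  - by move=> y _; rewrite lee_fin; case/andP: (wc y).
  - by apply: measurable_funTS; exact/measurable_EFinP.
  - by move=> y _; rewrite lee_fin; case/andP: (wc y).
rewrite (etrans (integral_cst _ mD _)
  (congr1 (fun z => c%:E * z)%E (@lebesgue_scaled_itv k 1 2 (ler1n _ 2)))).
rewrite -EFinM lee_fin.
by rewrite (_ : 2 - 1 = 1 :> R) ?mul1r //; ring.
Qed.

(** Only the middle half of the scaled interval is kept, of length [1 / (2 lam k)]: there a bump
    stays away from zero. *)
Lemma integral_scaled_ge k (w : R -> R) (c : R) : 0 <= c ->
  measurable_fun setT (w : measurableTypeR R -> measurableTypeR R) ->
  (forall y, 0 <= w y) -> (forall y, 5 / 4 <= lam k * y <= 7 / 4 -> c <= w y) ->
  ((c / (2 * lam k))%:E <= \int[leb]_y (w y)%:E)%E.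
Proof.
move=> c0 mw w0 wc.
pose D := [set y : measurableTypeR R | 5 / 4 <= lam k * y <= 7 / 4].
have mD : measurable D by rewrite /D scaled_itvE.
have -> : (c / (2 * lam k))%:E = (\int[leb]_(y in D) c%:E)%E.
  have h57 : 5 / 4 <= 7 / 4 :> R by lra.
  rewrite (etrans (integral_cst _ mD _)
    (congr1 (fun z => c%:E * z)%E (@lebesgue_scaled_itv k _ _ h57))).
  rewrite -EFinM; congr EFin; field; by rewrite gt_eqF // lam_gt0.
apply: (@le_trans _ _ (\int[leb]_(y in D) (w y)%:E)%E).
  apply: ge0_le_integral => //.
  by apply: measurable_funTS; exact/measurable_EFinP.
apply: ge0_subset_integral => //.
  exact/measurable_EFinP.
by move=> y _; rewrite lee_fin.
Qed.

Lemma measurable_bump k : measurable_fun setT (bump k : measurableTypeR R -> measurableTypeR R).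
Proof. exact: (continuous_measurable_fun (@continuous_bump k)). Qed.

Lemma measurable_dbump k : measurable_fun setT (dbump k : measurableTypeR R -> measurableTypeR R).
Proof. exact: (continuous_measurable_fun (@continuous_dbump k)). Qed.

Lemma bump_L1 k : (\int[leb]_y `|bump k y|%:E <= (2 ^- k)%:E)%E.
Proof.
apply: (@le_trans _ _ (2 ^+ k / lam k)%:E).
  apply: (integral_scaled_le (w := fun y => `|bump k y|)) => [|y|y hy].
  - apply: (measurableT_comp (@normr_measurable R setT)); exact: measurable_bump.
  - by rewrite normr_ge0 ger0_norm ?bump_ge0 // bump_le.
  - by rewrite bump_supp // normr0.
rewrite lee_fin ler_pdivrMr ?lam_gt0 // mulrC ler_pdivlMr ?exprn_gt0 // /lam.
rewrite -exprMn -natrM.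
by rewrite ler_peMl ?exprn_ge0 // ler1n.
Qed.

Lemma dbump_L1 (C : R) k : (forall y, `|dchi y| <= C) ->
  (\int[leb]_y `|dbump k y|%:E <= (C * 2 ^+ k)%:E)%E.
Proof.
move=> hC; have C0 : 0 <= C by exact: le_trans (hC 0).
have -> : C * 2 ^+ k = C * 2 ^+ k * lam k / lam k by rewrite mulfK // gt_eqF // lam_gt0.
apply: (integral_scaled_le (w := fun y => `|dbump k y|)) => [|y|y hy].
- apply: (measurableT_comp (@normr_measurable R setT)); exact: measurable_dbump.
- rewrite normr_ge0 /dbump normrM (normrM (lam k)) normrX (gtr0_norm (lam_gt0 k)) ger0_norm //.
  rewrite [leRHS](_ : _ = 2 ^+ k * (lam k * C)); last by ring.
  by rewrite ler_wpM2l ?exprn_ge0 // ler_wpM2l // ltW // lam_gt0.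
- by rewrite dbump_supp // normr0.
Qed.

Lemma integrable_of_norm (w : R -> R) (B : R) :
  measurable_fun setT (w : measurableTypeR R -> measurableTypeR R) ->
  (\int[leb]_y `|w y|%:E <= B%:E)%E -> leb.-integrable setT (EFin \o w) /\ \int[leb]_y `|w y| <= B.
Proof.
move=> mw wB; have fin : (\int[leb]_y `|w y|%:E < +oo)%E by exact: le_lt_trans wB (ltry _).
split; first by apply/integrableP; split; first exact/measurable_EFinP.
rewrite /Rintegral -lee_fin fineK // ge0_fin_numE //.
by apply: integral_ge0 => y _; rewrite lee_fin.
Qed.

Lemma integrable_bump k : leb.-integrable setT (EFin \o bump k).
Proof. by have [] := integrable_of_norm (measurable_bump k) (bump_L1 k). Qed.

Lemma bump_hat : exists2 C : R, 0 <= C & forall k t,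
  hatm (bump k) t <= C * 2 ^- k /\ (1 + `|t|) * hatm (bump k) t <= C * 2 ^+ k.
Proof.
have [C C0 hC] := dchi_bounded.
exists (2 + 2 * C); first by rewrite addr_ge0 // mulr_ge0.
move=> k t.
have [i1 l1] := integrable_of_norm (measurable_bump k) (bump_L1 k).
have [i2 l2] := integrable_of_norm (measurable_dbump k) (dbump_L1 k hC).
have [|h1 h2] := hat_bound (@is_derive_bump k) (@continuous_dbump k) (L := 2) _ i1 i2 l1 l2 t.
  move=> y hy; apply: bump_supp => /andP[y1 y2].
  have l0 := lam_gt0 k.
  have y0 : 0 <= y by rewrite -(pmulr_rge0 _ l0); apply: le_trans y1.
  move: hy; rewrite ger0_norm // ltNge => /negP; apply.
  rewrite -(ler_pM2l l0); apply: (le_trans y2).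
  by have := lam_ge64 k; lra.
have p0 : 0 < 2 ^+ k :> R by rewrite exprn_gt0.
have p1 : 2 ^- k <= 2 ^+ k :> R.
  apply: (@le_trans _ _ 1); first by rewrite invf_le1 // exprn_ege1 // ler1n.
  by rewrite exprn_ege1 // ler1n.
have p2 : 0 <= 2 ^- k :> R by rewrite invr_ge0 ltW.
split; first by apply: (le_trans h1); rewrite ler_wpM2r // lerDl mulr_ge0.
apply: (le_trans h2); have := mulr_ge0 C0 (ltW p0); lra.
Qed.

(* Interpolation between the two bounds of [bump_hat]. *)
Lemma bump_hat_decay : exists2 C : R, 0 <= C & forall (theta : R) k t, 0 <= theta <= 1 ->
  hatm (bump k) t <= C * ((2 `^ (2 * theta - 1)) ^+ k * decay theta t).
Proof.
have [C C0 hC] := bump_hat; exists C => // th k t /andP[t0 t1].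
have [h1 h2] := hC k t.
have m0 : 0 <= hatm (bump k) t by exact: sqrtr_ge0.
have T0 : 0 < 1 + `|t| by rewrite ltr_pwDl.
have p0 : 0 < 2 ^+ k :> R by rewrite exprn_gt0.
have th1 : 0 <= 1 - th by rewrite subr_ge0.
have pos1 : 0 <= C * 2 ^- k by rewrite mulr_ge0 // invr_ge0 ltW.
have pos2 : 0 <= C * 2 ^+ k / (1 + `|t|) by rewrite !mulr_ge0 // ?invr_ge0 ltW.
have h3 : hatm (bump k) t <= C * 2 ^+ k / (1 + `|t|) by rewrite ler_pdivlMr // mulrC.
have split1 (x : R) : 0 <= x -> x = x `^ (1 - th) * x `^ th.
  move=> x0; rewrite -powRD; first by rewrite subrK powRr1.
  by rewrite subrK oner_eq0.
rewrite {1}(split1 _ m0).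
apply: (@le_trans _ _ ((C * 2 ^- k) `^ (1 - th) * (C * 2 ^+ k / (1 + `|t|)) `^ th)).
  by apply: ler_pM; rewrite ?powR_ge0 //; apply: ge0_ler_powR; rewrite ?nnegrE.
rewrite powRM // ?invr_ge0 ?(ltW p0) // [(_ / (1 + `|t|)) `^ th]powRM ?invr_ge0 ?(ltW T0) //; last first.
  by rewrite mulr_ge0 // ltW.
rewrite powRM ?(ltW p0) //.
have -> : (1 + `|t|)^-1 `^ th = decay th t by rewrite /decay -powR_inv1 ?(ltW T0) // -powRrM mulN1r.
have E1 : (2 ^- k) `^ (1 - th) = 2 `^ (- (k%:R * (1 - th))) :> R.
  by rewrite -powR_inv1 ?(ltW p0) // -powR_mulrn // -!powRrM; congr (_ `^ _); ring.
have E2 : (2 ^+ k) `^ th = 2 `^ (k%:R * th) :> R by rewrite -powR_mulrn // -powRrM.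
have E3 : (2 `^ (2 * th - 1)) ^+ k = (2 ^- k) `^ (1 - th) * (2 ^+ k) `^ th :> R.
  rewrite E1 E2 -powRD ?pnatr_eq0 ?implybT // -powR_mulrn ?powR_ge0 // -powRrM.
  by congr (_ `^ _); ring.
rewrite E3 [X in _ <= X * _](split1 _ C0).
rewrite le_eqVlt; apply/orP; left; apply/eqP; ring.
Qed.

End profile.

(** * Series of functions with disjoint supports *)

Section disjoint_series.
Context {R : realType} {d0 : measure_display} {T : measurableType d0}.
Variables (mu : {measure set T -> \bar R}) (b : nat -> T -> R) (idx : T -> nat).
Hypotheses (mb : forall k, measurable_fun setT (b k : T -> measurableTypeR R)).
Hypotheses (b0 : forall k x, 0 <= b k x).
Hypotheses (disj : forall x k, k != idx x -> b k x = 0).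

Definition psum m x : R := \sum_(k < m) b k x.
(** At most one term is nonzero at each point, so the sum of the series is that term and no limit
    has to be taken. *)
Definition tsum x : R := b (idx x) x.

(** With at most one nonzero term, summation commutes with every [phi] that fixes 0; the identity
    and the square are the cases used. *)
Lemma psum_comp (phi : R -> R) m x : phi 0 = 0 ->
  \sum_(k < m) phi (b k x) = if (idx x < m)%N then phi (tsum x) else 0.
Proof.
move=> phi0; case: ifPn => [im|].
  rewrite (bigD1 (Ordinal im)) //= big1 ?addr0 // => k ki.
  by rewrite disj // -(inj_eq val_inj).
rewrite -leqNgt => mi; rewrite big1 // => k _.
by rewrite disj // neq_ltn (leq_trans (ltn_ord k) mi).
Qed.

Lemma psumE m x : psum m x = if (idx x < m)%N then tsum x else 0.
Proof. exact: (@psum_comp id). Qed.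

Lemma tsum_ge0 x : 0 <= tsum x. Proof. exact: b0. Qed.

Lemma psum_ge0 m x : 0 <= psum m x.
Proof. by apply: sumr_ge0 => k _; exact: b0. Qed.

Lemma psum_le m x : psum m x <= tsum x.
Proof. by rewrite psumE; case: ifP => // _; exact: tsum_ge0. Qed.

Lemma psumM m x : tsum x * psum m x = psum m x ^+ 2.
Proof. by rewrite psumE; case: ifP => _; rewrite ?mulr0 ?expr0n // expr2. Qed.

Lemma psum_sqr m x : psum m x ^+ 2 = \sum_(k < m) b k x ^+ 2.
Proof.
rewrite (@psum_comp (fun y => y ^+ 2)) ?expr0n // psumE.
by case: ifP => _ //; rewrite expr0n.
Qed.

Lemma measurable_psum m : measurable_fun setT (psum m : T -> measurableTypeR R).
Proof. by apply: measurable_sum => k; exact: mb. Qed.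

Lemma measurable_tsum : measurable_fun setT (tsum : T -> measurableTypeR R).
Proof.
apply: (measurable_fun_cvg measurable_psum) => x _.
apply: cvg_near_cst; near=> m; rewrite psumE ifT //.
by near: m; exists (idx x).+1.
Unshelve. all: by end_near. Qed.

(** By disjointness the [p]-th power of the tail is bounded by the sum of the [p]-th powers, which
    is integrated termwise against a geometric series. *)
Lemma tail_integral (p q : R) m : 0 < p -> 0 < q < 1 ->
  (forall k, (\int[mu]_x (b k x `^ p)%:E <= (q ^+ k)%:E)%E) ->
  (\int[mu]_x (`|tsum x - psum m x| `^ p)%:E <= (q ^+ m / (1 - q))%:E)%E.
Proof.
move=> p0 /andP[q0 q1] bq.
have mbp k : measurable_fun setT (fun x => (b k x `^ p)%:E).
  by apply/measurable_EFinP; exact: (measurableT_comp (measurable_powR _) (mb k)).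
have bp0 k x : (0 <= (b k x `^ p)%:E)%E by rewrite lee_fin powR_ge0.
apply: (@le_trans _ _ (\int[mu]_x \sum_(0 <= k <oo) (b (m + k)%N x `^ p)%:E)%E).
  apply: ge0_le_integral => //.
  - apply/measurable_EFinP; apply: (measurableT_comp (measurable_powR _)).
    apply: (measurableT_comp (@normr_measurable R setT)).
    exact: measurable_funB measurable_tsum (measurable_psum m).
  - by apply: ge0_emeasurable_sum => // k _; exact: mbp.
  - move=> x _; rewrite psumE; case: ltnP => im.
      rewrite subrr normr0 powR0 ?gt_eqF //; exact: nneseries_ge0.
    rewrite subr0 ger0_norm ?tsum_ge0 //.
    (* The last term of this partial sum has index [idx x]. *)
    apply: (@le_trans _ _ (\sum_(0 <= k < (idx x - m).+1) (b (m + k)%N x `^ p)%:E)%E).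
      rewrite big_nat_recr //= subnKC // leeDr //.
      by apply: sume_ge0 => k _.
    exact: nneseries_lim_ge.
rewrite (integral_nneseries _ measurableT) //.
apply: lime_le; first by apply: is_cvg_nneseries => k _ _; exact: integral_ge0.
near=> n.
apply: (@le_trans _ _ (\sum_(0 <= k < n) (q ^+ (m + k))%:E)%E).
  by apply: lee_sum => k _; exact: bq.
rewrite sumEFin lee_fin.
have := @geometric_le_lim R n (q ^+ m) q (exprn_ge0 _ (ltW q0)) q0.
rewrite (gtr0_norm q0) => /(_ q1).
by rewrite /series /=; under eq_bigr do rewrite -exprD.
Unshelve. all: by end_near. Qed.

Lemma integrable_tsum (q : R) : 0 < q < 1 ->
  (forall k, (\int[mu]_x (b k x)%:E <= (q ^+ k)%:E)%E) ->
  mu.-integrable setT (EFin \o tsum).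
Proof.
move=> q01 bq; apply/integrableP; split.
  by apply/measurable_EFinP; exact: measurable_tsum.
have := @tail_integral 1 q 0 ltr01 q01.
have b1 k : (\int[mu]_x (b k x `^ 1)%:E <= (q ^+ k)%:E)%E.
  by under eq_integral do rewrite powRr1 ?b0 //.
move=> /(_ b1); under eq_integral do rewrite /psum big_ord0 subr0 powRr1 //.
by move/le_lt_trans; apply; exact: ltry.
Qed.

Lemma integrable_psum m : (forall k, mu.-integrable setT (EFin \o b k)) ->
  mu.-integrable setT (EFin \o psum m).
Proof. by move=> ib; exact: (@integrable_fsum _ _ _ mu _ _ (fun k : 'I_m => b k)). Qed.

End disjoint_series.

(** * Bumps in several variables *)

Section tensor_bumps.
Context {R : realType} {n : nat}.
Local Notation mu := (lebesgue_rV n).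
Hypothesis n0 : (0 < n)%N.

Definition tbump (k : nat) : 'rV[R]_n -> R := tensor (bump k).

Lemma tbump_ge0 k x : 0 <= tbump k x.
Proof. by apply: prodr_ge0 => i _; exact: bump_ge0. Qed.

Lemma tbump_supp k x : tbump k x != 0 -> forall i, 1 < lam k * x ord0 i < 2.
Proof.
move=> + i; apply: contraR => hi.
have /eqP c0 : chi (lam k * x ord0 i) == 0 by apply: contraR hi; exact: chi_supp_open.
by rewrite /tbump /tensor (bigD1 i) //= /bump c0 mulr0 mul0r.
Qed.

(** The factor 64 in [lam] is chosen for this: coordinates in the support lie below 2/64. *)
Lemma tbump_coord k x : tbump k x != 0 -> forall i, 0 < x ord0 i < 32^-1.
Proof.
move=> kx i; have /andP[h1 h2] := tbump_supp kx i.
have l64 := lam_ge64 (R := R) k; have l0 := lam_gt0 (R := R) k.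
have x0 : 0 < x ord0 i by rewrite -(pmulr_rgt0 _ l0); apply: lt_trans h1.
rewrite x0 /=; have : 64 * x ord0 i <= lam k * x ord0 i by rewrite ler_wpM2r // ltW.
lra.
Qed.

(** Scales grow by at least a factor 4, whereas the support of [chi] spans a factor 2, so one
    coordinate already separates the bumps. *)
Lemma tbump_disjoint j k x : (j < k)%N -> tbump j x != 0 -> tbump k x = 0.
Proof.
move=> jk jx; apply/eqP; apply/negPn/negP => kx.
have /andP[h1 h2] := tbump_supp jx (Ordinal n0).
have /andP[h3 h4] := tbump_supp kx (Ordinal n0).
have : 4 * lam j <= lam k :> R.
  rewrite /lam mulrCA -exprS ler_wpM2l // ler_weXn2l // ler1n //.
have /andP[x0 _] := tbump_coord jx (Ordinal n0).
by move/(ler_wpM2r (ltW x0)) => h5; lra.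
Qed.

Lemma tbump_index : exists idx : 'rV[R]_n -> nat, forall x k, k != idx x -> tbump k x = 0.
Proof.
have /choice[idx h] : forall x : 'rV[R]_n, exists j, forall k, k != j -> tbump k x = 0.
  move=> x; have [[j jx]|/forallNP h] := pselect (exists j, tbump j x != 0); last first.
    by exists 0%N => k _; apply/eqP/negPn/negP; exact: h.
  exists j => k; rewrite neq_ltn => /orP[kj|jk].
    apply/eqP/negPn/negP => kx; move: jx.
    by rewrite (tbump_disjoint kj kx) eqxx.
  exact: tbump_disjoint jk jx.
by exists idx => x k; exact: h.
Qed.

Lemma measurable_tbump k : measurable_fun setT (tbump k : _ -> measurableTypeR R).
Proof.
apply: measurable_prod => i _; apply: (measurableT_comp (@measurable_bump R k)).
exact: measurable_row_coord.
Qed.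

Lemma integrable_tbump k : mu.-integrable setT (EFin \o tbump k).
Proof. exact: integrable_tensor (integrable_bump k). Qed.

Lemma tbump_powR (p : R) k x : tbump k x `^ p = \prod_(i < n) (bump k (x ord0 i) `^ p).
Proof.
suff [] : 0 <= tbump k x /\ tbump k x `^ p = \prod_(i < n) (bump k (x ord0 i) `^ p) by [].
apply: (big_ind2 (fun a c : R => 0 <= a /\ a `^ p = c)).
- by rewrite powR1.
- by move=> a1 c1 a2 c2 [h1 <-] [h2 <-]; rewrite mulr_ge0 // powRM.
- by move=> i _; rewrite bump_ge0.
Qed.

(** In each coordinate the height contributes [2^(k p)] and the width at most [4^-k]; the ratio
    decays because [p < 2]. *)
Lemma tbump_Lp (p : R) k : 1 <= p < 2 ->
  (\int[mu]_x (tbump k x `^ p)%:E <= ((2 `^ (p - 2)) ^+ k)%:E)%E.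
Proof.
move=> /andP[p1 p2]; have p0 : 0 < p by lra.
have mv : measurable_fun setT ((fun t => bump k t `^ p) : measurableTypeR R -> measurableTypeR R).
  exact: (measurableT_comp (measurable_powR _) (@measurable_bump R k)).
have v0 t : 0 <= bump k t `^ p by exact: powR_ge0.
pose q : R := (2 `^ (p - 2)) ^+ k.
have q0 : 0 <= q by rewrite exprn_ge0 // powR_ge0.
have q1 : q <= 1.
  rewrite exprn_ile1 ?powR_ge0 // -[leRHS](powRr0 (2 : R)).
  by apply: ler_powR; rewrite ?ler1n //; lra.
have one : (\int[lebesgue_measure]_t (bump k t `^ p)%:E <= q%:E)%E.
  apply: (@le_trans _ _ ((2 ^+ k) `^ p / lam k)%:E).
    apply: integral_scaled_le => // [y|y hy].
      by rewrite v0 /=; apply: ge0_ler_powR; rewrite ?nnegrE ?bump_ge0 ?(ltW p0) // bump_le.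
    by rewrite bump_supp // powR0 // gt_eqF.
  rewrite lee_fin ler_pdivrMr ?lam_gt0 // /lam /q.
  have -> : (2 ^+ k) `^ p = (2 `^ (p - 2)) ^+ k * 4 ^+ k :> R.
    rewrite -exprMn -powR_mulrn // -powRrM mulrC powRrM powR_mulrn ?powR_ge0 //; congr (_ ^+ _).
    have -> : 4 = 2 `^ 2 :> R by rewrite powR_mulrn // expr2 -natrM.
    rewrite -powRD ?subrK // pnatr_eq0 implybT //.
  rewrite ler_wpM2l ?exprn_ge0 ?powR_ge0 // ler_peMl ?exprn_ge0 // ler1n //.
under eq_integral do rewrite tbump_powR.
rewrite (@ge0_integral_rV_prod _ _ (fun t => bump k t `^ p)) //.
have I0 : (0 <= \int[lebesgue_measure]_t (bump k t `^ p)%:E)%E.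
  by apply: integral_ge0 => t _; rewrite lee_fin.
move: one I0; case: (\int[_]_t _)%E => [a|//|//]; rewrite !lee_fin => aq a0.
rewrite prodEFin lee_fin prodr_const card_ord.
apply: (@le_trans _ _ (q ^+ n)); first by rewrite lerXn2r ?nnegrE.
(* As [q <= 1], all factors but one may be dropped. *)
by case: n n0 => // m _; rewrite exprS ler_piMr // exprn_ile1.
Qed.

Lemma tbump_sqr : exists2 c : R, 0 < c & forall k, c <= \int[mu]_x (tbump k x ^+ 2).
Proof.
pose h := @bump_half R.
(* On the middle half [chi] is at least [h (1/4)^2], and the scales combine to
   [4^k / (2 * 64 * 4^k) = 1/128]. *)
pose c1 : R := (h 4^-1 * h 4^-1) ^+ 2 / 128.
have c10 : 0 < c1 by rewrite divr_gt0 // exprn_gt0 // mulr_gt0 // bump_half_gt0 // invr_gt0.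
exists (c1 ^+ n); first exact: exprn_gt0.
move=> k.
have mv : measurable_fun setT ((fun t => bump k t ^+ 2) : measurableTypeR R -> measurableTypeR R).
  exact: measurable_funX (@measurable_bump R k).
have v0 (t : R) : 0 <= bump k t ^+ 2 by exact: sqr_ge0.
have one : (c1%:E <= \int[lebesgue_measure]_t (bump k t ^+ 2)%:E)%E.
  have -> : c1 = (2 ^+ k * (h 4^-1 * h 4^-1)) ^+ 2 / (2 * lam k).
    have e4 : (2 ^+ k) ^+ 2 = 4 ^+ k :> R by rewrite -exprM mulnC exprM expr2 -natrM.
    have e0 : 4 ^+ k != 0 :> R by rewrite expf_eq0 pnatr_eq0 andbF.
    by rewrite /c1 [in RHS]exprMn e4 /lam; field.
  apply: integral_scaled_ge => //; first exact: sqr_ge0.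
  move=> y /andP[y1 y2]; rewrite lerXn2r ?nnegrE ?bump_ge0 //.
    by rewrite !mulr_ge0 ?bump_half_ge0.
  rewrite /bump /chi ler_wpM2l //.
  apply: ler_pM; rewrite ?bump_half_ge0 //; apply: bump_half_mono; lra.
(* Finiteness matters here: a real-valued integral sends the value [+oo] to 0, which would destroy
   the lower bound. *)
have fin : (\int[lebesgue_measure]_t ((bump k t : R) ^+ 2)%:E <= ((2 ^+ k) ^+ 2 / lam k)%:E)%E.
  apply: (integral_scaled_le (w := fun t => bump k t ^+ 2)) => // [y|y hy].
    by rewrite v0 lerXn2r ?nnegrE ?bump_ge0 // bump_le.
  by rewrite bump_supp // expr0n.
rewrite /Rintegral /tbump /tensor.
under eq_integral do rewrite -prodrXl.
rewrite (@ge0_integral_rV_prod _ _ (fun t => bump k t ^+ 2)) //.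
move: one fin; case: (\int[_]_t _)%E => [a|//|//]; rewrite !lee_fin => ca _.
rewrite prodEFin /= prodr_const card_ord lerXn2r ?nnegrE ?(ltW c10) //.
exact: le_trans (ltW c10) ca.
Qed.

End tensor_bumps.

(** * Fourier and L^p bounds for the tails of the series *)

Section fourier_size.
Context {R : realType} {n : nat}.
Local Notation mu := (lebesgue_rV n).
Implicit Types (G : 'rV[R]_n -> R).

Definition fnorm G xi : R := cmod (fourier (fun x => (G x)%:C) xi).

Lemma fnormE G xi : mu.-integrable setT (EFin \o G) ->
  fnorm G xi = cmod (cosT G xi -i* sinT G xi).
Proof. by move=> iG; rewrite /fnorm fourier_real. Qed.

Lemma fnormD G1 G2 xi : mu.-integrable setT (EFin \o G1) -> mu.-integrable setT (EFin \o G2) ->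
  fnorm (fun x => G1 x + G2 x) xi <= fnorm G1 xi + fnorm G2 xi.
Proof.
move=> i1 i2; have i3 : mu.-integrable setT (EFin \o (fun x => G1 x + G2 x)).
  exact: (integrableD measurableT i1 i2).
rewrite !fnormE //.
have Ec : cosT (fun x => G1 x + G2 x) xi = cosT G1 xi + cosT G2 xi.
  rewrite -(RintegralD measurableT (integrable_mul_cos xi i1) (integrable_mul_cos xi i2)).
  by apply: eq_Rintegral => x _; rewrite mulrDl.
have Es : sinT (fun x => G1 x + G2 x) xi = sinT G1 xi + sinT G2 xi.
  rewrite -(RintegralD measurableT (integrable_mul_sin xi i1) (integrable_mul_sin xi i2)).
  by apply: eq_Rintegral => x _; rewrite mulrDl.
rewrite Ec Es opprD -lecR rmorphD.
exact: (@ler_normD _ R[i] (cosT G1 xi -i* sinT G1 xi) (cosT G2 xi -i* sinT G2 xi)).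
Qed.

Lemma fnormN G xi : mu.-integrable setT (EFin \o G) -> fnorm (fun x => - G x) xi = fnorm G xi.
Proof.
move=> iG; have iN : mu.-integrable setT (EFin \o (fun x => - G x)).
  exact: (integrableN iG).
rewrite !fnormE //.
have -> : cosT (fun x => - G x) xi = - cosT G xi.
  rewrite /cosT -(RintegralN1 (integrable_mul_cos xi iG)).
  by apply: eq_Rintegral => x _; rewrite mulNr.
have -> : sinT (fun x => - G x) xi = - sinT G xi.
  rewrite /sinT -(RintegralN1 (integrable_mul_sin xi iG)).
  by apply: eq_Rintegral => x _; rewrite mulNr.
by rewrite /= !sqrrN.
Qed.

Lemma fnorm_le_L1 G xi : mu.-integrable setT (EFin \o G) ->
  fnorm G xi <= 2 * \int[mu]_x `|G x|.
Proof.
move=> iG; rewrite fnormE //= sqrrN (le_trans (sqrt_sum_le _ _)) //.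
have small (k : 'rV[R]_n -> R) : mu.-integrable setT (EFin \o (fun x => G x * k x)) ->
    (forall x, `|k x| <= 1) -> `|\int[mu]_x (G x * k x)| <= \int[mu]_x `|G x|.
  move=> i k1; apply: le_normr_Rintegral1 => //; first exact: integrable_norm.
  by move=> x; rewrite normrM ler_piMr.
have c := small _ (integrable_mul_cos xi iG) (fun=> norm_cos_le1 _).
have s := small _ (integrable_mul_sin xi iG) (fun=> norm_sin_le1 _).
by rewrite mulr_natl mulr2n; exact: lerD.
Qed.

End fourier_size.

Lemma pow2_lt1 {R : realType} (a : R) : a < 0 -> 2 `^ a < 1.
Proof.
by move=> a0; rewrite /powR pnatr_eq0 /= expR_lt1 pmulr_llt0 // ln_gt0 // ltr1n.
Qed.

Section norms_of_sums.
Context {R : realType} {n : nat}.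
Local Notation mu := (lebesgue_rV n).
Hypothesis n0 : (0 < n)%N.
Variable idx : 'rV[R]_n -> nat.
Hypothesis disj : forall x k, k != idx x -> @tbump R n k x = 0.

Local Notation f := (psum (@tbump R n)).
Local Notation g := (tsum (@tbump R n) idx).

Lemma tbump_tail_Lp (p : R) m : 1 <= p < 2 ->
  (\int[mu]_x (`|g x - f m x| `^ p)%:E <=
   ((2 `^ (p - 2)) ^+ m / (1 - 2 `^ (p - 2)))%:E)%E.
Proof.
move=> p12; have /andP[p1 p2] := p12.
apply: (tail_integral (idx := idx)) => //.
- exact: measurable_tbump.
- exact: tbump_ge0.
- by lra.
- by rewrite powR_gt0 //= pow2_lt1 //; lra.
- by move=> k; exact: tbump_Lp.
Qed.

Lemma half_pow : 2 `^ (1 - 2) = 2^-1 :> R.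
Proof. by rewrite (_ : 1 - 2 = -1 :> R) ?powR_inv1 //; ring. Qed.

Lemma integrable_g : mu.-integrable setT (EFin \o g).
Proof.
have q01 : 0 < (2^-1 : R) < 1 by apply/andP; split; lra.
apply: (integrable_tsum (@measurable_tbump R n) (@tbump_ge0 R n) disj q01) => k.
have h11 : 1 <= (1 : R) < 2 by rewrite lexx ltr1n.
have := tbump_Lp n0 k h11; rewrite half_pow; apply: le_trans.
rewrite (eq_integral (fun x => (tbump k x `^ 1)%:E)) // => x _.
by rewrite powRr1 ?tbump_ge0.
Qed.

Lemma integrable_f m : mu.-integrable setT (EFin \o f m).
Proof. exact: integrable_psum (@integrable_tbump R n). Qed.

Lemma integrable_gf m : mu.-integrable setT (EFin \o (fun x => g x - f m x)).
Proof. exact: (integrableB measurableT integrable_g (integrable_f m)). Qed.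

Lemma tail_L1 m : \int[mu]_x `|g x - f m x| <= 2 * 2^-1 ^+ m.
Proof.
have h11 : 1 <= (1 : R) < 2 by rewrite lexx ltr1n.
have := tbump_tail_Lp m h11; rewrite half_pow.
under eq_integral do rewrite powRr1 //.
move=> h; rewrite /Rintegral -lee_fin fineK.
  apply: (le_trans h); rewrite lee_fin mulrC; apply: ler_wpM2r; first exact: exprn_ge0.
  by rewrite (_ : 1 - 2^-1 = 2^-1) ?invrK //; lra.
rewrite ge0_fin_numE; first exact: le_lt_trans h (ltry _).
by apply: integral_ge0 => x _; rewrite lee_fin.
Qed.

(** The interpolation exponent [sobexp s] makes the geometric ratio [2^(sob s / n)] in each
    coordinate, hence [2^(sob s)] for the product of [n] of them. *)
Lemma tbump_fourier (s : R) : s < 0 -> exists2 C : R, 0 <= C & forall k xi,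
  fnorm (@tbump R n k) xi <= C * ((2 `^ sob s) ^+ k * decayn (@sobexp R n s) xi).
Proof.
move=> s0; have [/andP[s1 s2] _] := sob_bounds s0.
have n1 : (0 : R) < n%:R by rewrite ltr0n.
have n2 : (1 : R) <= n%:R by rewrite ler1n.
have [C C0 hC] := @bump_hat_decay R.
exists (C ^+ n); first exact: exprn_ge0.
move=> k xi; rewrite /fnorm cmod_fourier_tensor; last exact: integrable_bump.
have th : 0 <= @sobexp R n s <= 1.
  have h1 : 0 < 2 * n%:R :> R by rewrite mulr_gt0.
  rewrite /sobexp; apply/andP; split.
    rewrite -(@ler_pM2r _ (2 * n%:R)) // mul0r mulrDl divfK ?gt_eqF // mulrA mulVf // mul1r; lra.
  rewrite -(@ler_pM2r _ (2 * n%:R)) // mulrDl divfK ?gt_eqF // mulrA mulVf // mul1r mul1r; lra.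
have -> : (2 `^ sob s) ^+ k = \prod_(i < n) (2 `^ (2 * @sobexp R n s - 1)) ^+ k :> R.
  rewrite prodr_const card_ord exprAC; congr (_ ^+ k).
  rewrite -powR_mulrn ?powR_ge0 // -powRrM; congr (_ `^ _).
  by rewrite /sobexp; field; rewrite gt_eqF.
have -> : C ^+ n = \prod_(i < n) C by rewrite prodr_const card_ord.
rewrite /decayn -!big_split /=.
apply: ler_prod => i _; rewrite sqrtr_ge0 /=; exact: hC.
Qed.

(** Differences of partial sums obey a geometric bound independent of their length; what remains
    beyond them is small in L^1, so its transform is uniformly small. *)
Lemma tail_fourier (s : R) : s < 0 -> exists D r : R, [/\ 0 <= D, 0 <= r < 1 & forall m xi,
  fnorm (fun x => g x - f m x) xi <= D * r ^+ m * decayn (@sobexp R n s) xi].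
Proof.
move=> s0; have [/andP[s1 s2] _] := sob_bounds s0.
have [C C0 hC] := tbump_fourier s0.
pose r : R := 2 `^ sob s.
have r0 : 0 < r by exact: powR_gt0.
have r1 : r < 1.
  exact: pow2_lt1.
exists (C / (1 - r)), r; split; first by rewrite divr_ge0 // subr_ge0 ltW.
  by rewrite r1 ltW.
move=> m xi; set w := decayn _ xi; have w0 : 0 <= w by exact: decayn_ge0.
have iB j : mu.-integrable setT (EFin \o (fun x => f j x - f m x)).
  exact: (integrableB measurableT (integrable_f j) (integrable_f m)).
have fin j : fnorm (fun x => f (m + j) x - f m x) xi <= C * (\sum_(i < j) r ^+ (m + i)) * w.
  elim: j => [|j IH].
    rewrite addn0 big_ord0 mulr0 mul0r.
    rewrite (_ : (fun x => _) = fun=> 0); last by apply/funext => x; rewrite subrr.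
    apply: (le_trans (fnorm_le_L1 _ _)).
      rewrite (_ : EFin \o _ = cst 0%E) //; exact: integrable0.
    rewrite /Rintegral integral0_eq ?mulr0 // => x _; by rewrite normr0.
  rewrite big_ord_recr /= mulrDr mulrDl.
  rewrite (_ : (fun x => _) = fun x => (f (m + j) x - f m x) + tbump (m + j) x); last first.
    by apply/funext => x; rewrite addnS /psum big_ord_recr /=; ring.
  apply: (le_trans (fnormD _ (iB _) (integrable_tbump _))); apply: lerD => //.
  by rewrite -mulrA; exact: hC.
have fin2 M : fnorm (fun x => f (m + M) x - f m x) xi <= C / (1 - r) * r ^+ m * w.
  apply: (le_trans (fin M)); rewrite ler_wpM2r // -mulrA ler_wpM2l //.
  have := @geometric_le_lim R M (r ^+ m) r (exprn_ge0 _ (ltW r0)) r0.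
  rewrite (gtr0_norm r0) => /(_ r1); rewrite /series /= big_mkord mulrC => h.
  by under eq_bigr do rewrite exprD.
apply/ler_addgt0Pl => e e0.
(* One factor 2 comes from [fnorm_le_L1] and the other from [tail_L1]. *)
have [M hM] : exists M, 4 * 2^-1 ^+ M <= e.
  have h12 : `|2^-1 : R| < 1 by rewrite ger0_norm ?invr_ge0 // invf_lt1 // ltr1n.
  have /cvgr0Pnorm_le/(_ e e0)[M _ hM] := cvg_geometric (4 : R) h12.
  exists M; apply: le_trans (hM M (leqnn _)).
  exact: ler_norm.
have hM' : 4 * 2^-1 ^+ (m + M) <= e.
  apply: le_trans hM; rewrite ler_wpM2l // ler_wiXn2l // ?leq_addl //; lra.
rewrite (_ : (fun x => _) = fun x => (g x - f (m + M) x) + (f (m + M) x - f m x)); last first.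
  by apply/funext => x; ring.
apply: (le_trans (fnormD _ (integrable_gf _) (iB _))); apply: lerD => //.
apply: (le_trans (fnorm_le_L1 _ (integrable_gf _))).
by have := tail_L1 (m + M); lra.
Qed.

End norms_of_sums.

(** * Convergence of the partial sums in the data space *)

Section data_norms.
Context {R : realType} {n N : nat} (k0 : 'I_N).
Local Notation mu := (lebesgue_rV n).
Hypothesis n0 : (0 < n)%N.
Variable idx : 'rV[R]_n -> nat.
Hypothesis disj : forall x k, k != idx x -> @tbump R n k x = 0.

Local Notation f := (psum (@tbump R n)).
Local Notation g := (tsum (@tbump R n) idx).
Local Notation data_norm X G := (data_norm X (@spinor_pairing R n N k0 G)).

Let iG := integrable_g n0 disj.
Let iF := @integrable_f R n.

Let iFg m : mu.-integrable setT (EFin \o (fun x => f m x - g x)).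
Proof. exact: (integrableB measurableT (iF m) iG). Qed.

Lemma cvg_geometric_pow (C r e : R) : 0 <= r < 1 -> 0 < e -> \forall m \near \oo, C * r ^+ m < e.
Proof.
move=> /andP[r0 r1] e0; have h : `|r| < 1 by rewrite ger0_norm.
have /cvgr0Pnorm_lt/(_ e e0) := cvg_geometric C h.
by apply: filterS => m; apply: le_lt_trans; exact: ler_norm.
Qed.

(** Shows that the limit datum belongs to each of its neighbourhoods, which are described by
    distances. *)
Lemma data_norm0 (X : data_space R) : admissible X -> (data_norm X (fun=> 0%R) <= 0%:E)%E.
Proof.
have i0 : mu.-integrable setT (EFin \o (fun=> 0 : R)).
  rewrite (_ : EFin \o _ = cst 0%E) //; exact: integrable0.
case: X => [s s0|p /andP[p1 p2]] /=.
- have [K K0 hK] := Hs_norm_le k0 n0 s0.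
  apply: le_trans (hK _ 0 (lexx 0) i0 _) _; last by rewrite mul0r.
  move=> xi; rewrite mul0r; apply: (le_trans (fnorm_le_L1 _ i0)).
  by rewrite /Rintegral integral0_eq ?mulr0 // => x _; rewrite normr0.
- have p0 : 0 < p by lra.
  apply: le_trans (Lp_norm_le k0 p0 (lexx 0) i0 _) _.
    by rewrite integral0_eq // => x _; rewrite normr0 powR0 // gt_eqF.
  by rewrite powR0 // invr_eq0 gt_eqF.
Qed.

Lemma Lebesgue_data_norm (p : R) : 1 <= p < 2 ->
  [/\ (Lp_norm p (spinor_pairing k0 g) < +oo)%E,
      (forall m, Lp_norm p (spinor_pairing k0 (f m)) < +oo)%E &
      forall e : R, 0 < e -> \forall m \near \oo,
        (Lp_norm p (spinor_pairing k0 (fun x => (f m x - g x)%R)) < e%:E)%E].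
Proof.
move=> p12; have /andP[p1 p2] := p12; have p0 : 0 < p by lra.
set q : R := 2 `^ (p - 2).
have q0 : 0 < q by exact: powR_gt0.
have q1 : q < 1 by apply: pow2_lt1; lra.
have B0 m : 0 <= q ^+ m / (1 - q) by rewrite divr_ge0 ?exprn_ge0 ?subr_ge0 // ltW.
have Bg : (\int[mu]_x (`|g x| `^ p)%:E <= (q ^+ 0 / (1 - q))%:E)%E.
  have := tbump_tail_Lp n0 disj 0 p12; apply: le_trans.
  rewrite (eq_integral (fun x => (`|g x - f 0 x| `^ p)%:E)) // => x _.
  by rewrite /psum big_ord0 subr0.
split.
- by apply: le_lt_trans (Lp_norm_le k0 p0 (B0 0%N) iG Bg) _; exact: ltry.
- move=> m; apply: le_lt_trans (Lp_norm_le k0 p0 (B0 0%N) (iF m) _) _; last exact: ltry.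
  apply: le_trans Bg; apply: ge0_le_integral => //.
  + apply/measurable_EFinP; apply: (measurableT_comp (measurable_powR _)).
    apply: (measurableT_comp (@normr_measurable R setT)).
    exact: (measurable_psum (@measurable_tbump R n)).
  + apply/measurable_EFinP; apply: (measurableT_comp (measurable_powR _)).
    apply: (measurableT_comp (@normr_measurable R setT)).
    exact: (measurable_tsum (@measurable_tbump R n) disj).
  + move=> x _; rewrite lee_fin; apply: ge0_ler_powR; rewrite ?nnegrE ?(ltW p0) //.
    rewrite !ger0_norm ?psum_ge0 ?tsum_ge0 ?(psum_le (@tbump_ge0 R n) disj) //.
      exact: tbump_ge0.
    exact: tbump_ge0.
- move=> e e0.
  have ep : 0 < e `^ p by exact: powR_gt0.
  have q01 : 0 <= q < 1 by rewrite q1 ltW.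
  have := cvg_geometric_pow (1 - q)^-1 q01 ep; apply: filterS => m hm.
  apply: le_lt_trans (Lp_norm_le k0 p0 (B0 m) (iFg m) _) _.
    have := tbump_tail_Lp n0 disj m p12; apply: le_trans.
    rewrite (eq_integral (fun x => (`|g x - f m x| `^ p)%:E)) // => x _.
    by rewrite distrC.
  rewrite lte_fin -[ltRHS](powRr1 (ltW e0)) -[in ltRHS](mulfV (lt0r_neq0 p0)) powRrM.
  apply: gt0_ltr_powR; rewrite ?nnegrE ?powR_ge0 //; first by rewrite invr_gt0.
  by rewrite mulrC.
Qed.

Lemma Sobolev_data_norm (s : R) : s < 0 ->
  [/\ (Hs_norm s (spinor_pairing k0 g) < +oo)%E,
      (forall m, Hs_norm s (spinor_pairing k0 (f m)) < +oo)%E &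
      forall e : R, 0 < e -> \forall m \near \oo,
        (Hs_norm s (spinor_pairing k0 (fun x => (f m x - g x)%R)) < e%:E)%E].
Proof.
move=> s0; have [D [r [D0 r01 hD]]] := tail_fourier n0 disj s0.
have [K K0 hK] := Hs_norm_le k0 n0 s0.
have /andP[r0 r1] := r01.
have Fg xi : fnorm g xi <= D * decayn (@sobexp R n s) xi.
  have := hD 0%N xi; rewrite expr0 mulr1; rewrite (_ : (fun x => _) = g) //.
  by apply/funext => x; rewrite /psum big_ord0 subr0.
have Ffg m xi : fnorm (fun x => f m x - g x) xi <= D * r ^+ m * decayn (@sobexp R n s) xi.
  apply: le_trans (hD m xi).
  rewrite (_ : (fun x => _) = fun x => - (g x - f m x)).
    by rewrite fnormN //; exact: integrable_gf.
  by apply/funext => x; rewrite opprB.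
split.
- by apply: le_lt_trans (hK _ D D0 iG Fg) _; exact: ltry.
- move=> m; apply: le_lt_trans (hK _ (D * r ^+ m + D) _ (iF m) _) _; last exact: ltry.
    by rewrite addr_ge0 // mulr_ge0 // exprn_ge0.
  move=> xi; rewrite mulrDl.
  apply: (@le_trans _ _ (fnorm (fun x => (f m x - g x) + g x) xi)).
    by rewrite le_eqVlt; apply/orP; left; apply/eqP; congr (fnorm _ xi); apply/funext => x; rewrite subrK.
  by apply: (le_trans (fnormD _ (iFg m) iG)); apply: lerD.
- move=> e e0.
  have := cvg_geometric_pow (D * K) r01 e0; apply: filterS => m hm.
  apply: le_lt_trans (hK _ (D * r ^+ m) _ (iFg m) (Ffg m)) _.
    by rewrite mulr_ge0 // exprn_ge0.
  by rewrite lte_fin mulrAC.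
Qed.

Lemma admissible_data_norm (X : data_space R) : admissible X ->
  [/\ (data_norm X g < +oo)%E, (forall m, data_norm X (f m) < +oo)%E &
      forall e : R, 0 < e -> \forall m \near \oo,
        (data_norm X (fun x => (f m x - g x)%R) < e%:E)%E].
Proof. by case: X => [s|p]; [exact: Sobolev_data_norm|exact: Lebesgue_data_norm]. Qed.

End data_norms.

(** * Compactly supported data as Schwartz and test functions *)

Section compactly_supported.
Context {R : realType} {n : nat}.
Implicit Types (F : 'rV[R]_n -> R).

Lemma cpds_real F s : cpds s (fun x => (F x)%:C) = fun x => (pds s F x)%:C.
Proof.
elim: s => //= i s ->; apply/funext => x; rewrite /cpd /=.
by rewrite [X in _ +i* X](_ : _ = 0) // /pd derive_cst.
Qed.

Lemma pds_rbox F L s : (forall x, ~ rbox n L x -> F x = 0) ->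
  forall x, ~ rbox n L x -> pds s F x = 0.
Proof. by move=> F0; elim: s => //= i s IH; exact: pd_rbox. Qed.

Lemma enorm_rbox (x : 'rV[R]_n) : rbox n 1 x -> enorm x <= Num.sqrt n%:R.
Proof.
move=> hx; rewrite /enorm ler_wsqrtr //.
rewrite (_ : n%:R = \sum_(i < n) 1); last by rewrite sumr_const card_ord.
apply: ler_sum => i _; rewrite -real_normK ?num_real // exprn_ile1 //; exact: hx.
Qed.

Definition flatgen_schwartz F (fF : flatgen F) (F0 : forall x, ~ rbox n 1 x -> F x = 0) :
  schwartz R n.
Proof.
exists (fun x => (F x)%:C); first exact: csmooth_real.
move=> m s.
have [C C0 hC] := bounded_rbox (flatgen_continuous (flatgen_pds s fF)) (pds_rbox s F0).
exists ((1 + Num.sqrt n%:R) ^+ m * C) => x; rewrite cpds_real.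
have -> : cmod (pds s F x)%:C = `|pds s F x| by rewrite /= expr0n addr0 sqrtr_sqr.
have e0 : 0 <= 1 + enorm x by rewrite addr_ge0 // sqrtr_ge0.
have s0 : 0 <= 1 + Num.sqrt n%:R :> R by rewrite addr_ge0 // sqrtr_ge0.
have [xL|xL] := pselect (rbox n 1 x); last first.
  by rewrite (pds_rbox s F0 xL) normr0 mulr0 mulr_ge0 // exprn_ge0.
apply: ler_pM => //; first exact: exprn_ge0.
by rewrite lerXn2r ?nnegrE // lerD2l; exact: enorm_rbox.
Defined.

Definition flatgen_test F (fF : flatgen F) (F0 : forall x, ~ rbox n 1 x -> F x = 0) :
  test_function [set: 'rV[R]_n].
Proof.
exists (fun x => (F x)%:C); first exact: csmooth_real.
exists (rbox n 1); split => //; first exact: compact_rbox.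
by move=> x /F0 ->.
Defined.

End compactly_supported.

(** * Unboundedness in L^2 *)

Section bump_sums.
Context {R : realType} {n : nat}.
Local Notation mu := (lebesgue_rV n).
Variable idx : 'rV[R]_n -> nat.
Hypothesis disj : forall x k, k != idx x -> @tbump R n k x = 0.
Local Notation f := (psum (@tbump R n)).
Local Notation g := (tsum (@tbump R n) idx).

Lemma flatgen_tbump k : flatgen (@tbump R n k).
Proof.
apply: flatgen_prod => i; apply: flatgen_mul; first exact: flatgen_cst.
have fl : flatgen (fun x : 'rV[R]_n => lam k * x ord0 i).
  by apply: flatgen_mul; [exact: flatgen_cst|exact: flatgen_coord].
apply: flatgen_mul; apply: flatgen_flat; apply: flatgen_add => //.
- exact: flatgen_cst.
- exact: flatgen_cst.
- exact: flatgen_opp.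
Qed.

Lemma flatgen_f m : flatgen (f m).
Proof. by apply: flatgen_sum => k; exact: flatgen_tbump. Qed.

Lemma tbump_rbox k x : ~ rbox n 1 x -> @tbump R n k x = 0.
Proof.
move=> nx; apply/eqP/negPn/negP => kx; apply: nx => i.
have /andP[h1 h2] := tbump_coord kx i.
by rewrite gtr0_norm //; lra.
Qed.

Lemma f_rbox m x : ~ rbox n 1 x -> f m x = 0.
Proof. by move=> nx; rewrite /psum big1 // => k _; exact: tbump_rbox. Qed.

Lemma integrable_flatgen_rbox (F : 'rV[R]_n -> R) : flatgen F ->
  (forall x, ~ rbox n 1 x -> F x = 0) -> mu.-integrable setT (EFin \o F).
Proof. by move=> /flatgen_continuous; exact: integrable_continuous_rbox. Qed.

Lemma integrable_f_sqr m : mu.-integrable setT (EFin \o (fun x => f m x ^+ 2)).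
Proof.
apply: integrable_flatgen_rbox => [|x /f_rbox ->]; last by rewrite expr0n.
by apply: flatgen_mul; exact: flatgen_f.
Qed.

(** Disjoint supports make the squares add up, and each bump contributes at least the same
    constant. *)
Lemma f_L2_unbounded : exists2 c : R, 0 < c & forall m, c *+ m <= \int[mu]_x (f m x ^+ 2).
Proof.
have [c c0 hc] := @tbump_sqr R n; exists c => // m.
have iB k : mu.-integrable setT (EFin \o (fun x => @tbump R n k x ^+ 2)).
  apply: integrable_flatgen_rbox => [|x /tbump_rbox ->]; last by rewrite expr0n.
  by apply: flatgen_mul; exact: flatgen_tbump.
under eq_Rintegral do rewrite (psum_sqr disj).
rewrite (@Rintegral_fsum _ _ _ mu _ _ (fun (k : 'I_m) x => tbump k x ^+ 2)) //.
apply: (@le_trans _ _ (\sum_(k < m) c)); first by rewrite sumr_const card_ord.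
by apply: ler_sum => k _; exact: hc.
Qed.

(* If [g] were square integrable, then [int f_m^2 = <g, f_m>] would bound the L^2
   norm of [f_m] by that of [g]. *)
Lemma g_not_L2 N (k0 : 'I_N) : ~ (Lp_norm 2 (spinor_pairing k0 g) < +oo)%E.
Proof.
move=> /ereal_inf_lt[_ [h rep <-]].
rewrite unlock => hfin.
have fin : (\int[mu]_x (`|(cvnorm (h x))%:E| `^ 2) < +oo)%E.
  by apply: lty_poweRy hfin; rewrite invr_eq0 pnatr_eq0.
have mcv : measurable_fun setT ((fun x => cvnorm (h x)) : _ -> measurableTypeR R).
  apply: (measurableT_comp (continuous_measurable_fun (@sqrt_continuous R))).
  rewrite (_ : (fun x => _) = fun x => \sum_k (complex.Re (h x k ord0) ^+ 2 + complex.Im (h x k ord0) ^+ 2)).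
    by apply: measurable_sum => k; have [[m1 m2] _] := rep k; apply: measurable_funD; exact: measurable_funX.
  apply/funext => x; apply: eq_bigr => k _; case: (h x k ord0) => p q /=.
  by rewrite sqr_sqrtr // addr_ge0 // sqr_ge0.
have [mh hr] := rep k0.
(* [h] is any square-integrable representative of the datum; the real part of its component [k0] is
   enough for testing against real functions. *)
pose a x : R := complex.Re (h x k0 ord0).
have ma : measurable_fun setT (a : _ -> measurableTypeR R) by case: mh.
have ia : mu.-integrable setT (EFin \o (fun x => a x ^+ 2)).
  apply/integrableP; split; first by apply/measurable_EFinP; exact: measurable_funX.
  apply: le_lt_trans fin; apply: ge0_le_integral => //.
  - by apply: measurableT_comp => //; apply/measurable_EFinP; exact: measurable_funX.
  - apply: (measurableT_comp (measurable_poweR _)); apply: measurableT_comp => //.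
    exact/measurable_EFinP.
  - move=> x _; rewrite /= lee_fin ger0_norm ?sqr_ge0 // powR_mulrn ?normr_ge0 //.
    rewrite real_normK ?num_real // /cvnorm sqr_sqrtr; last first.
      by apply: sumr_ge0 => k _; exact: sqr_ge0.
    rewrite (bigD1 k0) //= (@le_trans _ _ (cmod (h x k0 ord0) ^+ 2)) //.
      rewrite -[X in X <= _]real_normK ?num_real // lerXn2r ?nnegrE ?cmod_ge0 //.
      exact: norm_Re_le.
    by rewrite lerDl sumr_ge0 // => k _; exact: sqr_ge0.
have [c c0 hc] := f_L2_unbounded.
have bound m : c *+ m <= \int[mu]_x (a x ^+ 2).
  apply: (le_trans (hc m)).
  pose phi := flatgen_schwartz (flatgen_f m) (@f_rbox m).
  have [[ir _]] := hr phi.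
  rewrite /spinor_pairing eqxx pairingE /cintegral => -[].
  have -> : \int[mu]_x (g x * complex.Re (phi x)) = \int[mu]_x (f m x ^+ 2).
    by apply: eq_Rintegral => x _; rewrite /= (psumM disj).
  move=> E _.
  have E1 : (fun x => complex.Re (h x k0 ord0 * phi x)) = fun x => a x * f m x.
    by apply/funext => x; rewrite /a /phi /=; case: (h x k0 ord0) => p q /=; ring.
  rewrite E1 in E; rewrite (_ : (fun x => _) = EFin \o (fun x => a x * f m x)) in ir; last first.
    by apply/funext => x; rewrite -[in RHS]E1.
  have i2 := integrable_f_sqr m.
  have ih : mu.-integrable setT (EFin \o (fun x => 2^-1 * a x ^+ 2 + 2^-1 * f m x ^+ 2)).
    exact: (integrableD measurableT (integrableZl measurableT 2^-1 ia) (integrableZl measurableT 2^-1 i2)).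
  (* The left side equals the integral of [f m ^+ 2], so half of it is absorbed and a bound
     independent of [m] remains. *)
  have : \int[mu]_x (a x * f m x) <= \int[mu]_x (2^-1 * a x ^+ 2 + 2^-1 * f m x ^+ 2).
    apply: (le_Rintegral measurableT ir ih) => x _.
    by have := sqr_ge0 (a x - f m x); rewrite sqrrB; lra.
  rewrite (RintegralD measurableT (integrableZl measurableT 2^-1 ia) (integrableZl measurableT 2^-1 i2)).
  rewrite RintegralZl ; [|exact: measurableT|exact: ia].
  rewrite RintegralZl -?E; [|exact: measurableT|exact: i2].
  lra.
have [m hm] : exists m : nat, \int[mu]_x (a x ^+ 2) < c *+ m.
  exists (Num.truncn (\int[mu]_x (a x ^+ 2) / c)).+1.
  rewrite -mulr_natl -ltr_pdivrMr //; exact: truncnS_gt.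
by have := bound m; rewrite leNgt hm.
Qed.

End bump_sums.

(** * The contradiction with continuity *)

Section ill_posedness.
Context {R : realType} {d : nat}.
Local Notation N := (spinor_dim d).
Local Notation nu := (lebesgue_rV d).
Implicit Types (F G : 'rV[R]_d -> R).

Lemma spinor_pairingB (k0 : 'I_N) F G : nu.-integrable setT (EFin \o F) ->
  nu.-integrable setT (EFin \o G) ->
  (fun k phi => spinor_pairing k0 F k phi - spinor_pairing k0 G k phi) =
  spinor_pairing k0 (fun x => F x - G x).
Proof.
move=> iF iG; apply/funext => k; apply/funext => phi; rewrite /spinor_pairing.
case: ifP => _; last by rewrite subrr.
have [f1 f2] := integrable_pairing phi iF; have [g1 g2] := integrable_pairing phi iG.
rewrite !pairingE; apply/eqP; rewrite eq_complex /=; apply/andP; split; apply/eqP.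
- rewrite -(RintegralB measurableT f1 g1); apply: eq_Rintegral => x _; by rewrite mulrBl.
- rewrite -(RintegralB measurableT f2 g2); apply: eq_Rintegral => x _; by rewrite mulrBl.
Qed.

Lemma data_dist_spinor X (k0 : 'I_N) F G iF iG :
  data_dist X (@spinor_density R d N k0 F iF) (@spinor_density R d N k0 G iG) =
  data_norm X (spinor_pairing k0 (fun x => F x - G x)).
Proof.
rewrite /data_dist -(spinor_pairingB k0 iF iG); congr (data_norm X _).
apply/funext => k; apply/funext => phi.
by rewrite -(spinor_densityE k0 iF) -(spinor_densityE k0 iG).
Qed.

Lemma cmod_real (a : R) : cmod a%:C = `|a|.
Proof. by rewrite /= expr0n addr0 sqrtr_sqr. Qed.

(** On the cube that carries the bumps, [1/16 + x_j] and [1/16 - x_j] are both at least 1/32. *)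
Lemma theta_ge (x : 'rV[R]_d) : (forall j, 0 < x ord0 j < 32^-1) ->
  (bump_half 32^-1 * bump_half 32^-1) ^+ d <= theta (row_cons (0, x)).
Proof.
move=> hx; rewrite /theta -[in X in X <= _](card_ord d) -prodr_const.
apply: ler_prod => j _; rewrite mulr_ge0 ?bump_half_ge0 //=.
rewrite row_cons0 row_consS /=; have /andP[x0 x1] := hx j.
by apply: ler_pM; rewrite ?bump_half_ge0 //; apply: bump_half_mono; lra.
Qed.

End ill_posedness.

Local Close Scope complex_scope.
Local Close Scope sesquilinear_scope.

Theorem theorem1 (R : realType) (d : nat) (M : R)
    (gamma : 'I_d.+1 -> 'M[R[i]]_(spinor_dim d)) (X : data_space R) :
  (1 <= d <= 3)%N -> 0 <= M -> dirac_matrices gamma -> admissible X ->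
  exists psi_bad : 'I_(spinor_dim d) -> tempered R d,
    [/\ in_space X psi_bad,
        ~ in_space (Lebesgue 2) psi_bad &
        forall (T : R) (Omega : set ('I_(spinor_dim d) -> tempered R d)),
          0 < T -> neighbourhood X psi_bad Omega ->
          ~ exists S : ('I_(spinor_dim d) -> tempered R d) ->
                       fields (@cone_interior R d T),
              continuous_data_map X Omega S /\
              solves_smooth_data M gamma Omega S].
Proof.
move=> /andP[d1 d3] _ hg adm.
have N0 : (0 < spinor_dim d)%N by rewrite /spinor_dim; case: ifP.
pose k0 := Ordinal N0.
have [idx disj] := @tbump_index R d d1.
pose f m : 'rV[R]_d -> R := psum (@tbump R d) m.
pose g : 'rV[R]_d -> R := tsum (@tbump R d) idx.
have iF m : (lebesgue_rV d).-integrable setT (EFin \o f m) by exact: integrable_f.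
have iG : (lebesgue_rV d).-integrable setT (EFin \o g) by exact: integrable_g.
pose u m := spinor_density k0 (iF m).
pose psi := spinor_density k0 iG.
have [ng nf nfg] := admissible_data_norm k0 d1 disj adm.
have psi_in : in_space X psi by rewrite /in_space spinor_densityE.
exists psi; split=> //.
  by rewrite /in_space spinor_densityE; exact: g_not_L2.
move=> T Omega T0 [_ [e e0 Omega_e]] [S [contS solS]].
have Omega_psi : Omega psi.
  apply: Omega_e => //; rewrite data_dist_spinor (_ : (fun x => _) = fun=> 0); last first.
    by apply/funext => x; rewrite subrr.
  by apply: le_lt_trans (data_norm0 k0 d1 adm) _; rewrite lte_fin.
(* The weight must live before time [T] and also where [theta] has its support in the slabs. *)
pose tau : R := Num.min T 16^-1.
have tau0 : 0 < tau by rewrite lt_min T0 /= invr_gt0.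
have tau1 : tau <= 16^-1 by rewrite ge_min lexx orbT.
have tauT : tau <= T by rewrite ge_min lexx.
pose phi := box_weight_test d3 tau0 tau1 tauT.
(* Continuity at the bad datum, with tolerance 1, bounds the pairings of all late partial sums with
   this one test function. *)
have [delta delta0 Sdelta] := contS psi Omega_psi phi 1 ltr01.
have ed0 : 0 < Num.min e delta by rewrite lt_min e0.
have [m0 _ hm0] := nfg _ ed0.
pose B : R := 1 + cmod ((S psi).2 ord0 phi).
have bounded m : (m0 <= m)%N -> Omega (u m) /\ cmod ((S (u m)).2 ord0 phi) <= B.
  move=> /hm0 /= hm.
  have Om : Omega (u m).
    apply: Omega_e; first by rewrite /in_space spinor_densityE; exact: nf.
    by rewrite data_dist_spinor; apply: lt_le_trans hm _; rewrite lee_fin ge_min lexx.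
  split=> //; have [|_ /(_ ord0) h1] := Sdelta (u m) Om.
    by rewrite data_dist_spinor; apply: lt_le_trans hm _; rewrite lee_fin ge_min lexx orbT.
  rewrite /B -[X in cmod X](subrK ((S psi).2 ord0 phi)) -lecR rmorphD.
  apply: le_trans (@ler_normD _ R[i] _ _) _; rewrite lerD2r.
  by rewrite [leLHS]/Num.norm /= lecR ltW.
have [c c0 hc] := f_L2_unbounded disj.
pose ct : R := (bump_half 32^-1 * bump_half 32^-1) ^+ d.
have ct0 : 0 < ct by rewrite exprn_gt0 // mulr_gt0 // bump_half_gt0 // invr_gt0.
pose ch : R := bump_half (bump_half (tau / 3)).
have ch0 : 0 < ch by do 2!apply: bump_half_gt0; rewrite divr_gt0.
have growth m : Omega (u m) -> ch * (ct * (c *+ m)) <= cmod ((S (u m)).2 ord0 phi).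
  move=> Om.
  have f0 (x : 'rV[R]_d) : ~ rbox d 1 x -> (fun=> 0 : R) x = 0 by [].
  pose F k := if k == k0 then flatgen_test (flatgen_f m) (@f_rbox R d m)
              else flatgen_test (flatgen_cst 0) f0.
  have FE k x : F k x = if k == k0 then (f m x)%:C%C else 0 by rewrite /F; case: ifP.
  (* The partial sum is a smooth, compactly supported datum, so [S] has to return a classical
     solution. *)
  have [|psi' [A [sm [_ isA] sol cd]]] := solS (u m) F Om.
    move=> k p; rewrite /u /spinor_density; under eq_fun do rewrite FE.
    by case: ifP => // _; rewrite cintegral0.
  rewrite (isA ord0 phi) (potential_pairing d3 tau0 tau1 tauT hg sm sol).
  have [ilow low] := pairing_lower_bound d3 tau0 tau1 tauT hg sm sol cd.
  have sumE x : \sum_k cmod (F k x) ^+ 2 = f m x ^+ 2.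
    under eq_bigr do rewrite FE.
    rewrite (bigD1 k0) // big1 => [|k /negPf kk0]; last by rewrite kk0 cmod0 expr0n.
    by rewrite eqxx cmod_real real_normK ?num_real /= ?addr0.
  rewrite cmod_real; apply: le_trans (ler_norm _); apply: le_trans low.
  have i2 := @integrable_f_sqr R d m.
  apply: (@le_trans _ _ (\int[lebesgue_rV d]_x (ch * ct * f m x ^+ 2))).
    rewrite RintegralZl; [|exact: measurableT|exact: i2].
    by rewrite mulrA ler_wpM2l //; apply/ltW/mulr_gt0.
  apply: (le_Rintegral measurableT _ ilow).
    exact: (integrableZl measurableT (ch * ct) i2).
  move=> x _; rewrite -mulrA ler_wpM2l ?(ltW ch0) // sumE.
  (* Where [f m] is nonzero some bump is, which places [x] in the cube where [theta_ge] applies. *)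
  have [->|fx] := eqVneq (f m x) 0; first by rewrite expr0n !mulr0.
  rewrite ler_wpM2r ?sqr_ge0 //; apply: theta_ge.
  have [k kx] : exists k, tbump k x != 0.
    apply: contrapT => /forallNP h; move/eqP: fx; apply; rewrite /f /psum big1 // => k _.
    by apply/eqP/negPn/negP; exact: h.
  exact: tbump_coord kx.
(* From this index on, the lower bound of [growth], linear in [m], exceeds the uniform bound [B]. *)
pose m1 := (Num.truncn (B / (ch * (ct * c)))).+1.
have [Om hB] := bounded (maxn m0 m1) (leq_maxl _ _).
have := le_trans (growth _ Om) hB; rewrite leNgt => /negP; apply.
have p0 : 0 < ch * (ct * c) by rewrite !mulr_gt0.
apply: (@lt_le_trans _ _ (ch * (ct * (c *+ m1)))).
  by rewrite !mulrnAr -mulr_natl -ltr_pdivrMr //; exact: truncnS_gt.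
by rewrite !ler_wpM2l ?(ltW ch0) ?(ltW ct0) // ler_wpMn2l ?leq_maxr // ltW.
Qed.
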